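(* Let $n\ge 1$ and let $X=\{\sigma_1,\dots,\sigma_K\}$ be a finite simplicial complex in $\mathbb{R}^n$ such that every $k$-simplex of $X$ with $k<n$ is a face of an $n$-simplex of $X$, the set $|X|$ is convex, and $X_k=\{\sigma_1,\dots,\sigma_k\}$ is a subcomplex of $X$ for every $1\le k\le K$. Let $\mathbb{X}: \emptyset=X_0\subset X_1\subset\cdots\subset X_K=X$, with homology coefficients in $\mathbb{Z}_2=\mathbb{Z}/2\mathbb{Z}$. Let $(V,E)$ be the result of the merge-tree algorithm (described in the context) applied to $\mathbb{X}$. Then: (i) $D_{n-1}(\mathbb{X})=\{(b,d)\mid (\sigma_d\xrightarrow{b}\sigma_s)\in E \text{ for some } \sigma_s\in V\}$. (ii) For each $(b,d)\in D_{n-1}(\mathbb{X})$, the optimal volume for $(b,d)$ is the set of all descendant nodes of $\sigma_d$ in $(V,E)$, including $\sigma_d$ itself. (iii) The persistence trees are determined by $(V,E)$ as follows: $(b_i,d_i)$ is a child of $(b_j,d_j)$ if and only if there are edges $\sigma_{d_i}\xrightarrow{b_i}\sigma_{d_j}\xrightarrow{b_j}\sigma_s$ in $E$ for some $\sigma_s\in V$.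
   Context: $|X|\subset\mathbb{R}^n$ is the union of the simplices of $X$. Coefficients are in $\mathbb{Z}_2$. The persistent homology $H_{n-1}(\mathbb{X})$ is the family $H_{n-1}(X_k)$, $0\le k\le K$, with the maps induced by inclusions; for $n=1$, reduced homology is used (with $\tilde H_0(\emptyset)=0$), and for $n\ge 2$ reduced and ordinary homology in degree $n-1$ coincide. It decomposes uniquely as $\bigoplus_{i=1}^p I(b_i,d_i)$, where the interval module $I(b,d)$ is $\mathbb{Z}_2$ at indices $k$ with $b\le k<d$ and $0$ elsewhere, with identity maps between the nonzero spaces and zero maps otherwise. The persistence diagram is $D_{n-1}(\mathbb{X})=\{(b_i,d_i)\mid i=1,\dots,p\}$. Optimal volumes. For an $(n-1)$-simplex $\sigma_k$, let $\sigma_k^*$ be the linear functional on $C_{n-1}(X)$ with $\sigma_k^*(\sigma_j)=\delta_{kj}$ for all $(n-1)$-simplices $\sigma_j$. For $(b_i,d_i)\in D_{n-1}(\mathbb{X})$ (with $d_i<\infty$) put $\mathcal{F}_m=\{\sigma_k \ m\text{-simplex}\mid b_i<k<d_i\}$. A chain $z\in C_n(X)$ is a persistent volume for $(b_i,d_i)$ if (1) $z=\sigma_{d_i}+\sum_{\sigma_k\in\mathcal{F}_n}\alpha_k\sigma_k$ for some $\alpha_k\in\mathbb{Z}_2$; (2) $\tau^*(\partial z)=0$ for all $\tau\in\mathcal{F}_{n-1}$; (3) $\sigma_{b_i}^*(\partial z)\ne 0$. The optimal volume for $(b_i,d_i)$ is the persistent volume $z$ minimizing the number of $n$-simplices with nonzero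 coefficient in $z$ (it exists and is unique in this setting). Since coefficients are in $\mathbb{Z}_2$, a chain in $C_n(X)$ is identified with the set of $n$-simplices having nonzero coefficient. Persistence trees. Any two optimal volumes of different pairs in $D_{n-1}(\mathbb{X})$ are disjoint or nested, so $D_{n-1}(\mathbb{X})$ is a forest under inclusion of optimal volumes; its trees are the persistence trees. Thus $(b_i,d_i)$ is a child of $(b_j,d_j)$ when the optimal volume of $(b_i,d_i)$ is properly contained in that of $(b_j,d_j)$ and no optimal volume of another pair lies strictly between them. Merge-tree algorithm. Let $\sigma_\infty=(\mathbb{R}^n\setminus|X|)\cup\{\infty\}$ be regarded as an additional $n$-cell of the one-point compactification $\mathbb{R}^n\cup\{\infty\}\simeq S^n$, with index $\infty$ larger than every integer. Every $(n-1)$-simplex of $X$ is a common face of exactly two $n$-cells of $X\cup\{\sigma_\infty\}$ (a boundary $(n-1)$-simplex of $|X|$ being a face of one $n$-simplex and of $\sigma_\infty$). The algorithm maintains a directed graph $(V,E)$ whose nodes are $n$-cells and whose edges carry an integer label; $(\sigma\xrightarrow{k}\tau)$ denotes the edge from $\sigma$ to $\tau$ with label $k$. The graph is always a forest, edges pointing from child to parent; the root of a node is obtained by following outgoing edges as long as possible, and the descendants of a node are the nodes from which there is a directed path to it. Initialize $V=\{\sigma_\infty\}$, $E=\emptyset$. For $k=K,K-1,\dots,1$: if $\sigma_k$ is an $n$-simplex, add $\sigma_k$ to $V$; if $\sigma_k$ is an $(n-1)$-simplex, let $\sigma_s,\sigma_t$ be the two $n$-cells whose common face is $\sigma_k$,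 and let $\sigma_{s'},\sigma_{t'}$ be the roots of $\sigma_s,\sigma_t$ in the current graph; if $s'=t'$ do nothing, if $s'>t'$ add $(\sigma_{t'}\xrightarrow{k}\sigma_{s'})$ to $E$, and if $s'<t'$ add $(\sigma_{s'}\xrightarrow{k}\sigma_{t'})$ to $E$; for simplices of other dimensions do nothing. The output is the final $(V,E)$. *)

(* Defs.v *)
From HB Require Import structures.
From mathcomp Require Import all_boot all_order all_algebra.
From mathcomp Require Import finmap.
From mathcomp Require Import all_classical all_reals all_analysis.

Set Implicit Arguments.
Unset Strict Implicit.
Unset Printing Implicit Defensive.

Import Order.TTheory GRing.Theory Num.Theory.
Import numFieldNormedType.Exports.

Local Open Scope ring_scope.

Section VectQuot.
Local Open Scope quotient_scope.
Variables (F : fieldType) (V : vectType F) (U : {vspace V}).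

Definition vquot : Type := Quotient.quot U.

HB.instance Definition _ := GRing.Zmodule.on vquot.

Definition vquot_pi (x : V) : vquot := \pi_(Quotient.quot U) x.
Definition vquot_repr (x : vquot) : V := repr (x : Quotient.quot U).

Lemma vquot_reprK x : vquot_pi (vquot_repr x) = x.
Proof. exact: reprK. Qed.

Lemma vquot_eq x y : vquot_pi x = vquot_pi y <-> x - y \in U.
Proof.
rewrite /vquot_pi; split=> [e|h].
  by rewrite Quotient.idealrBE; apply/eqP.
by apply/eqP; rewrite -Quotient.idealrBE.
Qed.

Lemma vquot_piB : {morph vquot_pi : x y / x - y}.
Proof. by move=> x y; rewrite /vquot_pi raddfB. Qed.

Lemma vquot_piD : {morph vquot_pi : x y / x + y}.
Proof. by move=> x y; rewrite /vquot_pi raddfD. Qed.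

Definition vquot_scale (a : F) (x : vquot) : vquot :=
  vquot_pi (a *: vquot_repr x).

Lemma vquot_piZ a x : vquot_scale a (vquot_pi x) = vquot_pi (a *: x).
Proof.
apply/vquot_eq; rewrite -scalerBr memvZ //.
by apply/vquot_eq; rewrite vquot_reprK.
Qed.

Fact vquot_scaleA a b x :
  vquot_scale a (vquot_scale b x) = vquot_scale (a * b) x.
Proof. by rewrite -(vquot_reprK x) !vquot_piZ scalerA. Qed.

Fact vquot_scale1 : left_id 1 vquot_scale.
Proof. by move=> x; rewrite -(vquot_reprK x) vquot_piZ scale1r. Qed.

Fact vquot_scaleDr : right_distributive vquot_scale +%R.
Proof.
move=> a x y; rewrite -(vquot_reprK x) -(vquot_reprK y) -vquot_piD !vquot_piZ.
by rewrite scalerDr vquot_piD.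
Qed.

Fact vquot_scaleDl x : {morph vquot_scale^~ x : a b / a + b}.
Proof.
by move=> a b; rewrite -(vquot_reprK x) !vquot_piZ scalerDl vquot_piD.
Qed.

HB.instance Definition _ := GRing.Zmodule_isLmodule.Build F vquot
  vquot_scaleA vquot_scale1 vquot_scaleDr vquot_scaleDl.

End VectQuot.

Section VectQuotMap.
Variables (F : fieldType) (V W : vectType F) (U : {vspace V}) (U' : {vspace W}).
Variables (f : {linear V -> W}) (fU : forall x, x \in U -> f x \in U').

Definition vquot_map of (forall x, x \in U -> f x \in U') :=
  fun x : vquot U => vquot_pi U' (f (vquot_repr x)).

Lemma vquot_mapE x : vquot_map fU (vquot_pi U x) = vquot_pi U' (f x).
Proof.
apply/vquot_eq; rewrite -linearB; apply: fU.
by apply/vquot_eq; rewrite vquot_reprK.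
Qed.

Fact vquot_map_linear : linear (vquot_map fU).
Proof.
move=> a x y; rewrite -(vquot_reprK x) -(vquot_reprK y).
rewrite [a *: vquot_pi _ _]vquot_piZ -vquot_piD !vquot_mapE.
by rewrite linearP vquot_piD [a *: vquot_pi _ _]vquot_piZ.
Qed.

HB.instance Definition _ :=
  GRing.isLinear.Build F (vquot U) (vquot U') _ (vquot_map fU) vquot_map_linear.

End VectQuotMap.

(* As [I] is finite, the product below is the direct sum. *)
Section DirectSum.
Variables (F : fieldType) (I : finType) (V : I -> lmodType F).

Definition dsum : Type := forall i, V i.

HB.instance Definition _ := gen_eqMixin dsum.
HB.instance Definition _ := gen_choiceMixin dsum.

Let add (x y : dsum) : dsum := fun i => x i + y i.
Let opp (x : dsum) : dsum := fun i => - x i.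
Let zero : dsum := fun=> 0.
Let scale a (x : dsum) : dsum := fun i => a *: x i.

Fact dsum_addA : associative add.
Proof. by move=> x y z; apply: functional_extensionality_dep => i; exact: addrA. Qed.
Fact dsum_addC : commutative add.
Proof. by move=> x y; apply: functional_extensionality_dep => i; exact: addrC. Qed.
Fact dsum_add0 : left_id zero add.
Proof. by move=> x; apply: functional_extensionality_dep => i; exact: add0r. Qed.
Fact dsum_addN : left_inverse zero opp add.
Proof. by move=> x; apply: functional_extensionality_dep => i; exact: addNr. Qed.

HB.instance Definition _ :=
  GRing.isZmodule.Build dsum dsum_addA dsum_addC dsum_add0 dsum_addN.

Fact dsum_scaleA a b x : scale a (scale b x) = scale (a * b) x.
Proof. by apply: functional_extensionality_dep => i; exact: scalerA. Qed.
Fact dsum_scale1 : left_id 1 scale.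
Proof. by move=> x; apply: functional_extensionality_dep => i; exact: scale1r. Qed.
Fact dsum_scaleDr : right_distributive scale +%R.
Proof. by move=> a x y; apply: functional_extensionality_dep => i; exact: scalerDr. Qed.
Fact dsum_scaleDl x : {morph scale^~ x : a b / a + b}.
Proof. by move=> a b; apply: functional_extensionality_dep => i; exact: scalerDl. Qed.

HB.instance Definition _ := GRing.Zmodule_isLmodule.Build F dsum
  dsum_scaleA dsum_scale1 dsum_scaleDr dsum_scaleDl.

End DirectSum.

Section DirectSumMap.
Variables (F : fieldType) (I : finType) (V W : I -> lmodType F).
Variable f : forall i, {linear V i -> W i}.

Definition dsum_map (x : dsum V) : dsum W := fun i => f i (x i).

Fact dsum_map_linear : linear dsum_map.
Proof.
by move=> a x y; apply: functional_extensionality_dep => i; exact: linearP.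
Qed.

HB.instance Definition _ :=
  GRing.isLinear.Build F (dsum V) (dsum W) _ dsum_map dsum_map_linear.

End DirectSumMap.

Record pmodule (F : fieldType) (N : nat) := PModule {
  pm_space :> 'I_N -> lmodType F;
  pm_map : forall j k : 'I_N, (j <= k)%N -> {linear pm_space j -> pm_space k};
  pm_map_id : forall (j : 'I_N) (jj : (j <= j)%N) x, pm_map jj x = x;
  pm_map_comp : forall (i j k : 'I_N) (ij : (i <= j)%N) (jk : (j <= k)%N)
    (ik : (i <= k)%N) x, pm_map jk (pm_map ij x) = pm_map ik x }.

Arguments pm_map {F N} p {j k} jk.

Definition pm_iso (F : fieldType) (N : nat) (M M' : pmodule F N) : Prop :=
  exists phi : forall k, {linear M k -> M' k},
    (forall k, bijective (phi k)) /\
    (forall (j k : 'I_N) (jk : (j <= k)%N) (x : M j),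
       phi k (pm_map M jk x) = pm_map M' jk (phi j x)).

Section Interval.
Variables (F : fieldType) (N : nat) (p : 'I_N * option 'I_N).

(* The death index [None] is infinity. *)
Definition in_interval (k : 'I_N) : bool :=
  (p.1 <= k)%N && (if p.2 is Some d then (k < d)%N else true).

(* ['rV_1] on the interval and ['rV_0] off it; [pid_mx 1] is the identity
   matrix between two nonzero spaces and an empty matrix otherwise. *)
Definition interval_space (k : 'I_N) : lmodType F := 'rV[F]_(in_interval k).

Definition interval_map (j k : 'I_N) of (j <= k)%N :
    {linear interval_space j -> interval_space k} :=
  mulmxr (pid_mx 1 : 'M[F]_(in_interval j, in_interval k)).

Fact interval_map_id (j : 'I_N) (jj : (j <= j)%N) x : interval_map jj x = x.
Proof.
have idP (b : bool) (v : 'rV[F]_b) : v *m pid_mx 1 = v.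
  case: b v => v /=; first by rewrite pid_mx_1 mulmx1.
  by rewrite [v]thinmx0 mul0mx.
exact: idP.
Qed.

Fact interval_map_comp (i j k : 'I_N) (ij : (i <= j)%N) (jk : (j <= k)%N)
  (ik : (i <= k)%N) x :
  interval_map jk (interval_map ij x) = interval_map ik x.
Proof.
have comp (a b c : bool) : (a -> c -> b) ->
    (pid_mx 1 : 'M[F]_(a, b)) *m pid_mx 1 = pid_mx 1 :> 'M[F]_(a, c).
  case: a; last by move=> _; rewrite [LHS]flatmx0 [RHS]flatmx0.
  case: c; last by move=> _; rewrite [LHS]thinmx0 [RHS]thinmx0.
  by case: b => [_|/(_ isT isT)//]; rewrite !pid_mx_1 mulmx1.
rewrite /interval_map /= -mulmxA comp // /in_interval.
move=> /andP[bi _] /andP[_]; rewrite (leq_trans bi ij) /=.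
by case: p.2 => // d; exact: leq_ltn_trans.
Qed.

Definition interval_module : pmodule F N :=
  PModule interval_map_id interval_map_comp.

End Interval.

Section DirectSumModule.
Variables (F : fieldType) (N : nat) (I : finType) (M : I -> pmodule F N).

Definition pm_dsum_space (k : 'I_N) : lmodType F := dsum (fun i => M i k).

Definition pm_dsum_map (j k : 'I_N) (jk : (j <= k)%N) :
    {linear pm_dsum_space j -> pm_dsum_space k} :=
  dsum_map (fun i => pm_map (M i) jk).

Fact pm_dsum_map_id (j : 'I_N) (jj : (j <= j)%N) x : pm_dsum_map jj x = x.
Proof. by apply: functional_extensionality_dep => i; exact: pm_map_id. Qed.

Fact pm_dsum_map_comp (i j k : 'I_N) (ij : (i <= j)%N) (jk : (j <= k)%N)
  (ik : (i <= k)%N) x :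
  pm_dsum_map jk (pm_dsum_map ij x) = pm_dsum_map ik x.
Proof. by apply: functional_extensionality_dep => l; exact: pm_map_comp. Qed.

Definition pm_dsum : pmodule F N := PModule pm_dsum_map_id pm_dsum_map_comp.

End DirectSumModule.

(* Diagrams are multisets, given by a list up to permutation. Empty intervals
   are excluded, as they could otherwise be added freely. *)
Definition is_pdiagram (F : fieldType) (N : nat) (M : pmodule F N)
    (D : seq ('I_N * option 'I_N)) : Prop :=
  (forall p, p \in D -> in_interval p p.1) /\
  pm_iso M (pm_dsum (fun i : 'I_(size D) => interval_module F (tnth (in_tuple D) i))).

(* A filtration sigma_1, ..., sigma_K is the list [X] of its simplices, a simplex
   being its finite set of vertices. Indices range over 0, ..., K, where index 0
   carries the empty simplex (of dimension -1): the boundary of a vertex is then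
   the empty simplex, so homology in degree 0 is reduced. *)
Section Filtration.
Local Open Scope fset_scope.
Local Open Scope ring_scope.
Variables (P : choiceType) (X : seq {fset P}).

Definition idx : predArgType := 'I_(size X).+1.

Definition simp (i : idx) : {fset P} := nth fset0 (fset0 :: X) i.

Definition has_dim (m : nat) (s : {fset P}) : bool := #|` s| == m.+1.

Definition is_face (t s : {fset P}) : bool := (t != fset0) && (t `<=` s).

Definition face_closed (Y : seq {fset P}) : Prop :=
  forall s t, s \in Y -> is_face t s -> t \in Y.

Definition chain : vectType 'F_2 := 'rV['F_2]_((size X).+1).

Definition elem (i : idx) : chain := delta_mx 0 i.
Definition coef (i : idx) (z : chain) : 'F_2 := z 0 i.
Definition supp (z : chain) : {set idx} := [set i | coef i z != 0].

Definition boundary_mx : 'M['F_2]_((size X).+1) :=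
  \matrix_(i, j) ((simp j `<=` simp i) && (#|` simp i| == #|` simp j|.+1))%:R.

Definition boundary : 'End(chain) := linfun (mulmxr boundary_mx).

(* C_m(X_k), Z_m(X_k) and B_m(X_k), with X_k = {sigma_1, ..., sigma_k}, as
   subspaces of the space of all chains of X. *)
Definition chains (m : nat) (k : idx) : {vspace chain} :=
  <<[seq elem i | i <- enum (idx : predArgType) & has_dim m (simp i) && (i <= k)%N]>>%VS.
Definition cycles m k : {vspace chain} := (chains m k :&: lker boundary)%VS.
Definition boundaries m k : {vspace chain} := (boundary @: chains m.+1 k)%VS.

Lemma chains_mono m (j k : idx) : (j <= k)%N -> (chains m j <= chains m k)%VS.
Proof.
move=> jk; apply: sub_span => c /mapP[i]; rewrite mem_filter.
move=> /andP[/andP[di ij] ie] ->; apply: map_f.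
by rewrite mem_filter di ie (leq_trans ij jk).
Qed.

Lemma cycles_mono m (j k : idx) : (j <= k)%N -> (cycles m j <= cycles m k)%VS.
Proof. by move=> jk; apply: capvS => //; exact: chains_mono. Qed.

Lemma boundaries_mono m (j k : idx) :
  (j <= k)%N -> (boundaries m j <= boundaries m k)%VS.
Proof. by move=> jk; apply: limgS; exact: chains_mono. Qed.

Definition cycle_boundaries m k : {vspace subvs_of (cycles m k)} :=
  (linfun (vsval : subvs_of (cycles m k) -> chain) @^-1: boundaries m k)%VS.

Definition homology m k : lmodType 'F_2 := vquot (cycle_boundaries m k).

Section InclusionMap.
Variables (m : nat) (j k : idx) (jk : (j <= k)%N).

Definition cycle_incl : subvs_of (cycles m j) -> subvs_of (cycles m k) :=
  vsproj (cycles m k) \o vsval.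

HB.instance Definition _ := GRing.Linear.on cycle_incl.

Lemma cycle_inclE x : vsval (cycle_incl x) = vsval x.
Proof. by rewrite vsprojK // (subvP (cycles_mono m jk)) // subvsP. Qed.

Lemma cycle_incl_boundaries x :
  x \in cycle_boundaries m j -> cycle_incl x \in cycle_boundaries m k.
Proof.
rewrite -!memv_preim !lfunE /= cycle_inclE.
exact: (subvP (boundaries_mono m jk)).
Qed.

Definition homology_map : {linear homology m j -> homology m k} :=
  vquot_map cycle_incl_boundaries.

End InclusionMap.

Fact homology_map_id m (j : idx) (jj : (j <= j)%N) x : homology_map m jj x = x.
Proof.
rewrite -(vquot_reprK x) [LHS]vquot_mapE; congr vquot_pi.
by apply: val_inj; rewrite /= cycle_inclE.
Qed.

Fact homology_map_comp m (i j k : idx) (ij : (i <= j)%N) (jk : (j <= k)%N)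
  (ik : (i <= k)%N) x :
  homology_map m jk (homology_map m ij x) = homology_map m ik x.
Proof.
rewrite -(vquot_reprK x) /homology_map /=.
rewrite !vquot_mapE; congr vquot_pi.
by apply: val_inj; rewrite /= !cycle_inclE.
Qed.

Definition persistent_homology m : pmodule 'F_2 (size X).+1 :=
  PModule (homology_map_id (m := m)) (homology_map_comp (m := m)).

Variable n : nat.

(* Only pairs with a finite death index have persistent volumes. *)
Definition persistent_volume (p : idx * option idx) (z : chain) : Prop :=
  if p is (b, Some d) then
    [/\ z \in chains n ord_max,
        exists alpha : idx -> 'F_2,
          z = elem d +
              \sum_(k : idx | has_dim n (simp k) && (b < k < d)%N) alpha k *: elem k,
        forall t : idx, has_dim n.-1 (simp t) -> (b < t < d)%N ->
          coef t (boundary z) = 0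
      & coef b (boundary z) != 0]
  else False.

Definition optimal_volume (p : idx * option idx) (z : chain) : Prop :=
  persistent_volume p z /\
  forall z', persistent_volume p z' -> (#|supp z| <= #|supp z'|)%N.

Definition is_child (D : seq (idx * option idx)) (p q : idx * option idx) : Prop :=
  exists zp zq, [/\ optimal_volume p zp, optimal_volume q zq,
    supp zp \proper supp zq
  & ~ exists r zr, [/\ r \in D, optimal_volume r zr,
        supp zp \proper supp zr & supp zr \proper supp zq]].

End Filtration.

Section Geometry.
Local Open Scope fset_scope.
Local Open Scope ring_scope.
Local Open Scope classical_set_scope.
Variables (R : realType) (n : nat).
Local Notation point := 'rV[R]_n.

Definition affinely_independent (s : {fset point}) : Prop :=
  forall lam : point -> R, \sum_(v <- s) lam v = 0 ->
    \sum_(v <- s) lam v *: v = 0 -> forall v, v \in s -> lam v = 0.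

Definition hull (s : {fset point}) : set point :=
  [set x | exists lam : point -> R,
     [/\ forall v, v \in s -> 0 <= lam v, \sum_(v <- s) lam v = 1
       & x = \sum_(v <- s) lam v *: v]].

Definition simplicial_complex (X : seq {fset point}) : Prop :=
  [/\ forall s, s \in X -> s != fset0 /\ affinely_independent s,
      face_closed X
    & forall s t, s \in X -> t \in X -> hull s `&` hull t !=set0 ->
        exists r, [/\ is_face r s, is_face r t & hull s `&` hull t = hull r]].

Definition polyhedron (X : seq {fset point}) : set point :=
  [set x | exists2 s, s \in X & hull s x].

End Geometry.

Section MergeTree.
Variables (R : realType) (n : nat) (X : seq {fset 'rV[R]_n}).

(* An n-cell is an n-simplex [Some k] or sigma_infinity, which is [None]. *)
Definition cell : predArgType := option (idx X).
Definition edge : predArgType := (cell * idx X * cell)%type.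

Definition cell_lt (c d : cell) : bool :=
  match c, d with
  | Some i, Some j => (i < j)%N
  | Some _, None => true
  | None, _ => false
  end.

(* A simplex is a face of sigma_infinity when it lies in its closure, that is,
   in the topological boundary of |X|. *)
Definition cell_face (k : idx X) (c : cell) : bool :=
  if c is Some i then has_dim n (simp i) && is_face (simp k) (simp i)
  else `[< (hull (simp k) `<=` closure (~` polyhedron X))%classic >].

Definition out_edge (E : {set edge}) (c : cell) : option edge :=
  [pick e in E | e.1.1 == c].

(* In a forest a directed path has at most [#|E|] edges. *)
Definition cell_root (E : {set edge}) (c : cell) : cell :=
  iter #|E| (fun c => if out_edge E c is Some e then e.2 else c) c.

Definition descendants (V : {set cell}) (E : {set edge}) (c : cell) : {set cell} :=
  [set x in V | connect [rel x y : cell | [exists k, (x, k, y) \in E]] x c].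

(* When |X| is convex and X is pure, an (n-1)-simplex is a face of exactly two
   n-cells; the graph is left unchanged in the other cases. *)
Definition merge_step (k : idx X) (G : {set cell} * {set edge}) :
    {set cell} * {set edge} :=
  let: (V, E) := G in
  if has_dim n (simp k) then (Some k |: V, E)
  else if has_dim n.-1 (simp k) then
    if [seq c <- enum cell | cell_face k c] is [:: s; t] then
      let s' := cell_root E s in
      let t' := cell_root E t in
      if cell_lt t' s' then (V, (t', k, s') |: E)
      else if cell_lt s' t' then (V, (s', k, t') |: E)
      else (V, E)
    else (V, E)
  else (V, E).

(* [foldr] starts from the last element of the list: k = K, K - 1, ..., 1. *)
Definition merge_tree : {set cell} * {set edge} :=
  foldr merge_step ([set None], finset.set0) [seq k : idx X <- enum (idx X) | (0 < k)%N].

End MergeTree.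

(* Main.v *)
Require Import Defs.
From HB Require Import structures.
From mathcomp Require Import all_boot all_order all_algebra.
From mathcomp Require Import finmap.
From mathcomp Require Import all_classical all_reals all_analysis.
From mathcomp Require Import ring lra.

(** The argument is planar duality read off the adjacency graph of the n-cells: its
nodes are the n-simplices and the outer cell, its edges are the (n-1)-simplices,
called facets below, each joining its two cofaces.  An n-chain is a function on
the nodes that vanishes at the outer cell, and its boundary is the set of edges
across which it changes ([facet_cells]).  Two topological facts make this a complete
description of the homology in degree n-1: an n-chain is determined by its boundary
([boundary_inj]) and every (n-1)-cycle is a boundary ([cycle_bounds]).

Both facts come from one parity statement ([radon_parity]): a point in general
position with respect to n+2 points of R^n lies in an even number of the n+2 simplices
obtained by omitting one of them.  For a chain c of (n-1)-simplices and a point w, let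
the winding number of c at x count, modulo 2, the cones from w over the simplices of c
that contain x.  Summing the parity statement over the simplices of an n-chain z shows
that the winding number of the boundary of z at x is the number modulo 2 of simplices
of z containing x, hence the coefficient of z on the simplex around x
([winding_boundary]); summing it over an (n-1)-cycle shows that the winding number
does not depend on w ([winding_indep]).  To compare the values at x1 and x2 one may
thus look from a point w behind x1 on the line x1 x2: a cone from w that separates x1
from x2 has its base crossed by the segment, so the winding number is constant on
the interior of an n-simplex and jumps across a facet exactly when the facet belongs
to the cycle ([winding_const], [winding_jump]).  It vanishes outside the polyhedron
when w is inside, by convexity ([winding_outside]).  Hence a cycle bounds the chain of
its winding numbers.

The algorithm builds, by decreasing index, the connected components of the graph
restricted to the edges of index at least k, the root of a component being its
largest node.  When the edge with label b is added out of the root d, the component of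
d is frozen as the set of descendants of d; it consists of cells with index between b
and d, no facet after b leaves it, and exactly one coface of b belongs to it
([volume_inv], [merge_tree_inv]).  Call the chain of these cells the volume of d.  Its
leading term is d and the leading term of its boundary is b.  Every n-simplex gets
such an edge, since otherwise its final component would be an n-cycle ([edge_ex]).  By
triangularity the boundaries of the volumes are a basis of the (n-1)-cycles; those
with b at most k span the cycles of X_k and those with d at most k its boundaries,
so the diagram consists of the pairs (b,d) ([tree_is_pdiagram]).  An interval
decomposition is unique because the ranks of the structure maps count intervals
([pdiagram_uniq]).  Finally a persistent volume for (b,d) contains d and is constant
across all facets after b, so it contains the volume of d, which is therefore the
optimal one ([volume_optimal]); nesting of volumes is then the descendant
relation of the tree ([child_edges]). *)

Set Implicit Arguments.
Unset Strict Implicit.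
Unset Printing Implicit Defensive.

Import Order.TTheory GRing.Theory Num.Theory.
Import numFieldNormedType.Exports.

Local Open Scope fset_scope.
Local Open Scope ring_scope.

(** * Parity in Radon's theorem *)

Section Radon.
Variables (R : realType) (n : nat).
Local Notation point := 'rV[R]_n.
Implicit Types (S T : {fset point}) (x w : point) (l m : point -> R).

(** Weights on [T] extended by zero: this lets all the simplices spanned by
subsets of [S] share one system of weights. *)
Lemma hull_subP S T x : T `<=` S ->
  hull T x <-> exists l, [/\ forall v, v \in S -> 0 <= l v,
    forall v, v \in S -> v \notin T -> l v = 0,
    \sum_(v <- S) l v = 1 & x = \sum_(v <- S) l v *: v].
Proof.
move=> TS; split=> [[l [l0 l1 lx]]|[l [l0 lT l1 lx]]].
  pose l' v := if v \in T then l v else 0.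
  have e : \sum_(v <- S) l' v = \sum_(v <- T) l v.
    rewrite -(@big_fset_incl _ _ _ _ T) //; last first.
      by move=> v _ vT; rewrite /l' (negbTE vT).
    by apply: eq_big_seq => v vT; rewrite /l' vT.
  have ex : \sum_(v <- S) l' v *: v = \sum_(v <- T) l v *: v.
    rewrite -(@big_fset_incl _ _ _ _ T) //; last first.
      by move=> v _ vT; rewrite /l' (negbTE vT) scale0r.
    by apply: eq_big_seq => v vT; rewrite /l' vT.
  exists l'; split; rewrite ?e ?ex //.
    by move=> v _; rewrite /l'; case: ifP => // /l0.
  by move=> v _ /negbTE; rewrite /l' => ->.
exists l; split.
- by move=> v /(fsubsetP TS); exact: l0.
- by rewrite -l1; apply: big_fset_incl.
- rewrite lx; symmetry; apply: big_fset_incl => // v vS vT.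
  by rewrite lT // scale0r.
Qed.

Lemma hull_sub S T x : T `<=` S -> hull T x -> hull S x.
Proof.
by move=> TS /(hull_subP x TS)[l [l0 _ l1 lx]]; exists l.
Qed.

(** Among the ratios [l v / - m v] with [m v < 0], the least one is the time at which
the moving point leaves the orthant, and the coordinate where it leaves vanishes. *)
Lemma move_to_face S l m : (forall v, v \in S -> 0 <= l v) ->
  (exists2 v, v \in S & m v < 0) ->
  exists t, [/\ 0 <= t, forall v, v \in S -> 0 <= l v + t * m v &
    exists2 j, j \in S & m j < 0 /\ l j + t * m j = 0].
Proof.
move=> l0 [v0 v0S mv0].
pose F (v : S) := l (val v) / - m (val v).
case: (@arg_minP _ R S [` v0S] (fun v => m (val v) < 0) F mv0) => j mj jmin.
have Fj : 0 <= F j by rewrite divr_ge0 ?l0 ?fsvalP // oppr_ge0 ltW.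
exists (F j); split=> //; last first.
  exists (val j); first by case: (j).
  by split=> //; rewrite /F; field; rewrite lt_eqF.
move=> v vS; have [mv|mv] := ltP (m v) 0; last first.
  by apply: addr_ge0; [exact: l0|exact: mulr_ge0].
have := jmin [` vS] mv; rewrite {2}/F /= => le.
have : F j * - m v <= l v by rewrite -ler_pdivlMr // oppr_gt0.
lra.
Qed.

(** The homogenized points are too many rows for a matrix with [1 + n] columns. *)
Lemma affine_dependence S : (n.+1 < #|` S|)%N ->
  exists m, [/\ \sum_(v <- S) m v = 0, \sum_(v <- S) m v *: v = 0 &
    exists2 v, v \in S & m v != 0].
Proof.
move=> cS; pose s : seq point := enum_fset S.
have us : uniq s by exact: fset_uniq.
pose A : 'M[R]_(size s, 1 + n) := \matrix_i row_mx 1%:M (s`_i).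
have : kermx A != 0.
  rewrite -mxrank_eq0 mxrank_ker subn_eq0 -ltnNge.
  by apply: leq_ltn_trans (rank_leq_col _) _.
case/matrix0Pn => i [j kij].
have [u [uA uj]] : exists u : 'rV[R]_(size s), u *m A = 0 /\ u 0 j != 0.
  by exists (row i (kermx A)); rewrite mxE; split=> //; rewrite -row_mul mulmx_ker row0.
pose m v := if insub (index v s) is Some k then u 0 k else 0.
have mE (k : 'I_(size s)) : m (s`_k) = u 0 k.
  by rewrite /m index_uniq // insubT //= => lt; congr (u 0 _); apply: val_inj.
exists m; split.
- have := congr1 (fun B : 'rV[R]_(1 + n) => B 0 (lshift n 0)) uA.
  rewrite mxE [RHS]mxE => e0; rewrite -[RHS]e0 (big_nth 0) big_mkord.
  by apply: eq_bigr => k _; rewrite mE mxE row_mxEl mxE mulr1.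
- apply/rowP => q; have := congr1 (fun B : 'rV[R]_(1 + n) => B 0 (rshift 1 q)) uA.
  rewrite mxE [RHS]mxE => e0; rewrite [RHS]mxE -[RHS]e0 (big_nth 0) big_mkord summxE.
  by apply: eq_bigr => k _; rewrite [LHS]mxE mE mxE row_mxEr.
- by exists (nth 0 s j); [exact: mem_nth | rewrite mE].
Qed.

(** The nonnegative weights on [S] with barycentre [x] form the intersection of the
positive orthant with an affine space.  General position forces at most one weight to
vanish, so that affine space is a line, and its intersection with the orthant is a
segment whose two end points, if there are any, each lie on one facet of the
orthant. *)
Lemma radon_parity S x : #|` S| = n.+2 ->
  (forall T, T `<=` S -> (#|` T| <= n)%N -> ~ hull T x) ->
  \sum_(v <- S) (`[< hull (S `\ v) x >]%:R : 'F_2) = 0.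
Proof.
move=> cS gen.
pose sol l := [/\ forall v, v \in S -> 0 <= l v, \sum_(v <- S) l v = 1 &
  x = \sum_(v <- S) l v *: v].
pose ker m := \sum_(v <- S) m v = 0 /\ \sum_(v <- S) m v *: v = 0.
have facetP i : i \in S -> hull (S `\ i) x <-> exists2 l, sol l & l i = 0.
  move=> iS; split=> [/(hull_subP x (fsubD1set _ _))[l [l0 li l1 lx]]|[l [l0 l1 lx] li]].
    by exists l => //; apply: li => //; rewrite !inE eqxx.
  apply/(hull_subP x (fsubD1set _ _)); exists l; split=> // v vS.
  by rewrite !inE vS andbT negbK => /eqP ->.
have two_zeros l i j : sol l -> i \in S -> j \in S -> l i = 0 -> l j = 0 -> i = j.
  move=> [l0 l1 lx] iS jS li lj; apply/eqP; apply/negPn/negP => ij.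
  have sub : S `\ i `\ j `<=` S.
    by apply: fsubset_trans (fsubD1set _ _) (fsubD1set _ _).
  apply: (gen _ sub).
    have := cS; rewrite (cardfsD1 i) iS (cardfsD1 j) !inE eq_sym ij jS /=.
    by rewrite !add1n => -[->].
  apply/(hull_subP x sub); exists l; split=> // v vS.
  rewrite !inE vS andbT negb_and !negbK => /orP[]/eqP-> //.
have solD l m t : sol l -> ker m -> (forall v, v \in S -> 0 <= l v + t * m v) ->
    sol (fun v => l v + t * m v).
  move=> [l0 l1 lx] [m0 mx] pos; split=> //.
    by rewrite big_split /= l1 -mulr_sumr m0 mulr0 addr0.
  under eq_bigr do rewrite scalerDl -scalerA.
  by rewrite big_split /= -lx -scaler_sumr mx scaler0 addr0.
have kerN m : ker m -> ker (fun v => - m v).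
  move=> [m0 mx]; split; first by rewrite sumrN m0 oppr0.
  by under eq_bigr do rewrite scaleNr; rewrite sumrN mx oppr0.
have negative m : ker m -> (exists2 v, v \in S & m v != 0) ->
    exists2 v, v \in S & m v < 0.
  move=> [m0 _] [v vS mv]; apply: contrapT => noneg.
  have pos u : u \in S -> 0 <= m u.
    by move=> uS; rewrite leNgt; apply/negP => mu; apply: noneg; exists u.
  have : \sum_(u <- S) m u == 0 by rewrite m0.
  rewrite big_seq psumr_eq0; last by move=> u; exact: pos.
  by move=> /allP/(_ v vS); rewrite vS (negbTE mv).
have ker0 l m i : sol l -> ker m -> i \in S -> l i = 0 -> m i = 0 ->
    forall v, v \in S -> m v = 0.
  move=> sl km iS li mi v vS; apply/eqP/negPn/negP => mv.
  have [u uS mu] := negative m km (ex_intro2 _ _ v vS mv).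
  have [l0 _ _] := sl.
  have [t [t0 tpos [j jS [mj ej]]]] := move_to_face l0 (ex_intro2 _ _ u uS mu).
  have := two_zeros _ i j (solD _ _ t sl km tpos) iS jS.
  rewrite li mi mulr0 addr0 ej => /(_ erefl erefl) ij.
  by move: mj; rewrite -ij mi ltxx.
have [[i iS hi]|none] := pselect (exists2 i, i \in S & hull (S `\ i) x); last first.
  rewrite big_seq big1 // => i iS.
  by have -> : `[< hull (S `\ i) x >] = false by apply/asboolP => hi; apply: none; exists i.
have /(facetP _ iS)[l sl li] := hi; have [l0 l1 lx] := sl.
have [m0 [km0 km0' nz0]] : exists m, [/\ \sum_(v <- S) m v = 0,
    \sum_(v <- S) m v *: v = 0 & exists2 v, v \in S & m v != 0].
  by apply: affine_dependence; rewrite cS.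
have [m [km mi]] : exists m, ker m /\ 0 < m i.
  have mi0 : m0 i != 0.
    apply/eqP => mi; have [v vS] := nz0.
    by rewrite (ker0 l m0 i) ?eqxx.
  have [mi|mi] := ltP 0 (m0 i); first by exists m0.
  exists (fun v => - m0 v); split; first exact: kerN.
  by rewrite oppr_gt0 lt_neqAle mi0.
have [t [t0 tpos [j jS [mj ej]]]] :
  exists t, [/\ 0 <= t, forall v, v \in S -> 0 <= l v + t * m v &
    exists2 j, j \in S & m j < 0 /\ l j + t * m j = 0].
  apply: move_to_face => //; apply: negative => //; exists i => //.
  by rewrite gt_eqF.
have ij : i != j by apply/eqP => ij; move: mj; rewrite -ij ltNge (ltW mi).
have sj := solD _ _ t sl km tpos.
have hj : hull (S `\ j) x by apply/(facetP _ jS); eexists; [exact: sj|].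
(* the solutions form a segment, which leaves the orthant at i and at j only *)
have only v : v \in S -> v != i -> v != j -> `[< hull (S `\ v) x >] = false.
  move=> vS vi vj; apply/asboolP => /(facetP _ vS)[l' sl' lv'].
  have [l0' l1' lx'] := sl'.
  have pos' u : u \in S -> u != v -> 0 < l' u.
    move=> uS uv; rewrite lt_neqAle l0' // andbT eq_sym.
    by apply/eqP => lu; move/eqP: uv; apply; apply: (two_zeros l').
  have pos u : u \in S -> u != i -> 0 < l u.
    move=> uS ui; rewrite lt_neqAle l0 // andbT eq_sym.
    by apply/eqP => lu; move/eqP: ui; apply; apply: (two_zeros l).
  have posj u : u \in S -> u != j -> 0 < l u + t * m u.
    move=> uS uj; rewrite lt_neqAle tpos // andbT eq_sym.
    by apply/eqP => lu; move/eqP: uj; apply; apply: (two_zeros _ u j sj).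
  (* l' - l is a multiple c of m *)
  pose c := l' i / m i.
  have key u : u \in S -> l' u = l u + c * m u.
    move=> uS; apply/eqP; rewrite -subr_eq0; apply/eqP.
    apply: (ker0 l (fun u => l' u - (l u + c * m u)) i) => //; last first.
      by rewrite li add0r /c divfK ?subrr // gt_eqF.
    have [k0 kx] := km; split.
      by rewrite sumrB big_split /= l1 l1' -mulr_sumr k0 mulr0 addr0 subrr.
    under eq_bigr do rewrite scalerBl scalerDl -scalerA.
    by rewrite sumrB big_split /= -lx -lx' -scaler_sumr kx scaler0 addr0 subrr.
  have c0 : 0 < c by rewrite divr_gt0 // pos' // eq_sym.
  have := pos' j jS; rewrite eq_sym vj key // => /(_ isT) pj.
  have := posj v vS vj; have := key v vS; rewrite lv' => e pv.
  have lpos := pos v vS vi.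
  have ct : c < t.
    have : 0 < (c - t) * m j by lra.
    by rewrite nmulr_lgt0 // subr_lt0.
  have mv : m v < 0 by have : c * m v < 0 by [lra]; rewrite pmulr_rlt0.
  have : (t - c) * m v < 0 by rewrite pmulr_rlt0 // subr_gt0.
  lra.
rewrite (big_fsetD1 i) //= (big_fsetD1 j) ?inE /=; last by rewrite eq_sym ij.
rewrite asboolT // asboolT // big_seq big1 ?addr0.
  by apply/eqP; rewrite -natrD.
by move=> v; rewrite !inE => /and3P[vj vi vS]; rewrite only.
Qed.

End Radon.

(** * Points in general position *)

Section GeneralPosition.
Variables (R : realType) (n : nat).
Local Notation point := 'rV[R]_n.
Implicit Types (S T W : {fset point}) (x w : point).

(** Affine hulls of points are linear spans of their homogenizations. *)
Definition homog x : 'rV[R]_(1 + n) := row_mx 1%:M x.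

Lemma homogl x i : homog x 0 (lshift n i) = 1.
Proof. by rewrite row_mxEl ord1 mxE eqxx. Qed.

Lemma homogr x i : homog x 0 (rshift 1 i) = x 0 i.
Proof. exact: row_mxEr. Qed.

Lemma homogE (s : seq point) (l : point -> R) : \sum_(v <- s) l v = 1 ->
  homog (\sum_(v <- s) l v *: v) = \sum_(v <- s) l v *: homog v.
Proof.
move=> l1; apply/rowP => j; rewrite summxE.
case: (split_ordP j) => k ->.
  by rewrite homogl -l1; apply: eq_bigr => v _; rewrite mxE homogl mulr1.
by rewrite homogr summxE; apply: eq_bigr => v _; rewrite mxE [RHS]mxE homogr.
Qed.

Definition aspan T := <<[seq homog v | v <- T]>>%VS.

Lemma hull_aspan T x : hull T x -> homog x \in aspan T.
Proof.
move=> [l [_ l1 ->]]; rewrite homogE // big_seq memv_suml // => v vT.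
by rewrite memvZ // memv_span // map_f.
Qed.

Lemma aspanS S T : S `<=` T -> (aspan S <= aspan T)%VS.
Proof.
move=> ST; apply: sub_span => _ /mapP[v vS ->].
by apply: map_f; exact: (fsubsetP ST).
Qed.

Lemma aspanU1 T w y : y \in aspan (w |` T) ->
  exists k z, z \in aspan T /\ y = k *: homog w + z.
Proof.
have : (aspan (w |` T) <= <[homog w]> + aspan T)%VS.
  apply/span_subvP => _ /mapP[v + ->]; rewrite !inE => /orP[/eqP ->|vT].
    by apply: (subvP (addvSl _ _)); exact: memv_line.
  by apply: (subvP (addvSr _ _)); rewrite memv_span // map_f.
move=> /subvP le /le /memv_addP[u /vlineP[k ->] [z zT ->]].
by exists k, z.
Qed.

Lemma mem_aspan T v : v \in T -> homog v \in aspan T.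
Proof. by move=> vT; rewrite memv_span // map_f. Qed.

(** A span of at most [n] points never fills the space; a span of more points may. *)
Definition generic W x := forall T, T `<=` W -> (#|` T| <= n)%N ->
  homog x \notin aspan T.

Lemma genericS W W' x : W `<=` W' -> generic W' x -> generic W x.
Proof. by move=> le g T TW; apply: g; exact: fsubset_trans le. Qed.

Lemma generic_hull W x T : generic W x -> T `<=` W -> (#|` T| <= n)%N ->
  ~ hull T x.
Proof. by move=> g TW cT /hull_aspan; apply/negP/g. Qed.

Lemma homog_line x1 x2 (s : R) :
  homog (x1 - s *: (x2 - x1)) = (1 + s) *: homog x1 - s *: homog x2.
Proof.
have comb (m : nat) (u v : 'rV[R]_m) a b j :
  (a *: u - b *: v) 0 j = a * u 0 j - b * v 0 j by rewrite !mxE.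
apply/rowP => j; rewrite comb; case: (split_ordP j) => k ->.
  by rewrite !homogl; ring.
by rewrite !homogr !mxE; ring.
Qed.

(** A point [w] of the line through [x1] and [x2] is not generic with respect to them, but it
can be exchanged: if [x1] lay in the span of [w] and of some points of [W], then [x2] would lie in the span
of [x1] and of these points.  The point [w] lies beyond [x1], hence differs from [x2], which
rules out the degenerate case of the exchange. *)
Lemma generic_line W x1 x2 s : 0 < s -> generic W x1 -> generic (x1 |` W) x2 ->
  let w := x1 - s *: (x2 - x1) in generic (w |` W) x1 /\ generic (w |` W) x2.
Proof.
move=> s_gt0 g1 g2 w; have s0 : s != 0 by rewrite gt_eqF.
have g2' : generic W x2 by apply: genericS g2; exact: fsubsetUr.
(* only the spans that involve w are new *)
have split T : T `<=` w |` W -> (#|` T| <= n)%N ->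
    T `<=` W \/ exists T', [/\ T' `<=` W, (#|` T'| < n)%N & T = w |` T'].
  move=> TW cT; have [wT|wT] := boolP (w \in T); last first.
    left; apply/fsubsetP => v vT; have := fsubsetP TW v vT.
    by rewrite !inE => /orP[/eqP e|//]; rewrite -e vT in wT.
  right; exists (T `\ w); split.
  - by rewrite fsubDset.
  - by move: cT; rewrite (cardfsD1 w) wT add1n.
  - by rewrite fsetD1K.
have aux T' : T' `<=` W -> (#|` T'| < n)%N -> homog x2 \notin aspan (x1 |` T').
  move=> TW cT; apply: g2; first exact: fsetUS.
  by rewrite cardfsU1; case: (_ \notin _) => //=; rewrite add0n ltnW.
have auxP T' a b c z : T' `<=` W -> (#|` T'| < n)%N -> z \in aspan T' -> a != 0 ->
    a *: homog x2 <> b *: homog x1 + c *: z.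
  move=> TW cT zT a0 e; have /negP := aux _ TW cT; apply.
  rewrite -[homog x2](scalerK a0) e memvZ // memvD // memvZ //.
    by rewrite mem_aspan // !inE eqxx.
  by apply: (subvP (aspanS _)) zT; exact: fsubsetUr.
split=> T TW cT; have [|[T' [TW' cT' ->]]] := split T TW cT.
- by move=> TW'; apply: g1.
- apply/negP => /aspanU1[k [z [zT]]]; rewrite homog_line => e.
  have [k0|k0] := eqVneq k 0.
    by move: e; rewrite k0 scale0r add0r => e; have /negP := g1 _ TW' (ltnW cT'); rewrite e.
  apply: (@auxP T' (k * s) (k * (1 + s) - 1) 1 z) => //; first by rewrite mulf_neq0.
  move: e; generalize (homog x1) (homog x2) => a b /rowP e.
  by apply/rowP => j; move: (e j); rewrite !mxE => {}e; lra.
- by move=> TW'; apply: g2'.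
- apply/negP => /aspanU1[k [z [zT]]]; rewrite homog_line => e.
  have [k0|k0] := eqVneq (1 + k * s) 0; last first.
    apply: (@auxP T' (1 + k * s) (k * (1 + s)) 1 z) => //.
    move: e; generalize (homog x1) (homog x2) => a b /rowP e.
    by apply/rowP => j; move: (e j); rewrite !mxE => {}e; lra.
  have /negP := g1 _ TW' (ltnW cT'); apply.
  have : (k - 1) *: homog x1 = - z.
    move: e; generalize (homog x1) (homog x2) => a b /rowP e.
    apply/rowP => j; move: (e j); rewrite !mxE => {}e.
    have : (1 + k * s) * b 0 j = 0 by rewrite k0 mul0r.
    have : (1 + k * s) * a 0 j = 0 by rewrite k0 mul0r.
    lra.
  have k2 : k - 1 != 0.
    rewrite lt_eqF // subr_lt0; apply: lt_trans (ltr01).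
    by rewrite -(pmulr_llt0 _ s_gt0) (_ : k * s = -1) ?oppr_lt0 //; lra.
  by move=> ez; rewrite -[homog x1](scalerK k2) ez memvZ // memvN.
Qed.
(** The affine functions on R^n, as columns acting on homogenized points. *)
Definition afun (c : 'cV[R]_(1 + n)) x : R := (homog x *m c) 0 0.

Lemma afunE c x :
  afun c x = c (lshift n 0) 0 + \sum_(i < n) x 0 i * c (rshift 1 i) 0.
Proof.
rewrite /afun mxE big_split_ord big_ord1 /=; congr (_ + _).
  by rewrite homogl mul1r.
by apply: eq_bigr => i _; rewrite homogr.
Qed.

Lemma afun_sum c (s : seq point) (l : point -> R) : \sum_(v <- s) l v = 1 ->
  afun c (\sum_(v <- s) l v *: v) = \sum_(v <- s) l v * afun c v.
Proof.
move=> l1; rewrite /afun homogE // mulmx_suml summxE.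
by apply: eq_bigr => v _; rewrite -scalemxAl mxE.
Qed.

Lemma afun_line c x y t : afun c (x + t *: (y - x)) =
  afun c x + t * (afun c y - afun c x).
Proof.
have -> : x + t *: (y - x) = x - (- t) *: (y - x) by rewrite scaleNr opprK.
rewrite /afun homog_line mulmxBl -!scalemxAl !mxE; ring.
Qed.

Lemma afun_continuous c : continuous (afun c).
Proof.
move=> x; rewrite (_ : afun c = fun x => c (lshift n 0) 0 +
    \sum_(i < n) x 0 i * c (rshift 1 i) 0); last by apply/funext => y; exact: afunE.
apply: (@cvgD _ _ _ (nbhs x)); first exact: cvg_cst.
apply: (@cvg_big _ _ _ _ _ _ _ (nbhs x)); first exact: add_continuous.
by move=> i _; apply: (@cvgM _ _ (nbhs x)); [exact: coord_continuous|exact: cvg_cst].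
Qed.

Lemma near_afun_gt0 c x : 0 < afun c x -> \forall y \near x, 0 < afun c y.
Proof. by move=> cx; exact: (cvgr_gt _ (@afun_continuous c x) _ cx). Qed.

Lemma near_afun_lt0 c x : afun c x < 0 -> \forall y \near x, afun c y < 0.
Proof. by move=> cx; exact: (cvgr_lt _ (@afun_continuous c x) _ cx). Qed.

Lemma near_afun_neq0 c x : afun c x != 0 -> \forall y \near x, afun c y != 0.
Proof.
rewrite neq_lt => /orP[/near_afun_lt0|/near_afun_gt0]; apply: filterS => y.
  by move/lt_eqF ->.
by move/gt_eqF ->.
Qed.
Lemma near_ray (P : point -> Prop) x u : (\forall y \near x, P y) ->
  exists2 e, 0 < e & forall t, 0 <= t < e -> P (x + t *: u).
Proof.
move=> Px.
have : (x + t *: u @[t --> (0 : R)] --> x)%classic.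
  rewrite -[X in (_ --> X)%classic]addr0 -(scale0r u).
  by apply: cvgD; [exact: cvg_cst|apply: cvgZr_tmp; exact: cvg_id].
move=> /(_ P Px); rewrite /nbhs /= => /nbhs_ballP[e /= e0 he].
exists e => // t /andP[t0 te]; apply: he; rewrite /ball /= sub0r normrN.
by rewrite ger0_norm.
Qed.

(** Avoiding the zeros of finitely many nonzero affine functions is an open condition, so
they can be avoided one after the other by moving a little each time. *)
Lemma avoid_zeros (L : seq 'cV[R]_(1 + n)) (P : point -> Prop) x :
  (forall c, c \in L -> c != 0) -> (\forall y \near x, P y) ->
  exists2 y, \forall z \near y, P z & forall c, c \in L -> afun c y != 0.
Proof.
elim: L => [|c L IH] L0 Px; first by exists x.
have [|y Py yL] := IH _ Px; first by move=> d dL; apply: L0; rewrite inE dL orbT.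
have [cy|cy] := eqVneq (afun c y) 0; last first.
  by exists y => // d; rewrite inE => /orP[/eqP ->|/yL].
have nearL : \forall z \near y, forall d : seq_sub L, afun (val d) z != 0.
  by apply: (@filter_forall _ _ _ (nbhs y)) => d; apply: near_afun_neq0; apply: yL; exact: valP.
have [u cu] : exists u, afun c (y + u) != 0.
  apply: contrapT => none.
  have all0 z : afun c z = 0.
    apply/eqP/negPn/negP => cz; apply: none; exists (z - y).
    by rewrite addrC subrK.
  have /eqP := L0 c (mem_head _ _); apply; apply/colP => j.
  have c0 : c (lshift n 0) 0 = 0.
    have := all0 0; rewrite afunE big1 ?addr0 // => i _.
    by rewrite mxE mul0r.
  rewrite [RHS]mxE; case: (split_ordP j) => k ->; first by rewrite ord1.
  have := all0 (delta_mx 0 k); rewrite afunE c0 add0r (bigD1 k) //= big1.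
    by rewrite addr0 mxE !eqxx mul1r.
  by move=> i ik; rewrite mxE (negbTE ik) andbF mul0r.
have [e e0 he] := near_ray u (filterI (near_join Py) nearL).
have [|yQ yL'] := he (e / 2); first by apply/andP; split; lra.
exists (y + (e / 2) *: u) => // d; rewrite inE => /orP[/eqP ->|dL].
  have := afun_line c y (y + u) (e / 2); rewrite addrAC subrr add0r => ->.
  by rewrite cy subr0 add0r mulf_neq0 // gt_eqF // divr_gt0.
exact: (yL' (SeqSub dL)).
Qed.

Lemma afun_vanish T : (#|` T| <= n)%N ->
  exists2 c, c != 0 & forall x, homog x \in aspan T -> afun c x = 0.
Proof.
move=> cT; pose A : 'M[R]_(size T, 1 + n) := \matrix_i homog (nth 0 T i).
have : kermx A^T != 0.
  rewrite -mxrank_eq0 mxrank_ker subn_eq0 -ltnNge mxrank_tr.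
  by apply: leq_ltn_trans (rank_leq_row _) _; rewrite add1n ltnS.
case/matrix0Pn => i [j kij].
exists (row i (kermx A^T))^T.
  by apply/matrix0Pn; exists j, 0; rewrite mxE mxE.
move=> x xT; rewrite /afun.
have : (aspan T <= lker (linfun (mulmxr (row i (kermx A^T))^T)))%VS.
  apply/span_subvP => _ /mapP[v vT ->]; rewrite memv_ker lfunE /=.
  have -> : homog v = row (Ordinal (ltac:(by rewrite index_mem) : (index v T < size T)%N)) A.
    by rewrite rowK /= nth_index.
  apply/eqP/trmx_inj; rewrite trmx_mul trmxK tr_row trmx0.
  by rewrite colE mulmxA -row_mul mulmx_ker row0 mul0mx.
move=> /subvP/(_ _ xT); rewrite memv_ker lfunE /= => /eqP ->.
by rewrite mxE.
Qed.

(** Each of the finitely many spans to avoid lies in the zero set of a nonzero affine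
function. *)
Lemma generic_near W (P : point -> Prop) x : (\forall y \near x, P y) ->
  exists2 y, P y & generic W y.
Proof.
move=> Px.
pose vanish T : 'cV[R]_(1 + n) := if pselect (#|` T| <= n)%N is left cT
  then sval (cid2 (afun_vanish cT)) else 0.
have [|y /nbhs_singleton Py yL] := @avoid_zeros
    [seq vanish T | T <- fpowerset W & (#|` T| <= n)%N] P x _ Px.
  move=> c /mapP[T]; rewrite mem_filter => /andP[cT _] ->.
  by rewrite /vanish; case: pselect => // cT'; case: cid2.
exists y => // T TW cT; apply/negP => yT.
have /eqP : afun (vanish T) y != 0.
  by apply: yL; apply: map_f; rewrite mem_filter cT fpowersetE.
by apply; rewrite /vanish; case: pselect => // cT'; case: cid2 => c /= _ ->.
Qed.

End GeneralPosition.

(** * Chains, the boundary and winding numbers *)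

Lemma addF2 (a : 'F_2) : a + a = 0.
Proof. by rewrite -mulr2n -(mulr_natr a) pchar_Zp ?mulr0. Qed.

Lemma oppF2 (a : 'F_2) : - a = a.
Proof. by apply/eqP; rewrite eq_sym -addr_eq0 addF2. Qed.

Lemma neq0F2 (a : 'F_2) : (a != 0) = (a == 1).
Proof. by case: a => [[|[|[]]]]. Qed.

Lemma boolF2 (a : 'F_2) : a = (a != 0)%:R.
Proof. by case: (eqVneq a 0) => [->//|]; rewrite neq0F2 => /eqP. Qed.

Section Chains.
Variables (P : choiceType) (X : seq {fset P}).
Implicit Types (i j k : idx X) (z : chain X).

Lemma chainsP m k z : reflect
  (forall i, z 0 i != 0 -> has_dim m (simp i) && (i <= k)%N) (z \in chains m k).
Proof.
apply: (iffP idP) => [zC i|zP].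
  apply: contraR => ni.
  pose e : 'cV['F_2]_(size X).+1 := delta_mx i 0.
  have : (chains m k <= lker (linfun (mulmxr e)))%VS.
    apply/span_subvP => _ /mapP[j + ->]; rewrite mem_filter => /andP[dj _].
    rewrite memv_ker lfunE /= /elem mul_delta_mx_cond.
    by have [eji|] := eqVneq j i; [rewrite -eji dj in ni|rewrite mulr0n].
  move=> /subvP/(_ _ zC); rewrite memv_ker lfunE /= => /eqP /matrixP/(_ 0 0).
  by rewrite -colE !mxE => ->.
rewrite [z]row_sum_delta; apply: memv_suml => i _.
have [->|/zP zi] := eqVneq (z 0 i) 0; first by rewrite scale0r mem0v.
apply: memvZ; apply: memv_span; apply: map_f.
by rewrite mem_filter zi mem_enum.
Qed.

Lemma boundaryE z j : boundary X z 0 j =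
  \sum_i z 0 i * ((simp j `<=` simp i) && (#|` simp i| == #|` simp j|.+1))%:R.
Proof. by rewrite /boundary lfunE /= mxE; apply: eq_bigr => i _; rewrite mxE. Qed.

Lemma cyclesP m k z : reflect (z \in chains m k /\ boundary X z = 0)
  (z \in cycles m k).
Proof. by rewrite memv_cap memv_ker; apply: (iffP andP) => -[-> /eqP]. Qed.

Lemma boundariesP m k c : reflect
  (exists2 z, z \in chains m.+1 k & c = boundary X z) (c \in boundaries m k).
Proof. exact: memv_imgP. Qed.

Hypotheses (uX : uniq X) (X0 : fset0 \notin X) (fX : face_closed X).

Lemma simp_inj : injective (@simp _ X).
Proof.
move=> i j /eqP; rewrite nth_uniq ?ltn_ord //=; last by rewrite X0.
by move/eqP/val_inj.
Qed.

Lemma simp_ex s : s \in X -> exists2 i : idx X, simp i = s & (0 < i)%N.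
Proof.
move=> sX; have lt : ((index s X).+1 < (size X).+1)%N by rewrite ltnS index_mem.
by exists (Ordinal lt) => //; rewrite /simp /= nth_index.
Qed.

Lemma mem_simp i : (0 < i)%N -> simp i \in X.
Proof. by case: i => [[|i] //= lt] _; rewrite /simp /= mem_nth. Qed.

Lemma simp_gt0 i : simp i != fset0 -> (0 < i)%N.
Proof. by case: i => [[|i] lt]; rewrite // /simp /= eqxx. Qed.

Lemma facet_ex i v : v \in simp i -> exists j : idx X, simp j = simp i `\ v.
Proof.
move=> vi; have i0 : (0 < i)%N.
  by apply: simp_gt0; apply/fset0Pn; exists v.
have [->|ne] := eqVneq (simp i `\ v) fset0; first by exists ord0.
have [|j ej _] := @simp_ex (simp i `\ v); last by exists j.
by apply: fX (mem_simp i0) _; rewrite /is_face ne fsubD1set.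
Qed.
(** The boundary is dual to the coboundary: the facets of a simplex are obtained by
omitting one vertex.  All sums over faces below are evaluated through this identity. *)
Lemma boundary_pairing z (g : {fset P} -> 'F_2) :
  \sum_j boundary X z 0 j * g (simp j) =
  \sum_i z 0 i * \sum_(v <- simp i) g (simp i `\ v).
Proof.
under eq_bigr => j _ do rewrite boundaryE mulr_suml.
rewrite exchange_big /=; apply: eq_bigr => i _.
under eq_bigr => j _ do rewrite -mulrA.
rewrite -mulr_sumr; congr (_ * _).
pose f (v : simp i) : idx X := odflt ord0 [pick j | simp j == simp i `\ val v].
have fE v : simp (f v) = simp i `\ val v.
  rewrite /f; case: pickP => [j /eqP //|none].
  by have [j ej] := facet_ex (valP v); have := none j; rewrite ej eqxx.
have f_inj : injective f.
  move=> u v /(congr1 (@simp _ X)); rewrite !fE => e.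
  have : fsval u \notin simp i `\ val v by rewrite -e !inE eqxx.
  by rewrite !inE fsvalP andbT negbK => /eqP/val_inj.
rewrite big_seq_fsetE /=.
transitivity (\sum_(j in f @: [set: simp i]%SET) g (simp j)); last first.
  rewrite big_imset /=; last by move=> u v _ _; exact: f_inj.
  by apply: eq_big => v; rewrite ?finset.in_setT ?fE.
rewrite [RHS]big_mkcond; apply: eq_bigr => j _.
rewrite (_ : (j \in f @: [set: simp i]%SET) = (simp j `<=` simp i) && (#|` simp i| == #|` simp j|.+1)).
  by case: ifP; rewrite ?mul1r ?mul0r.
apply/finset.imsetP/andP => [[v _ ->]|[ji /eqP cji]].
  by rewrite fE fsubD1set (cardfsD1 (val v)) fsvalP add1n.
have : #|` simp i `\` simp j| = 1%N.
  by rewrite cardfsD (fsetIidPr ji) cji subSnn.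
move=> /eqP/cardfs1P[v ev]; have : v \in simp i `\` simp j by rewrite ev inE.
rewrite inE => /andP[vj vi]; exists [` vi] => //; apply: simp_inj; rewrite fE /=.
by rewrite -ev fsetDK.
Qed.

(** Each unordered pair is counted twice. *)
Lemma sum_pairs_sym (T : finType) (G : T -> T -> 'F_2) : (forall u v, G u v = G v u) ->
  \sum_u \sum_(v | v != u) G u v = 0.
Proof.
move=> Gs; pose lt (u v : T) := (enum_rank u < enum_rank v)%N.
have neE u v : (v != u) = lt v u || lt u v.
  by rewrite /lt -neq_ltn (inj_eq val_inj) (inj_eq enum_rank_inj).
have split u : \sum_(v | v != u) G u v = \sum_(v | lt v u) G u v + \sum_(v | lt u v) G u v.
  rewrite (bigID (lt^~ u)) /=; congr (_ + _); apply: eq_bigl => v; rewrite neE /lt.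
    by case: ltngtP.
  by case: ltngtP.
under eq_bigr do rewrite split.
rewrite big_split /= [X in _ + X](exchange_big_dep xpredT) //=.
rewrite -big_split big1 // => u _ /=.
by rewrite [X in _ + X](eq_bigr (G u)) ?addF2.
Qed.

(** Omitting two vertices in either order gives the same face. *)
Lemma boundary_boundary z : boundary X (boundary X z) = 0.
Proof.
apply/rowP => j; rewrite [RHS]mxE.
pose g s : 'F_2 := (s == simp j)%:R.
have -> : boundary X (boundary X z) 0 j = \sum_i boundary X (boundary X z) 0 i * g (simp i).
  rewrite (bigD1 j) //= /g eqxx mulr1 big1 ?addr0 // => i ij.
  by rewrite (inj_eq simp_inj) (negbTE ij) mulr0.
rewrite (boundary_pairing _ g).
rewrite (boundary_pairing z (fun s => \sum_(v <- s) g (s `\ v))).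
rewrite big1 // => i _; rewrite big_seq_fsetE /=.
rewrite (_ : \sum_(u : simp i) _ = 0) ?mulr0 //.
rewrite -[RHS](sum_pairs_sym (T := simp i) (G := fun u v => g (simp i `\ val u `\ val v))).
  apply: eq_bigr => u _; pose F v := if v != val u then g (simp i `\ val u `\ v) else 0.
  transitivity (\sum_(v <- simp i `\ val u) F v).
    by apply: eq_big_seq => v; rewrite !inE /F => /andP[->].
  rewrite (@big_fset_incl _ _ _ _ _ (simp i)) ?fsubD1set //; last first.
    by move=> v vi; rewrite !inE vi andbT negbK /F => ->.
  by rewrite big_seq_fsetE /= [RHS]big_mkcond.
by move=> u v; congr g; rewrite !fsetDDl fsetUC.
Qed.

End Chains.

Section Cones.
Variables (R : realType) (n : nat).
Local Notation point := 'rV[R]_n.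
Implicit Types (s t W : {fset point}) (x w : point).

Definition inhull s x : 'F_2 := `[< hull s x >]%:R.

Lemma fset1UDl w s v : v != w -> (w |` s) `\ v = w |` (s `\ v).
Proof.
move=> vw; apply/fsetP => u; rewrite !inE.
by have [->|] := eqVneq u w; rewrite ?andbT //= eq_sym vw.
Qed.

Lemma radon_inhull W s x : #|` s| = n.+2 -> s `<=` W -> generic W x ->
  \sum_(v <- s) inhull (s `\ v) x = 0.
Proof.
move=> cs sW gx; apply: radon_parity => // T Ts cT.
by apply: generic_hull gx _ cT; exact: fsubset_trans sW.
Qed.

(** [radon_parity] for the points of [s] and [w]. *)
Lemma cone_sum W s w x : #|` s| = n.+1 -> w \notin s -> w |` s `<=` W -> generic W x ->
  \sum_(v <- s) inhull (w |` (s `\ v)) x = inhull s x.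
Proof.
move=> cs ws sW gx.
have := @radon_inhull W (w |` s) x _ sW gx.
rewrite cardfsU1 ws cs add1n => /(_ erefl).
rewrite big_fsetU1 //= fsetU1K // => /eqP; rewrite addr_eq0 oppF2 => /eqP ->.
apply: eq_big_seq => v vs; rewrite fset1UDl //.
by apply: contraNneq ws => <-.
Qed.

(** [radon_parity] for the points of [t], [w] and [w']. *)
Lemma cone_sum2 W t w w' x : #|` t| = n -> w \notin t -> w' \notin t -> w != w' ->
  w |` (w' |` t) `<=` W -> generic W x ->
  \sum_(v <- t) inhull (w |` (w' |` (t `\ v))) x = inhull (w |` t) x + inhull (w' |` t) x.
Proof.
move=> ct wt w't ww' tW gx.
have wt' : w \notin w' |` t by rewrite !inE negb_or ww'.
have := @radon_inhull W (w |` (w' |` t)) x _ tW gx.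
rewrite cardfsU1 wt' cardfsU1 w't ct !add1n => /(_ erefl).
rewrite big_fsetU1 //= big_fsetU1 //= fsetU1K //.
rewrite fset1UDl 1?eq_sym // fsetU1K // addrA => /eqP.
rewrite addr_eq0 oppF2 addrC => /eqP ->.
apply: eq_big_seq => v vt; rewrite fset1UDl ?fset1UDl //.
  by apply: contraNneq w't => <-.
by apply: contraNneq wt => <-.
Qed.

Variable X : seq {fset point}.
Hypotheses (uX : uniq X) (X0 : fset0 \notin X) (fX : face_closed X).

Definition vertices : {fset point} := \bigcup_(s <- X) s.

Lemma sub_vertices s : s \in X -> s `<=` vertices.
Proof. by move=> sX; apply: bigfcup_sup. Qed.

Lemma simp_sub_vertices (i : idx X) : simp i `<=` vertices.
Proof.
have [->|ne] := eqVneq (simp i) fset0; first exact: fsub0set.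
by apply: sub_vertices; apply: mem_simp; exact: simp_gt0.
Qed.
(** The parity of the number of simplices of [c] crossed by the ray that leaves [x] in the
direction opposite to [w]: such a ray meets [simp i] exactly when [x] lies in the cone from [w] over it. *)
Definition winding w (c : chain X) x : 'F_2 :=
  \sum_i c 0 i * inhull (w |` simp i) x.

(** Sum [cone_sum] over the simplices of [z]; the left-hand sides assemble into
the boundary of [z]. *)
Lemma winding_boundary w z x : z \in chains n ord_max -> w \notin vertices ->
  generic (w |` vertices) x ->
  winding w (boundary X z) x = \sum_i z 0 i * inhull (simp i) x.
Proof.
move=> /chainsP zC wV gx.
rewrite /winding (boundary_pairing uX X0 fX z (fun s => inhull (w |` s) x)).
apply: eq_bigr => i _; have [->|/zC/andP[/eqP ci _]] := eqVneq (z 0 i) 0.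
  by rewrite !mul0r.
congr (_ * _); apply: cone_sum gx => //; last exact: fsetUS (simp_sub_vertices i).
by apply: contra wV; apply/fsubsetP; exact: simp_sub_vertices.
Qed.

(** Sum [cone_sum2] over the simplices of [c]; the left-hand sides assemble into
the boundary of [c], which is zero. *)
Lemma winding_indep w w' c x : (0 < n)%N -> c \in cycles n.-1 ord_max ->
  w \notin vertices -> w' \notin vertices -> w != w' ->
  generic (w |` (w' |` vertices)) x -> winding w c x = winding w' c x.
Proof.
move=> n0 /cyclesP[/chainsP cC c0] wV w'V ww' gx.
apply/eqP; rewrite -[winding w' c x]oppF2 -addr_eq0 -big_split /=.
apply/eqP.
transitivity (\sum_i boundary X c 0 i * inhull (w |` (w' |` simp i)) x); last first.
  by rewrite c0 big1 // => i _; rewrite mxE mul0r.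
rewrite (boundary_pairing uX X0 fX c (fun s => inhull (w |` (w' |` s)) x)).
apply: eq_bigr => i _; have [->|/cC/andP[/eqP ci _]] := eqVneq (c 0 i) 0.
  by rewrite !mul0r addr0.
rewrite -mulrDr; congr (_ * _); apply/esym; apply: cone_sum2 gx => //.
- by rewrite ci prednK.
- by apply: contra wV; apply/fsubsetP; exact: simp_sub_vertices.
- by apply: contra w'V; apply/fsubsetP; exact: simp_sub_vertices.
- by apply: fsetUS; apply: fsetUS; exact: simp_sub_vertices.
Qed.

End Cones.

(** * Barycentric coordinates *)

Section Barycentric.
Variables (R : realType) (n : nat).
Local Notation point := 'rV[R]_n.
Implicit Types (s t : {fset point}) (u v x y : point) (l : point -> R).

Definition nsimplex s := affinely_independent s /\ #|` s| = n.+1.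

Definition bary_coords s (b : point -> 'cV[R]_(1 + n)) := forall x,
  \sum_(v <- s) afun (b v) x = 1 /\ x = \sum_(v <- s) afun (b v) x *: v.

(** The homogenized vertices of an n-simplex form an invertible matrix, whose inverse gives
the coordinates. *)
Lemma bary_exists s : nsimplex s -> exists b, bary_coords s b.
Proof.
move=> [si cs]; have szs : size s = (1 + n)%N := cs.
pose A : 'M[R]_(1 + n) := \matrix_i homog (nth 0 s i).
have AE k q : A k q = homog (nth 0 s k) 0 q by rewrite mxE.
have nth_sum (V : nmodType) (F : point -> V) :
    \sum_(v <- s) F v = \sum_(k < 1 + n) F (nth 0 s k).
  by rewrite (big_nth 0) big_mkord szs.
have uA : A \in unitmx.
  rewrite -row_free_unit -kermx_eq0; apply/negPn/negP => /matrix0Pn[i [j]].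
  have : row i (kermx A) *m A = 0 by rewrite -row_mul mulmx_ker row0.
  rewrite -[kermx A i j](mxE matrix_key (fun _ j => kermx A i j) (0 : 'I_1)).
  rewrite -/(row i (kermx A)); move: (row i (kermx A)) => r rA /eqP; apply.
  pose l v := r 0 (inord (index v s)).
  have lE (k : 'I_(1 + n)) : l (nth 0 s k) = r 0 k.
    by rewrite /l index_uniq ?szs ?fset_uniq // inord_val.
  have rAE q : \sum_k r 0 k * A k q = 0.
    by have := congr1 (fun B : 'rV[R]_(1 + n) => B 0 q) rA; rewrite mxE [RHS]mxE.
  rewrite -lE; apply: (si l); last by rewrite mem_nth ?szs.
    rewrite nth_sum -[RHS](rAE (lshift n 0)); apply: eq_bigr => k _.
    by rewrite lE AE homogl mulr1.
  apply/rowP => q; rewrite [RHS]mxE -[RHS](rAE (rshift 1 q)) nth_sum summxE.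
  by apply: eq_bigr => k _; rewrite mxE lE AE homogr.
exists (fun v => col (inord (index v s)) (invmx A)) => x.
pose r := homog x *m invmx A.
have bE (k : 'I_(1 + n)) :
    afun (col (inord (index (nth 0 s k) s)) (invmx A)) x = r 0 k.
  rewrite index_uniq ?szs ?fset_uniq // inord_val /afun colE mulmxA -colE.
  by rewrite mxE.
have rA : r *m A = homog x by rewrite /r mulmxKV.
have rAE q : \sum_k r 0 k * A k q = homog x 0 q by rewrite -rA mxE.
split; rewrite nth_sum.
  rewrite -[RHS](homogl x 0) -rAE; apply: eq_bigr => k _.
  by rewrite bE AE homogl mulr1.
apply/rowP => q; rewrite -homogr -rAE summxE; apply: eq_bigr => k _.
by rewrite [RHS]mxE bE AE homogr.
Qed.
(** Choosing the coordinates, with a dummy value when there are none, makes them total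
functions of the vertex set. *)
Definition bary_fun s : point -> 'cV[R]_(1 + n) :=
  xget (fun=> 0) [set b | bary_coords s b]%classic.

Definition bary s v x := afun (bary_fun s v) x.

Section Simplex.
Variable s : {fset point}.
Hypothesis ss : nsimplex s.

Lemma bary_spec : bary_coords s (bary_fun s).
Proof. by rewrite /bary_fun; case: xgetP => // none; have [b /none] := bary_exists ss. Qed.

Lemma bary_uniq l x : \sum_(v <- s) l v = 1 -> x = \sum_(v <- s) l v *: v ->
  {in s, forall v, bary s v x = l v}.
Proof.
move=> l1 lx v vs; have [b1 bx] := bary_spec x.
apply/eqP; rewrite -subr_eq0; apply/eqP.
apply: (ss.1 (fun v => bary s v x - l v)) vs; first by rewrite sumrB b1 l1 subrr.
by under eq_bigr do rewrite scalerBl; rewrite sumrB -bx -lx subrr.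
Qed.

Lemma hull_bary t x : t `<=` s -> hull t x <->
  (forall v, v \in s -> 0 <= bary s v x) /\
  (forall v, v \in s -> v \notin t -> bary s v x = 0).
Proof.
move=> ts; split=> [/(hull_subP x ts)[l [l0 lt l1 lx]]|[b0 bt]].
  by split=> v vs; rewrite (bary_uniq l1 lx vs); [exact: l0|exact: lt].
apply/(hull_subP x ts); have [b1 bx] := bary_spec x.
by exists (fun v => bary s v x).
Qed.

Lemma bary_ge0 x : hull s x -> forall v, v \in s -> 0 <= bary s v x.
Proof. by move/(hull_bary x (fsubset_refl s)) => []. Qed.

Lemma bary_vertex u v : u \in s -> v \in s -> bary s v u = (v == u)%:R.
Proof.
move=> us vs; have one (V : nmodType) (F : point -> V) :
    (forall w, w \in s -> w != u -> F w = 0) -> \sum_(w <- s) F w = F u.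
  move=> F0; rewrite (big_fsetD1 u) //= big_seq big1 ?addr0 // => w.
  by rewrite !inE => /andP[wu ws]; exact: F0.
rewrite (@bary_uniq (fun w => (w == u)%:R) u) //.
  by rewrite one ?eqxx // => w _ /negbTE ->.
by rewrite one ?eqxx ?scale1r // => w _ /negbTE ->; rewrite scale0r.
Qed.

Lemma afun_bary c x : afun c x = \sum_(v <- s) bary s v x * afun c v.
Proof. by have [b1 bx] := bary_spec x; rewrite {1}bx afun_sum. Qed.

End Simplex.

Definition relint t y := exists l, [/\ forall v, v \in t -> 0 < l v,
  \sum_(v <- t) l v = 1 & y = \sum_(v <- t) l v *: v].

Lemma relint_hull t y : relint t y -> hull t y.
Proof. by move=> [l [l0 l1 ly]]; exists l; split=> // v /l0/ltW. Qed.

Lemma relint_ex t : t != fset0 -> exists y, relint t y.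
Proof.
move=> t0; exists (\sum_(v <- t) (#|` t|%:R)^-1 *: v); exists (fun=> (#|` t|%:R)^-1).
have ct : (0 < #|` t|)%N by rewrite cardfs_gt0.
split=> // [v _|]; first by rewrite invr_gt0 ltr0n.
by rewrite big_const_seq count_predT iter_addr_0 -[LHS]mulr_natr mulVf // pnatr_eq0 -lt0n.
Qed.

Lemma relint_bary s t y : nsimplex s -> t `<=` s -> relint t y ->
  (forall v, v \in t -> 0 < bary s v y) /\
  (forall v, v \in s -> v \notin t -> bary s v y = 0).
Proof.
move=> ss ts ry; have hy := relint_hull ry.
have [_ b0] := (hull_bary ss y ts).1 hy; split=> //.
have [l [l0 l1 ly]] := ry.
pose l' v := if v \in t then l v else 0.
have l'E v : v \in t -> l' v = l v by rewrite /l' => ->.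
have eb := @bary_uniq s ss l' y _ _.
move=> v vt; rewrite eb ?(fsubsetP ts) ?l'E ?l0 //.
  rewrite -l1 -(@big_fset_incl _ _ _ _ t) //.
    by apply: eq_big_seq => w /l'E.
  by move=> w _ /negbTE; rewrite /l' => ->.
rewrite ly -[RHS](@big_fset_incl _ _ _ _ t) //.
  by apply: eq_big_seq => w /l'E ->.
by move=> w _ /negbTE; rewrite /l' => ->; rewrite scale0r.
Qed.

End Barycentric.

(** * Facets of a pure complex *)

Section Facets.
Variables (R : realType) (n : nat) (X : seq {fset 'rV[R]_n}).
Local Notation point := 'rV[R]_n.
Implicit Types (s t : {fset point}) (u v w x y : point).
Hypotheses (n_gt0 : (0 < n)%N) (X_complex : simplicial_complex X).
Hypothesis X_pure : forall (k : nat) s, (k < n)%N -> s \in X -> has_dim k s ->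
  exists2 t, t \in X & has_dim n t && is_face s t.

Lemma complex_nsimplex s : s \in X -> #|` s| = n.+1 -> nsimplex s.
Proof. by have [ind _ _] := X_complex; move=> /ind[_ si]. Qed.

Lemma card_complex s : s \in X -> (#|` s| <= n.+1)%N.
Proof.
have [ind _ _] := X_complex; move=> /ind[_ si]; rewrite leqNgt; apply/negP.
by move=> /affine_dependence[m [m0 mx [v vs /eqP]]]; apply; exact: (si m).
Qed.

Lemma complex_neq0 s : s \in X -> s != fset0.
Proof. by have [ind _ _] := X_complex; move=> /ind[]. Qed.
(** Two simplices of a complex meet in a common face, and a point of a face has weight
zero at the vertices outside that face. *)
Lemma carrier s t x : s \in X -> #|` s| = n.+1 -> t \in X -> hull s x -> hull t x ->
  {in s, forall v, 0 < bary s v x -> v \in t}.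
Proof.
move=> sX cs tX hs ht v vs pv; have ss := complex_nsimplex sX cs.
have [_ _ cap] := X_complex.
have [|r [/andP[_ rs] /andP[_ rt] e]] := cap s t sX tX; first by exists x.
have hr : hull r x by rewrite -e.
have [_ b0] := (hull_bary ss x rs).1 hr.
apply: (fsubsetP rt); apply/negPn/negP => vr.
by move: pv; rewrite b0 // ltxx.
Qed.

(** By purity the polyhedron is a finite union of n-simplices, each of which is cut out by the
affine inequalities that say that its barycentric coordinates are nonnegative. *)
Lemma polyhedronP x : polyhedron X x <->
  exists s, [/\ s \in X, #|` s| = n.+1 & hull s x].
Proof.
split=> [[s sX hs]|[s [sX _ hs]]]; last by exists s.
have [cs|cs] := eqVneq #|` s| n.+1; first by exists s.
have c0 : (0 < #|` s|)%N by rewrite cardfs_gt0 complex_neq0.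
have lt : (#|` s|.-1 < n)%N.
  by rewrite -ltnS prednK // ltn_neqAle cs card_complex.
have [|t tX /andP[/eqP ct /andP[_ st]]] := X_pure lt sX.
  by rewrite /has_dim prednK.
by exists t; split=> //; exact: hull_sub hs.
Qed.

Section Facet.
Variable t : {fset point}.
Hypotheses (ct : #|` t| = n).
(** The n-simplices with the facet [t] are handled through their vertex opposite to [t]. *)
Definition apex u := u \notin t /\ u |` t \in X.

Lemma apex_card u : apex u -> #|` u |` t| = n.+1.
Proof. by case=> ut _; rewrite cardfsU1 ut ct. Qed.

Lemma apex_nsimplex u : apex u -> nsimplex (u |` t).
Proof. by move=> au; apply: complex_nsimplex (apex_card au); case: au. Qed.

(** The barycentric coordinate of the apex: an affine equation of the hyperplane spanned by [t],
positive on the side of the apex. *)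
Definition height u x := bary (u |` t) u x.

Lemma height_facet u v : apex u -> v \in t -> height u v = 0.
Proof.
move=> au vt; rewrite /height (bary_vertex (apex_nsimplex au)) ?inE ?eqxx ?vt ?orbT //.
by have [ut _] := au; rewrite (_ : u == v = false) //; apply: contraNF ut => /eqP ->.
Qed.

Lemma height_apex u : apex u -> height u u = 1.
Proof.
by move=> au; rewrite /height (bary_vertex (apex_nsimplex au)) ?inE ?eqxx.
Qed.

(** Two affine functions vanishing on [t] are proportional. *)
Lemma height_prop u u' x : apex u -> apex u' -> height u' x = height u x * height u' u.
Proof.
move=> au au'; have [ut _] := au.
rewrite {1}/height [LHS](afun_bary (apex_nsimplex au)) big_fsetU1 //=.
rewrite [X in _ + X]big_seq [X in _ + X]big1 ?addr0 // => v vt.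
by rewrite -/(bary _ _ _) -/(height _ _) height_facet // mulr0.
Qed.

Lemma height_hull u x : apex u -> hull t x -> height u x = 0.
Proof.
move=> au [l [_ l1 ->]]; rewrite /height /bary afun_sum // big_seq big1 // => v vt.
by rewrite -/(bary _ _ _) -/(height _ _) height_facet ?mulr0.
Qed.

Lemma apex_of s : s \in X -> #|` s| = n.+1 -> t `<=` s -> exists2 u, apex u & s = u |` t.
Proof.
move=> sX cs ts; have : #|` s `\` t| = 1%N.
  by rewrite cardfsD (fsetIidPr ts) cs ct subSnn.
move=> /eqP/cardfs1P[u eu]; have : u \in s `\` t by rewrite eu inE.
rewrite inE => /andP[ut us]; have es : s = u |` t.
  apply/fsetP => v; have := congr1 (fun A : {fset point} => v \in A) eu.
  rewrite !inE => <-; case: (boolP (v \in t)) => [/(fsubsetP ts) ->|_] //=.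
  by rewrite orbF.
by exists u => //; split; rewrite -?es.
Qed.

Hypothesis tX : t \in X.

Lemma apex_ex : exists u, apex u.
Proof.
have [||s sX /andP[/eqP cs /andP[_ ts]]] := X_pure (k := n.-1) _ tX.
- by rewrite prednK.
- by rewrite /has_dim ct prednK.
by have [u au _] := apex_of sX cs ts; exists u.
Qed.
(** A simplex that meets every neighbourhood of [y] contains [y], since it is closed, hence
contains [t], since [t] carries [y]. *)
Lemma near_facet y : relint t y -> \forall x \near y,
  (forall u, apex u -> forall v, v \in t -> 0 < bary (u |` t) v x) /\
  (forall s, s \in X -> #|` s| = n.+1 -> hull s x -> t `<=` s).
Proof.
move=> ry; have hy := relint_hull ry.
have [u0 au0] := apex_ex.
have ypos u v : apex u -> v \in t -> 0 < bary (u |` t) v y.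
  by move=> au vt; have [b0 _] := relint_bary (apex_nsimplex au) (fsubsetUr _ _) ry; exact: b0.
have near1 : \forall x \near y, forall s : seq_sub X,
    forall u, apex u -> val s = u |` t -> forall v, v \in t -> 0 < bary (val s) v x.
  apply: (@filter_forall _ _ _ (nbhs y)) => s.
  have [[u [au es]]|none] := pselect (exists u, apex u /\ val s = u |` t); last first.
    by apply: nearW => x u au es; case: none; exists u.
  have : \forall x \near y, forall v : t, 0 < bary (val s) (val v) x.
    apply: (@filter_forall _ _ _ (nbhs y)) => v; apply: near_afun_gt0.
    by rewrite -/(bary _ _ _) es ypos // fsvalP.
  by apply: filterS => x h u' _ _ v vt; exact: (h [` vt]).
have near2 : \forall x \near y, forall s : seq_sub X,
    #|` val s| = n.+1 -> hull (val s) x -> t `<=` val s.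
  apply: (@filter_forall _ _ _ (nbhs y)) => s; have sX := valP s.
  have [ts|ts] := boolP (t `<=` val s); first by apply: nearW => x.
  have [cs|cs] := pselect (#|` val s| = n.+1); last by apply: nearW => x.
  have ss := complex_nsimplex sX cs.
  have nhy : ~ hull (val s) y.
    move=> hs; move/negP: ts; apply; apply/fsubsetP => v vt.
    have [_ au0X] := au0.
    apply: (carrier au0X (apex_card au0) sX _ hs).
    - by apply: hull_sub hy; exact: fsubsetUr.
    - by rewrite !inE vt orbT.
    - exact: ypos.
  have [v vs bv] : exists2 v, v \in val s & bary (val s) v y < 0.
    apply: contrapT => none; apply: nhy; apply/(hull_bary ss y (fsubset_refl _)).
    split=> v vs; last by rewrite vs.
    by rewrite leNgt; apply/negP => bv; apply: none; exists v.
  move: (near_afun_lt0 bv); apply: filterS => x bx _ hx; exfalso.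
  by have := bary_ge0 ss hx vs; rewrite leNgt /bary bx.
apply: filterS (filterI near1 near2) => x [h1 h2]; split=> [u au v vt|s sX].
  by have [_ uX] := au; exact: (h1 (SeqSub uX) u).
exact: (h2 (SeqSub sX)).
Qed.

(** Start at a point of the relative interior of [t] and move towards [u']: the points
reached are interior to both n-simplices. *)
Lemma height_same_side u u' : apex u -> apex u' -> 0 < height u u' -> u = u'.
Proof.
move=> au au' hp.
have [y ry] : exists y, relint t y by apply: relint_ex; exact: complex_neq0.
have [e e0 he] := near_ray (u' - y) (near_facet ry).
have [|h1 _] := he (e / 2); first by apply/andP; split; lra.
set x := y + _ in h1.
have xh w : apex w -> height w x = e / 2 * height w u'.
  move=> aw; have := afun_line (bary_fun (w |` t) w) y u' (e / 2).
  rewrite -/(bary _ _ _) -/(height _ _) => ->.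
  by rewrite -!/(bary _ _ _) -!/(height _ _) (height_hull aw (relint_hull ry)) subr0 add0r.
have inside w : apex w -> 0 < height w u' -> forall v, v \in w |` t -> 0 < bary (w |` t) v x.
  move=> aw hw v; rewrite !inE => /orP[/eqP ->|vt]; last exact: h1.
  by rewrite -/(height _ _) xh // mulr_gt0 // divr_gt0.
have inhull w : apex w -> 0 < height w u' -> hull (w |` t) x.
  move=> aw hw; apply/(hull_bary (apex_nsimplex aw) x (fsubset_refl _)).
  by split=> v vs; [apply: ltW; exact: inside|rewrite vs].
have hp' : 0 < height u' u' by rewrite height_apex.
have [_ uX] := au; have [_ u'X] := au'.
have : u \in u' |` t.
  apply: (carrier uX (apex_card au) u'X (inhull _ au hp) (inhull _ au' hp')).
    by rewrite !inE eqxx.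
  by apply: inside => //; rewrite !inE eqxx.
by rewrite !inE; have [/negbTE -> _] := au; rewrite orbF => /eqP.
Qed.

Lemma height_opposite u u' : apex u -> apex u' -> u != u' -> height u u' < 0.
Proof.
move=> au au' uu'; rewrite ltNge; apply/negP; rewrite le_eqVlt => /orP[/eqP h0|].
  have := height_prop u' au au'; rewrite -h0 mul0r height_apex // => /eqP.
  by rewrite oner_eq0.
by move=> /(height_same_side au au') /eqP; rewrite (negbTE uu').
Qed.

(** A hyperplane has only two sides. *)
Lemma two_apices u u' u'' : apex u -> apex u' -> u != u' -> apex u'' ->
  u'' = u \/ u'' = u'.
Proof.
move=> au au' uu' au''; have [->|ne] := eqVneq u'' u; first by left.
right; apply/esym; apply: (height_same_side au' au'').
rewrite (height_prop u'' au au') nmulr_rgt0; apply: height_opposite => //.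
  by rewrite eq_sym.
by rewrite eq_sym.
Qed.
(** The two n-simplices fill the two sides of [t]. *)
Lemma facet_interior u u' y : apex u -> apex u' -> u != u' -> relint t y ->
  \forall x \near y, polyhedron X x.
Proof.
move=> au au' uu' /near_facet; apply: filterS => x [h1 _].
have inhull w : apex w -> 0 <= height w x -> polyhedron X x.
  move=> aw hw; have [_ wX] := aw; exists (w |` t) => //.
  apply/(hull_bary (apex_nsimplex aw) x (fsubset_refl _)).
  split=> v vs; last by rewrite vs.
  by move: vs; rewrite !inE => /orP[/eqP ->//|vt]; apply: ltW; exact: h1.
have [|hx] := leP 0 (height u x); first exact: inhull.
apply: (inhull u' au'); rewrite (height_prop x au au') nmulr_rge0 // ltW //.
by apply: height_opposite; rewrite // eq_sym.
Qed.

(** On the other side of [t] there is no n-simplex. *)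
Lemma facet_boundary u y : apex u -> (forall u', apex u' -> u' = u) -> relint t y ->
  \forall x \near y, height u x < 0 -> ~ polyhedron X x.
Proof.
move=> au only /near_facet; apply: filterS => x [_ h2] hx /polyhedronP[s [sX cs hs]].
have [u' au' es] := apex_of sX cs (h2 s sX cs hs).
move: hs; rewrite es (only u' au') => hs.
have := bary_ge0 (apex_nsimplex au) hs (v := u); rewrite !inE eqxx => /(_ isT).
by rewrite leNgt hx.
Qed.

Lemma below_facet u y (P : point -> Prop) : apex u -> relint t y ->
  (\forall x \near y, P x) -> exists2 x, height u x < 0 & \forall z \near x, P z.
Proof.
move=> au ry Py; have [e e0 he] := near_ray (y - u) (near_join Py).
have e2 : 0 <= e / 2 < e by apply/andP; split; lra.
exists (y + (e / 2) *: (y - u)); last exact: he.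
have := afun_line (bary_fun (u |` t) u) y u (- (e / 2)).
rewrite scaleNr -scalerN opprB => eh.
rewrite /height /bary eh -!/(bary _ _ _) -!/(height _ _).
rewrite height_apex // (height_hull au (relint_hull ry)); lra.
Qed.
(** Points of [t] are limits of points of its relative interior, which are limits of points
below [t] when no second n-simplex lies there. *)
Lemma facet_boundaryP u : apex u ->
  (forall u', apex u' -> u' = u) <->
  (hull t `<=` closure (~` polyhedron X))%classic.
Proof.
move=> au; split=> [only z hz|hcl u' au'].
  have [y0 ry0] : exists y, relint t y by apply: relint_ex; exact: complex_neq0.
  move=> B /near_join nB; have [e e0 he] := near_ray (y0 - z) nB.
  (* the step must stay in the neighbourhood and strictly inside the segment from z to y0 *)
pose d := Num.min (e / 2) (1 / 2).
  have d0 : 0 < d by rewrite lt_min; apply/andP; split; lra.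
  have d1 : d < 1 by rewrite gt_min; apply/orP; right; lra.
  have de : d < e by rewrite gt_min; apply/orP; left; lra.
  have {he} nB' := he d ltac:(by rewrite ltW).
  have ry : relint t (z + d *: (y0 - z)).
    have [l [l0 l1 lz]] := hz; have [m [m0 m1 my]] := ry0.
    exists (fun v => (1 - d) * l v + d * m v); split.
    - move=> v vt; have := l0 v vt; have := m0 v vt => mv lv.
      by apply: ltr_wpDl; [apply: mulr_ge0 => //; lra|exact: mulr_gt0].
    - by rewrite big_split /= -!mulr_sumr l1 m1; lra.
    - under eq_bigr do rewrite scalerDl -!scalerA.
      rewrite big_split /= -!scaler_sumr -lz -my scalerBr scalerBl scale1r.
      by rewrite addrA addrAC.
  have [x hx nx] := below_facet au ry (filterI nB' (facet_boundary au only ry)).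
  by have [Bx nPx] := nbhs_singleton nx; exists x; split=> //; exact: nPx.
apply/eqP/negPn/negP => u'u.
have [y ry] : exists y, relint t y by apply: relint_ex; exact: complex_neq0.
have [x [nPx Px]] := hcl y (relint_hull ry) _ (facet_interior au' au u'u ry).
exact: nPx.
Qed.

End Facet.
End Facets.

(** * Cones over a facet along a line *)

Section ConeSegment.
Variables (R : realType) (n : nat).
Local Notation point := 'rV[R]_n.
Implicit Types (s t : {fset point}) (u v w x y : point) (l : point -> R).

Lemma hull_cone t w x : w \notin t -> t != fset0 -> hull (w |` t) x <->
  exists q a, [/\ hull t q, 0 <= a <= 1 & x = q + a *: (w - q)].
Proof.
move=> wt t0; split=> [[l [l0 l1 lx]]|[q [a [[m [m0 m1 qm]] /andP[a0 a1] ->]]]].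
  have lw : 0 <= l w by apply: l0; rewrite !inE eqxx.
  have lt v : v \in t -> 0 <= l v by move=> vt; apply: l0; rewrite !inE vt orbT.
  rewrite big_fsetU1 //= in l1; rewrite big_fsetU1 //= in lx.
  have sum0 : 0 <= \sum_(v <- t) l v by rewrite big_seq sumr_ge0.
  have [e1|ne1] := eqVneq (l w) 1.
    have [q /relint_hull hq] := relint_ex t0.
    exists q, 1; rewrite ler01 lexx; split=> //.
    have s0 : \sum_(v <- t) l v = 0 by lra.
    rewrite scale1r addrC subrK lx e1 scale1r big_seq big1 ?addr0 // => v vt.
    move: s0 => /eqP; rewrite big_seq psumr_eq0; last exact: lt.
    by move=> /allP/(_ v vt); rewrite vt /= => /eqP ->; rewrite scale0r.
  have d0 : 1 - l w != 0 by rewrite subr_eq0 eq_sym.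
  have dpos : 0 < 1 - l w by rewrite lt_neqAle eq_sym d0 /=; lra.
  exists (\sum_(v <- t) (l v / (1 - l w)) *: v), (l w); split; first last.
  - have -> : \sum_(v <- t) (l v / (1 - l w)) *: v =
        (1 - l w)^-1 *: \sum_(v <- t) l v *: v.
      by rewrite scaler_sumr; apply: eq_bigr => v _; rewrite scalerA mulrC.
    set z := \sum_(v <- t) l v *: v in lx *.
    rewrite lx scalerBr addrCA; congr (_ + _).
    by rewrite -scaleNr -{1}[_ *: z]scale1r -scalerDl scalerA mulfV // scale1r.
  - by rewrite lw /=; lra.
  - exists (fun v => l v / (1 - l w)); split=> //.
      by move=> v vt; rewrite divr_ge0 ?lt ?ltW.
    by rewrite -mulr_suml (_ : \sum_(v <- t) l v = 1 - l w) ?mulfV //; lra.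
exists (fun v => if v == w then a else (1 - a) * m v).
have mE (V : nmodType) (F : R -> point -> V) : \sum_(v <- t)
    F (if v == w then a else (1 - a) * m v) v = \sum_(v <- t) F ((1 - a) * m v) v.
  apply: eq_big_seq => v vt; case: eqP => // e.
  by rewrite -e vt in wt.
split.
- move=> v; rewrite !inE; case: eqP => //= _ vt.
  by rewrite mulr_ge0 ?m0 // subr_ge0.
- by rewrite big_fsetU1 //= eqxx (mE _ (fun r _ => r)) -mulr_sumr m1; lra.
- rewrite big_fsetU1 //= eqxx (mE _ (fun r v => r *: v)).
  under [in RHS]eq_bigr do rewrite -scalerA.
  rewrite -scaler_sumr -qm scalerBl scale1r scalerBr.
  by rewrite addrCA.
Qed.

Section Segment.
Variables (x1 x2 : point) (s : R).
Hypothesis s_gt0 : 0 < s.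
Let w := x1 - s *: (x2 - x1).
Variable t : {fset point}.
Hypotheses (wt : w \notin t) (t0 : t != fset0).

(** The ray from [w] through [x1] continues to [x2].  If [x1] is in the cone but [x2] is not, the ray
hits the base of the cone between the two points. *)
Lemma cone_segment :
  (forall a, 0 <= a <= 1 -> ~ hull t (x1 + a *: (x2 - x1))) ->
  inhull (w |` t) x1 = inhull (w |` t) x2.
Proof.
have s0 := s_gt0; move=> avoid; congr (_%:R); congr nat_of_bool; apply/asboolP/asboolP; last first.
  move=> /(hull_cone x2 wt t0)[q [a [hq /andP[a0 a1] ex]]].
  apply/(hull_cone x1 wt t0); exists q, ((1 + s * a) / (1 + s)).
  have s1 : 1 + s != 0 by rewrite gt_eqF //; lra.
  have sa0 : 0 <= s * a by rewrite mulr_ge0 // ltW.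
  have sa1 : s * a <= s by rewrite ler_piMr // ltW.
  split=> //.
    by rewrite divr_ge0 ?ler_pdivrMr ?mul1r //=; lra.
  apply/rowP => j; move/rowP/(_ j): ex; rewrite /w !mxE => ex.
  apply: (mulfI s1).
  transitivity ((1 + s) * q 0 j +
    (1 + s * a) * (x1 0 j - s * (x2 0 j - x1 0 j) - q 0 j)); last by field.
  have := congr1 (fun r => s * r) ex => /= exs; lra.
move=> /(hull_cone x1 wt t0)[q [a [hq /andP[a0 a1] ex]]].
apply/(hull_cone x2 wt t0).
have [ea|na] := eqVneq a 1.
  have e12 : x2 = x1.
    apply/rowP => j; move/rowP/(_ j): ex; rewrite /w ea !mxE => ex.
    by apply: (mulfI (lt0r_neq0 s_gt0)); lra.
  by exists q, a; rewrite a0 a1; split=> //; rewrite e12.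
have d0 : 1 - a != 0 by rewrite subr_eq0 eq_sym.
have dpos : 0 < 1 - a by rewrite lt_neqAle eq_sym d0 /=; lra.
pose la := s * a / (1 - a).
have la0 : 0 <= la by rewrite divr_ge0 ?mulr_ge0 // ltW.
have eq_q : q = x1 + la *: (x2 - x1).
  apply/rowP => j; move/rowP/(_ j): ex; rewrite /w !mxE => ex.
  apply: (mulfI d0).
  have -> : (1 - a) * (x1 0 j + la * (x2 0 j - x1 0 j)) =
    (1 - a) * x1 0 j + s * a * (x2 0 j - x1 0 j) by rewrite /la; field.
  lra.
have [le1|gt1] := leP la 1.
  by case: (avoid la); rewrite ?la0 // -eq_q.
have sl0 : s + la != 0 by rewrite gt_eqF //; lra.
exists q, ((la - 1) / (s + la)); split=> //.
  by rewrite divr_ge0 ?ler_pdivrMr ?mul1r //=; lra.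
apply/rowP => j; rewrite eq_q /w !mxE; field.
exact: sl0.
Qed.

(** The base is hit between [x1] and [x2], so [x1] is in the cone; and [x2] is on the side of
the hyperplane of [t] that does not contain [w]. *)
Lemma cone_cross c a : 0 <= a <= 1 -> hull t (x1 + a *: (x2 - x1)) ->
  (forall q, hull t q -> afun c q = 0) -> 0 < afun c x1 -> afun c x2 < 0 ->
  inhull (w |` t) x1 + inhull (w |` t) x2 = 1.
Proof.
have s0 := s_gt0; move=> /andP[a0 a1] hp c0 c1 c2; rewrite /inhull asboolT; last first.
  apply/(hull_cone x1 wt t0).
  have sa0 : s + a != 0 by rewrite gt_eqF //; lra.
  exists (x1 + a *: (x2 - x1)), (a / (s + a)); split=> //.
    by rewrite divr_ge0 ?ler_pdivrMr ?mul1r //=; lra.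
  by apply/rowP => j; rewrite /w !mxE; field.
rewrite asboolF ?addr0 // => /(hull_cone x2 wt t0)[q [b [hq /andP[b0 b1] ex]]].
have := afun_line c q w b; rewrite -ex (c0 q hq) subr0 add0r => e2.
have : afun c w = afun c x1 + s * (afun c x1 - afun c x2).
  have := afun_line c x1 x2 (- s); rewrite scaleNr => ->; ring.
move=> ew; have : 0 < afun c w.
  by rewrite ew addr_gt0 // mulr_gt0 // subr_gt0 (lt_trans c2).
by move=> cw; move: c2; rewrite e2 ltNge mulr_ge0 // ltW.
Qed.

End Segment.
End ConeSegment.

(** * Homology of a convex polyhedron in degrees n and n - 1 *)

Section Acyclic.
Variables (R : realType) (n : nat) (X : seq {fset 'rV[R]_n}).
Local Notation point := 'rV[R]_n.
Implicit Types (s t : {fset point}) (u v w x y : point).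
Hypotheses (n_gt0 : (0 < n)%N) (uX : uniq X) (X_complex : simplicial_complex X).
Hypothesis X_pure : forall (k : nat) s, (k < n)%N -> s \in X -> has_dim k s ->
  exists2 t, t \in X & has_dim n t && is_face s t.
Hypothesis X_convex : convex_set (polyhedron X).

Lemma fset0_notin_complex : fset0 \notin X.
Proof. by apply/negP => /(complex_neq0 X_complex)/eqP. Qed.

Lemma complex_closed : face_closed X.
Proof. by case: X_complex. Qed.

Let X0 := fset0_notin_complex.
Let fX := complex_closed.

Lemma polyhedron_segment x y a : polyhedron X x -> polyhedron X y -> 0 <= a <= 1 ->
  polyhedron X (y + a *: (x - y)).
Proof.
move=> Px Py /andP[a0 a1].
have := X_convex (x := x) (y := y) (Itv01 a0 a1); rewrite !inE => /(_ Px Py).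
rewrite /conv /= /unstable.onem scalerBl scale1r.
by rewrite (_ : y + a *: (x - y) = a *: x + (y - a *: y)) // scalerBr addrCA.
Qed.

Definition inside s x := forall v, v \in s -> 0 < bary s v x.

Lemma inside_hull s x : nsimplex s -> inside s x -> hull s x.
Proof.
move=> ss ix; apply/(hull_bary ss x (fsubset_refl _)).
by split=> v vs; [apply: ltW; exact: ix|rewrite vs].
Qed.

Lemma inside_sub s t x : s \in X -> #|` s| = n.+1 -> t \in X -> inside s x ->
  hull t x -> s `<=` t.
Proof.
move=> sX cs tX ix ht; apply/fsubsetP => v vs.
apply: (carrier X_complex sX cs tX _ ht) => //; last exact: ix.
exact: inside_hull (complex_nsimplex X_complex sX cs) ix.
Qed.

Lemma bary_segment_gt0 s v x y a : 0 < bary s v x -> 0 < bary s v y -> 0 <= a <= 1 ->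
  0 < bary s v (x + a *: (y - x)).
Proof.
move=> ix iy /andP[a0 a1]; rewrite /bary afun_line -!/(bary _ _ _).
have [->|ne] := eqVneq a 0; first by rewrite mul0r addr0.
have -> : bary s v x + a * (bary s v y - bary s v x) =
  (1 - a) * bary s v x + a * bary s v y by ring.
apply: ltr_wpDl; first by apply: mulr_ge0; [lra|exact: ltW].
by rewrite mulr_gt0 // lt_neqAle eq_sym ne.
Qed.

Lemma inside_segment s x y a : inside s x -> inside s y -> 0 <= a <= 1 ->
  inside s (x + a *: (y - x)).
Proof. by move=> ix iy a01 v vs; apply: bary_segment_gt0; [exact: ix|exact: iy|]. Qed.

Lemma no_facet_inside s t x : s \in X -> #|` s| = n.+1 -> inside s x ->
  t \in X -> #|` t| = n -> ~ hull t x.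
Proof.
move=> sX cs ix tX ct ht; have /fsubset_leq_card := inside_sub sX cs tX ix ht.
by rewrite cs ct ltnn.
Qed.

Lemma generic_inside W s : nsimplex s -> exists2 x, inside s x & generic W x.
Proof.
move=> ss; have [y ry] : exists y, relint s y.
  by apply: relint_ex; rewrite -cardfs_gt0 ss.2.
have [b0 _] := relint_bary ss (fsubset_refl _) ry.
have near_y : \forall x \near y, forall v : s, 0 < bary s (val v) x.
  apply: (@filter_forall _ _ _ (nbhs y)) => v.
  by apply: near_afun_gt0; exact: b0 (fsvalP v).
have [x ix gx] := generic_near W near_y.
by exists x => // v vs; exact: (ix [` vs]).
Qed.

Lemma generic_notin W x : generic W x -> x \notin W.
Proof.
move=> gx; apply/negP => xW.
have := gx [fset x]; rewrite fsub1set cardfs1 => /(_ xW n_gt0) /negP; apply.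
by apply: mem_aspan; rewrite inE.
Qed.
(** At a generic point inside an n-simplex of [z] the winding number of the boundary of [z] is the
coefficient of that simplex. *)
Lemma boundary_inj z : z \in chains n ord_max -> boundary X z = 0 -> z = 0.
Proof.
move=> zC bz; apply/rowP => i; rewrite [RHS]mxE; apply/eqP/negPn/negP => zi.
have dim j : z 0 j != 0 -> #|` simp j| = n.+1 /\ simp j \in X.
  move=> /(chainsP _ _ _ zC) /andP[/eqP cj _]; split=> //.
  by apply: mem_simp; apply: simp_gt0; rewrite -cardfs_gt0 cj.
have [ci iX] := dim i zi; have ss := complex_nsimplex X_complex iX ci.
have [w _ gw] := generic_inside (vertices X) ss.
have [x ix gx] := generic_inside (w |` vertices X) ss.
have := winding_boundary uX X0 fX zC (generic_notin gw) gx.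
rewrite bz /winding big1 => [|j _]; last by rewrite mxE mul0r.
rewrite (bigD1 i) //= big1 => [|j ji].
  rewrite addr0 /inhull asboolT; last exact: inside_hull.
  by rewrite mulr1 => /esym/eqP; rewrite (negbTE zi).
have [->|/dim[cj jX]] := eqVneq (z 0 j) 0; first by rewrite mul0r.
rewrite /inhull asboolF ?mulr0 // => hj.
have sub := inside_sub iX ci jX ix hj.
have e : simp i = simp j by apply/eqP; rewrite eqEfcard sub cj ci leqnn.
by rewrite (simp_inj uX X0 e) eqxx in ji.
Qed.

Lemma avoid_finite (f : nat -> point) (W : {fset point}) : injective f ->
  exists m, f m \notin W.
Proof.
move=> f_inj; apply: contrapT => none.
have sub : {subset [seq f m | m <- iota 0 (size W).+1] <= W}.
  by move=> _ /mapP[m _ ->]; apply/negPn/negP => fW; apply: none; exists m.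
have := uniq_leq_size _ sub; rewrite map_inj_uniq ?iota_uniq // => /(_ isT).
by rewrite size_map size_iota ltnn.
Qed.

Section Winding.
Variables (c : chain X) (w0 : point).
Hypotheses (cZ : c \in cycles n.-1 ord_max) (w0V : w0 \notin vertices X).
Hypothesis w0X : polyhedron X w0.

Lemma chain_dim j : c 0 j != 0 -> #|` simp j| = n /\ simp j \in X.
Proof.
have /cyclesP[/chainsP cC _] := cZ.
move=> /cC /andP[/eqP cj _]; rewrite prednK // in cj; split=> //.
by apply: mem_simp; apply: simp_gt0; rewrite -cardfs_gt0 cj.
Qed.
(** Both winding numbers are computed from a point [w] behind [x1] on the line through
[x1] and [x2].  The factor [s] is free, which allows [w] to avoid the finitely many
vertices. *)
Lemma winding_segment x1 x2 : generic (w0 |` vertices X) x1 ->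
  generic (x1 |` (w0 |` vertices X)) x2 -> exists s : R,
  let w := x1 - s *: (x2 - x1) in
  [/\ 0 < s, w \notin vertices X & winding w0 c x1 + winding w0 c x2 =
    \sum_i c 0 i * (inhull (w |` simp i) x1 + inhull (w |` simp i) x2)].
Proof.
move=> g1 g2.
have ne : x2 - x1 != 0.
  rewrite subr_eq0; apply/eqP => e; have := generic_notin g2.
  by rewrite e !inE eqxx.
(* an infinite family of candidates for w, of which only finitely many are excluded *)
pose f m : point := x1 - m.+1%:R *: (x2 - x1).
have [|m] := @avoid_finite f (w0 |` vertices X).
  move=> a b /addrI/oppr_inj/eqP; rewrite -subr_eq0 -scalerBl scaler_eq0 (negbTE ne) orbF.
  by rewrite subr_eq0 eqr_nat => /eqP[].
rewrite !inE negb_or => /andP[fw0 fV]; exists m.+1%:R => w; split=> //.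
have [gw1 gw2] := generic_line (ltr0Sn R m) g1 g2.
rewrite -!(winding_indep uX X0 fX n_gt0 cZ fV w0V fw0) //.
rewrite -big_split /=; apply: eq_bigr => i _; rewrite mulrDr //.
Qed.

(** No base of a cone is hit between [x1] and [x2]. *)
Lemma winding_const x1 x2 : generic (w0 |` vertices X) x1 ->
  generic (x1 |` (w0 |` vertices X)) x2 ->
  (forall t a, t \in X -> #|` t| = n -> 0 <= a <= 1 -> ~ hull t (x1 + a *: (x2 - x1))) ->
  winding w0 c x1 = winding w0 c x2.
Proof.
move=> g1 g2 avoid; apply/eqP; rewrite -[winding w0 c x2]oppF2 -addr_eq0; apply/eqP.
have [s [s0 wV ->]] := winding_segment g1 g2.
rewrite big1 // => i _; have [->|/chain_dim[ci iX]] := eqVneq (c 0 i) 0.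
  by rewrite mul0r.
rewrite (@cone_segment _ _ x1 x2 s s0 (simp i)) ?addF2 ?mulr0 //.
- by apply: contra wV; apply/fsubsetP; exact: simp_sub_vertices.
- exact: complex_neq0 iX.
- by move=> a a01; exact: avoid.
Qed.

(** The only base hit between [x1] and [x2] is [simp k]. *)
Lemma winding_jump k x1 x2 d a0 : generic (w0 |` vertices X) x1 ->
  generic (x1 |` (w0 |` vertices X)) x2 -> #|` simp k| = n ->
  (forall t a, t \in X -> #|` t| = n -> t != simp k -> 0 <= a <= 1 ->
    ~ hull t (x1 + a *: (x2 - x1))) ->
  0 <= a0 <= 1 -> hull (simp k) (x1 + a0 *: (x2 - x1)) ->
  (forall q, hull (simp k) q -> afun d q = 0) -> 0 < afun d x1 -> afun d x2 < 0 ->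
  c 0 k = winding w0 c x1 + winding w0 c x2.
Proof.
move=> g1 g2 ck avoid a01 hk d0 d1 d2.
have [s [s0 wV ->]] := winding_segment g1 g2.
have wi (i : idx X) : x1 - s *: (x2 - x1) \notin simp i.
  by apply: contra wV; apply/fsubsetP; exact: simp_sub_vertices.
rewrite (bigD1 k) //= big1 ?addr0 => [|i ik]; last first.
  have [->|/chain_dim[ci iX]] := eqVneq (c 0 i) 0; first by rewrite mul0r.
  rewrite (@cone_segment _ _ x1 x2 s s0 (simp i)) ?addF2 ?mulr0 //.
    exact: complex_neq0 iX.
  move=> a a'01; apply: avoid => //.
  by apply: contra ik => /eqP/(simp_inj uX X0) ->.
rewrite (cone_cross s0 _ _ a01 hk d0 d1 d2) ?mulr1 //.
by rewrite -cardfs_gt0 ck.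
Qed.

(** The cones from [w0] over simplices of the complex stay in the convex polyhedron. *)
Lemma winding_outside x : ~ polyhedron X x -> winding w0 c x = 0.
Proof.
move=> nPx; rewrite /winding big1 // => i _.
have [->|/chain_dim[ci iX]] := eqVneq (c 0 i) 0; first by rewrite mul0r.
rewrite /inhull asboolF ?mulr0 // => /hull_cone[||q [a [hq a01 ex]]].
- by apply: contra w0V; apply/fsubsetP; exact: simp_sub_vertices.
- exact: complex_neq0 iX.
- by apply: nPx; rewrite ex; apply: polyhedron_segment => //; exists (simp i).
Qed.

End Winding.

Section FacetBoundary.
Variable j : idx X.
Hypothesis cj : #|` simp j| = n.
Local Notation t := (simp j).
Local Notation apexj := (apex X (simp j)).

Lemma facet_in : t \in X.
Proof. by apply: mem_simp; apply: simp_gt0; rewrite -cardfs_gt0 cj. Qed.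

Lemma boundary_facet z :
  boundary X z 0 j = \sum_(i | (t `<=` simp i) && has_dim n (simp i)) z 0 i.
Proof.
rewrite boundaryE [RHS]big_mkcond; apply: eq_bigr => i _.
by rewrite /has_dim cj; case: ifP; rewrite ?mulr1 ?mulr0.
Qed.

Lemma coface_apex (i : idx X) : (t `<=` simp i) && has_dim n (simp i) ->
  exists2 u, apexj u & simp i = u |` t.
Proof.
move=> /andP[ti /eqP ci]; apply: apex_of => //.
by apply: mem_simp; apply: simp_gt0; rewrite -cardfs_gt0 ci.
Qed.

Lemma apex_coface u (i : idx X) : apexj u -> simp i = u |` t ->
  (t `<=` simp i) && has_dim n (simp i).
Proof. by move=> au ei; rewrite ei fsubsetUr /has_dim (apex_card cj au) eqxx. Qed.

Lemma boundary_one u (i : idx X) z : apexj u -> (forall u', apexj u' -> u' = u) ->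
  simp i = u |` t -> z \in chains n ord_max -> boundary X z 0 j = z 0 i.
Proof.
move=> au only ei zC; rewrite boundary_facet (bigD1 i) /=; last exact: apex_coface ei.
rewrite big1 ?addr0 // => k /andP[/coface_apex[u' /only -> ek]].
by rewrite (simp_inj uX X0 (etrans ek (esym ei))) eqxx.
Qed.

Lemma boundary_two u u' (i i' : idx X) z : apexj u -> apexj u' -> u != u' ->
  simp i = u |` t -> simp i' = u' |` t -> z \in chains n ord_max ->
  boundary X z 0 j = z 0 i + z 0 i'.
Proof.
move=> au au' uu' ei ei' zC.
rewrite boundary_facet (bigD1 i) /=; last exact: apex_coface ei.
have ii' : i' != i.
  apply: contra uu' => /eqP e; have : u \in u' |` t by rewrite -ei' e ei !inE eqxx.
  by rewrite !inE; have [/negbTE -> _] := au; rewrite orbF.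
rewrite (bigD1 i') /=; last by rewrite ii' andbT; apply: apex_coface ei'.
rewrite big1 ?addr0 // => k /andP[/andP[/coface_apex[w aw ek]]].
have [e|e] := two_apices n_gt0 X_complex X_pure cj facet_in au au' uu' aw.
  by rewrite (simp_inj uX X0 (etrans ek (etrans (congr1 (fun w => w |` t) e) (esym ei)))) eqxx.
by rewrite (simp_inj uX X0 (etrans ek (etrans (congr1 (fun w => w |` t) e) (esym ei')))) eqxx.
Qed.

(** A point of the polyhedron below a boundary facet would give, by convexity,
points of the polyhedron just below that facet. *)
Lemma boundary_halfspace u x : apexj u -> (forall u', apexj u' -> u' = u) ->
  polyhedron X x -> 0 <= height t u x.
Proof.
move=> au only Px; rewrite leNgt; apply/negP => hx.
have tX := facet_in.
have [y ry] : exists y, relint t y by apply: relint_ex; exact: complex_neq0 tX.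
have [e e0 he] := near_ray (x - y)
  (facet_boundary n_gt0 X_complex X_pure cj tX au only ry).
pose d := Num.min (e / 2) 1.
have d0 : 0 < d by rewrite lt_min; apply/andP; split; lra.
have d1 : d <= 1 by rewrite ge_min; apply/orP; right; lra.
have de : d < e by rewrite gt_min; apply/orP; left; lra.
apply: (he d); first by rewrite ltW.
  have := afun_line (bary_fun (u |` t) u) y x d.
  rewrite -!/(bary _ _ _) -!/(height _ _ _) => ->.
  by rewrite (height_hull X_complex cj au (relint_hull ry)) subr0 add0r pmulr_rlt0.
apply: polyhedron_segment => //; last by rewrite ltW.
by exists t => //; exact: relint_hull.
Qed.

(** A point just across the facet [t]: the end point of the segments along which winding
numbers jump. *)
Lemma generic_below W u : apexj u -> exists x,
  [/\ generic W x, height t u x < 0 &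
    forall u', apexj u' -> forall v, v \in t -> 0 < bary (u' |` t) v x].
Proof.
move=> au; have tX := facet_in.
have [y ry] : exists y, relint t y by apply: relint_ex; exact: complex_neq0 tX.
have [x hx nx] := below_facet X_complex cj au ry
  (near_facet n_gt0 X_complex X_pure cj tX ry).
have [x' [[h1 _] hx'] gx'] := generic_near W (filterI nx (near_afun_lt0 hx)).
by exists x'; split.
Qed.

Section Crossing.
Variables (u x1 x2 : point).
Hypotheses (au : apexj u) (i1 : inside (u |` t) x1).
Hypotheses (h2 : height t u x2 < 0).
Hypothesis b2 : forall u', apexj u' -> forall v, v \in t -> 0 < bary (u' |` t) v x2.
Let p a := x1 + a *: (x2 - x1).
Let a0 := height t u x1 / (height t u x1 - height t u x2).

Let h1 : 0 < height t u x1.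
Proof. by apply: i1; rewrite !inE eqxx. Qed.

Lemma crossing_bary v a : v \in t -> 0 <= a <= 1 -> 0 < bary (u |` t) v (p a).
Proof.
move=> vt a01; apply: bary_segment_gt0 => //; last exact: b2.
by apply: i1; rewrite !inE vt orbT.
Qed.

Lemma crossing_height a :
  height t u (p a) = height t u x1 + a * (height t u x2 - height t u x1).
Proof. exact: afun_line. Qed.

Lemma crossing_range : 0 <= a0 < 1.
Proof.
have := h1; have := h2 => n2 n1.
have d : 0 < height t u x1 - height t u x2 by lra.
by rewrite divr_ge0 ?ltr_pdivrMr ?mul1r //=; lra.
Qed.

Lemma crossing_height0 : height t u (p a0) = 0.
Proof.
rewrite crossing_height /a0; field.
by rewrite subr_eq0; apply/eqP => e; have := h1; have := h2; rewrite e; lra.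
Qed.

Lemma crossing_hull a : 0 <= a <= 1 -> 0 <= height t u (p a) -> hull (u |` t) (p a).
Proof.
move=> a01 ha.
apply/(hull_bary (apex_nsimplex X_complex cj au) _ (fsubset_refl _)).
split=> v vs; last by rewrite vs.
by move: vs; rewrite !inE => /orP[/eqP ->//|vt]; apply: ltW; exact: crossing_bary.
Qed.

Lemma crossing_facet : hull t (p a0).
Proof.
have /andP[a00 a01] := crossing_range.
apply/(hull_bary (apex_nsimplex X_complex cj au) _ (fsubsetUr _ _)).
split=> v; rewrite !inE => /orP[/eqP ->|vt].
- by rewrite -/(height _ _ _) crossing_height0.
- by apply: ltW; apply: crossing_bary; rewrite // a00 ltW.
- by rewrite -/(height _ _ _) crossing_height0.
- by rewrite vt.
Qed.

(** Above [t] the segment from [x1] to [x2] runs in the interior of the n-simplex and then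
through the relative interior of [t], which meet no other facet. *)
Lemma crossing_above t' a : t' \in X -> #|` t'| = n -> t' != t -> 0 <= a <= 1 ->
  0 <= height t u (p a) -> ~ hull t' (p a).
Proof.
move=> t'X ct' ne a01 ha ht'; move/negP: ne; apply.
have [_ uX'] := au; rewrite eq_sym eqEfcard ct' cj leqnn andbT.
apply/fsubsetP => v vt.
apply: (carrier X_complex uX' (apex_card cj au) t'X (crossing_hull a01 ha) ht').
  by rewrite !inE vt orbT.
exact: crossing_bary.
Qed.

(** Below [t] the segment runs in the interior of the second n-simplex: its
coordinates are positive at [x2] and nonnegative where the segment crosses [t]. *)
Lemma crossing_below u' a : apexj u' -> u != u' -> 0 <= a <= 1 ->
  height t u (p a) < 0 -> inside (u' |` t) (p a).
Proof.
move=> au' uu' /andP[a_0 a_1] ha v; rewrite !inE => /orP[/eqP ->|vt].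
  rewrite -/(height _ _ _) (height_prop X_complex cj _ au au') nmulr_rgt0 //.
  apply: (height_opposite n_gt0 X_complex X_pure cj facet_in au' au).
  by rewrite eq_sym.
have /andP[a00 a01] := crossing_range.
have lt : a0 < a.
  rewrite ltNge; apply/negP => le; move: ha; rewrite ltNge => /negP; apply.
  have := h1; have := h2; rewrite crossing_height => n2 n1.
  have : 0 <= (a0 - a) * (height t u x1 - height t u x2) by apply: mulr_ge0; lra.
  have := crossing_height0; rewrite crossing_height; lra.
have d0 : 1 - a0 != 0 by rewrite subr_eq0 eq_sym lt_eqF.
have -> : p a = p a0 + ((a - a0) / (1 - a0)) *: (x2 - p a0).
  by apply/rowP => k; rewrite /p !mxE; field.
apply: bary_segment_gt0; last 2 first.
- exact: b2.
- by rewrite divr_ge0 ?ler_pdivrMr ?mul1r //=; lra.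
have [_ u'X] := au'.
rewrite /bary (afun_bary (apex_nsimplex X_complex cj au)) big_fsetU1 /=; last by case: au.
rewrite -!/(bary _ _ _) -[bary _ u _]/(height t u _) crossing_height0 mul0r add0r.
rewrite (big_fsetD1 v) //= big_seq big1 => [|w].
  rewrite addr0 -!/(bary _ _ _) (bary_vertex (apex_nsimplex X_complex cj au')) ?inE ?vt ?orbT //.
  by rewrite eqxx mulr1; apply: crossing_bary; rewrite // a00 ltW.
rewrite !inE => /andP[wv wt].
rewrite -!/(bary _ _ _) (bary_vertex (apex_nsimplex X_complex cj au')) ?inE ?vt ?wt ?orbT //.
by rewrite eq_sym (negbTE wv) mulr0.
Qed.

End Crossing.
End FacetBoundary.
(** The coefficient on an n-simplex is the winding number at a generic point inside it.
Across a facet with two cofaces the winding numbers differ by the coefficient of the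
facet; at a boundary facet the outer value is zero. *)
Lemma cycle_bounds c : c \in cycles n.-1 ord_max ->
  exists2 z, z \in chains n ord_max & boundary X z = c.
Proof.
move=> cZ; have [->|] := eqVneq c 0; first by exists 0; rewrite ?mem0v ?linear0.
case/matrix0Pn => [r [i0]]; rewrite ord1 => ci0.
have [ci0' i0X] := chain_dim cZ ci0.
have [u0 au0] := apex_ex n_gt0 X_pure ci0' i0X.
have [w0 iw0 gw0] := generic_inside (vertices X) (apex_nsimplex X_complex ci0' au0).
have w0V := generic_notin gw0.
have w0X : polyhedron X w0.
  exists (u0 |` simp i0); first by case: au0.
  exact: inside_hull (apex_nsimplex X_complex ci0' au0) iw0.
have in_X (i : idx X) : has_dim n (simp i) -> simp i \in X.
  by move=> /eqP ci; apply: mem_simp; apply: simp_gt0; rewrite -cardfs_gt0 ci.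
have [xs xsP] : {xs : idx X -> point & forall i, has_dim n (simp i) ->
    inside (simp i) (xs i) /\ generic (w0 |` vertices X) (xs i)}.
  apply: (choice (P := fun i x => has_dim n (simp i) -> inside (simp i) x /\ _ x)) => i.
  have [ci|_] := boolP (has_dim n (simp i)); last by exists 0.
  have [x ix gx] := generic_inside (w0 |` vertices X)
    (complex_nsimplex X_complex (in_X i ci) (eqP ci)).
  by exists x.
pose z : chain X := \row_i if has_dim n (simp i) then winding w0 c (xs i) else 0.
have zC : z \in chains n ord_max.
  apply/chainsP => i; rewrite mxE leq_ord andbT; case: ifP => //.
exists z => //; apply/rowP => j.
have [cj|cj] := eqVneq #|` simp j| n; last first.
  have -> : c 0 j = 0.
    by apply/eqP; apply: contraTT cj => /(chain_dim cZ)[-> _]; rewrite eqxx.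
  rewrite boundaryE big1 // => i _; rewrite mxE; case: ifP => [/eqP ci|_]; last by rewrite mul0r.
  by rewrite ci eqSS eq_sym (negbTE cj) andbF mulr0.
have tX := facet_in cj.
have [u au] := apex_ex n_gt0 X_pure cj tX.
have idx_of w : apex X (simp j) w -> exists i : idx X, simp i = w |` simp j.
  by move=> [_ /simp_ex[i ei _]]; exists i.
have zE w i : apex X (simp j) w -> simp i = w |` simp j -> z 0 i = winding w0 c (xs i).
  by move=> aw ei; rewrite mxE /has_dim ei (apex_card cj aw) eqxx.
have xsE w i : apex X (simp j) w -> simp i = w |` simp j ->
    inside (w |` simp j) (xs i) /\ generic (w0 |` vertices X) (xs i).
  by move=> aw ei; rewrite -ei; apply: xsP; rewrite /has_dim ei (apex_card cj aw).
have [i ei] := idx_of u au; have [ii gi] := xsE u i au ei.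
have d0 q : hull (simp j) q -> afun (bary_fun (u |` simp j) u) q = 0.
  exact: (height_hull X_complex cj au).
have [only|] := pselect (forall u', apex X (simp j) u' -> u' = u).
  have [x2 [g2 h2 b2]] := generic_below cj (xs i |` (w0 |` vertices X)) au.
  rewrite (boundary_one cj au only ei zC) (zE u) //.
  have out y : height (simp j) u y < 0 -> ~ polyhedron X y.
    by move=> hy Py; have := boundary_halfspace cj au only Py; rewrite leNgt hy.
  have [/andP[a00 a01]] := crossing_range ii h2.
  rewrite (@winding_jump c w0 cZ w0V j (xs i) x2 (bary_fun (u |` simp j) u) _ gi g2 cj
     _ _ (crossing_facet cj au ii h2 b2) d0) //.
  - by rewrite (winding_outside cZ w0V w0X (out _ h2)) addr0.
  - move=> t' a t'X ct' ne a01'.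
    have [hp|hp] := leP 0 (height (simp j) u (xs i + a *: (x2 - xs i))).
      exact: (crossing_above cj au ii b2).
    by move=> ht'; apply: (out _ hp); exists t'.
  - by rewrite a00 ltW.
  - by apply: ii; rewrite !inE eqxx.
move=> /existsNP[u' /not_implyP[au' /eqP uu']]; rewrite eq_sym in uu'.
have [i' ei'] := idx_of u' au'; have [ii' gi'] := xsE u' i' au' ei'.
have [x2 [g2 h2 b2]] := generic_below cj (xs i' |` (xs i |` (w0 |` vertices X))) au.
have g2i : generic (xs i |` (w0 |` vertices X)) x2 by apply: genericS g2; exact: fsubsetUr.
have g2i' : generic (xs i' |` (w0 |` vertices X)) x2.
  by apply: genericS g2; apply: fsetUS; exact: fsubsetUr.
rewrite (boundary_two cj au au' uu' ei ei' zC) (zE u) // (zE u') //.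
have [_ u'X] := au'.
have i2 : inside (u' |` simp j) x2.
  move=> v; rewrite !inE => /orP[/eqP ->|]; last exact: b2.
  rewrite -/(height _ _ _) (height_prop X_complex cj _ au au') nmulr_rgt0 //.
  apply: (height_opposite n_gt0 X_complex X_pure cj tX au' au).
  by rewrite eq_sym.
rewrite (winding_const cZ w0V gi' g2i'); last first.
  move=> t' a t'X ct' a01.
  exact: (no_facet_inside u'X (apex_card cj au') (inside_segment ii' i2 a01)).
have [/andP[a00 a01]] := crossing_range ii h2.
rewrite (@winding_jump c w0 cZ w0V j (xs i) x2 (bary_fun (u |` simp j) u) _ gi g2i cj
   _ _ (crossing_facet cj au ii h2 b2) d0) //.
- move=> t' a t'X ct' ne a01'.
  have [hp|hp] := leP 0 (height (simp j) u (xs i + a *: (x2 - xs i))).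
    exact: (crossing_above cj au ii b2).
  apply: (no_facet_inside u'X (apex_card cj au')) => //.
  exact: (crossing_below cj au ii h2 b2).
- by rewrite a00 ltW.
- by apply: ii; rewrite !inE eqxx.
Qed.

End Acyclic.

(** * The two cofaces of a facet *)

Section Cells.
Variables (R : realType) (n : nat) (X : seq {fset 'rV[R]_n}).
Hypotheses (n_gt0 : (0 < n)%N) (uX : uniq X) (X_complex : simplicial_complex X).
Hypothesis X_pure : forall (k : nat) (s : {fset 'rV[R]_n}), (k < n)%N ->
  s \in X -> has_dim k s -> exists2 t, t \in X & has_dim n t && is_face s t.
Hypothesis X_filtration :
  forall k : nat, (1 <= k <= size X)%N -> face_closed (take k X).

Let X0 := fset0_notin_complex X_complex.
Let fX := complex_closed X_complex.

(** The index of a face is bounded by that of the simplex because each [take k X] is closed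
under faces. *)
Lemma face_lt (i j : idx X) : is_face (simp j) (simp i) -> simp j != simp i -> (j < i)%N.
Proof.
move=> /andP[j0 ji] ne; have i0 : (0 < i)%N.
  apply: simp_gt0; apply: contraNneq j0 => e.
  by rewrite -fsubset0 -e.
have jpos := simp_gt0 j0; have ltj := ltn_ord j; have lti := ltn_ord i.
have simpE (k : idx X) : (0 < k)%N -> simp k = nth fset0 X k.-1.
  by case: k => [[|k] lt].
have szi : size (take i X) = i.
  by rewrite size_takel // -ltnS.
have iX : simp i \in take i X.
  rewrite simpE // -(@nth_take i) ?prednK // mem_nth // szi prednK //.
have ir : (1 <= i <= size X)%N by rewrite i0 -ltnS.
have := X_filtration ir iX (t := simp j); rewrite /is_face j0 ji => /(_ isT).
move=> /(nthP fset0)[k]; rewrite szi => ki; rewrite nth_take // simpE // => /eqP.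
rewrite nth_uniq //; last 2 first.
- by apply: leq_trans ki _; rewrite -ltnS.
- by rewrite prednK // -ltnS.
move=> /eqP ek; rewrite -(prednK jpos) -ek ltn_neqAle ki andbT.
apply: contra ne => /eqP e; apply/eqP; congr simp; apply: val_inj.
by rewrite /= -e ek prednK.
Qed.

(** Chains take the value zero on the outer cell. *)
Definition cell_coef (z : chain X) (c : cell X) : 'F_2 := if c is Some i then z 0 i else 0.

(** A facet has one or two apices; with one apex it lies on the topological boundary, and
the outer cell is the second coface. *)
Lemma facet_cells (j : idx X) : has_dim n.-1 (simp j) -> exists s t : cell X,
  [/\ [seq c <- enum (cell X) | cell_face j c] = [:: s; t], s != t,
    forall i, Some i \in [:: s; t] -> has_dim n (simp i) /\ (j < i)%N &
    forall z, z \in chains n ord_max ->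
      boundary X z 0 j = cell_coef z s + cell_coef z t].
Proof.
move=> /eqP; rewrite prednK // => cj; have tX := facet_in n_gt0 cj.
have j0 : simp j != fset0 by rewrite -cardfs_gt0 cj.
have [u au] := apex_ex n_gt0 X_pure cj tX.
have [i ei _] := simp_ex au.2.
pose b : cell X := if pselect (forall u', apex X (simp j) u' -> u' = u) is right h
  then [pick k | (simp j `<=` simp k) && has_dim n (simp k) & k != i] else None.
have onlyP := facet_boundaryP n_gt0 X_complex X_pure cj tX au.
have [bi [cellsP bdP]] : b != Some i /\ ((forall c, cell_face j c = (c == Some i) || (c == b))
    /\ forall z, z \in chains n ord_max ->
    boundary X z 0 j = cell_coef z (Some i) + cell_coef z b).
  rewrite /b; case: pselect => [only|nonly].
    split=> //; split=> [[k|]|z zC] /=; rewrite ?orbF ?addr0.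
    - rewrite /is_face j0 /= andbC; apply/idP/eqP => [hk|[->]].
        have [u' /only -> ek] := coface_apex cj hk.
        by congr Some; apply: (simp_inj uX X0); rewrite ek ei.
      exact: apex_coface ei.
    - by apply/asboolP; apply/onlyP.
    - exact: (boundary_one uX X_complex cj au only ei zC).
  have [u' [au' u'u]] : exists u', apex X (simp j) u' /\ u' != u.
    by move: nonly => /existsNP[u' /not_implyP[au' /eqP u'u]]; exists u'.
  have [i' ei' _] := simp_ex au'.2.
  have ii' : i' != i.
    apply: contra u'u => /eqP e; have : u' \in u |` simp j by rewrite -ei -e ei' !inE eqxx.
    by rewrite !inE; have [/negbTE -> _] := au'; rewrite orbF.
  have only2 k : (simp j `<=` simp k) && has_dim n (simp k) -> k = i \/ k = i'.
    move=> /(coface_apex cj)[w aw ek].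
    have [e|e] := two_apices n_gt0 X_complex X_pure cj tX au au' ltac:(by rewrite eq_sym) aw.
      by left; apply: (simp_inj uX X0); rewrite ek e ei.
    by right; apply: (simp_inj uX X0); rewrite ek e ei'.
  case: pickP => [k /andP[hk ki]|/(_ i')]; last first.
    by rewrite (apex_coface cj au' ei') ii'.
  have {}ki : k = i' by have [e|//] := only2 k hk; rewrite e eqxx in ki.
  rewrite ki; split; first by rewrite (inj_eq Some_inj).
  split=> [[k'|]|z zC] /=.
  - rewrite /is_face j0 /= andbC !(inj_eq Some_inj); apply/idP/orP => [/only2[]->|[]/eqP ->].
    + by left.
    + by right.
    + exact: apex_coface ei.
    + exact: apex_coface ei'.
  - by apply/asboolP => /onlyP h; move/eqP: u'u; apply; exact: h.
  - by apply: (boundary_two n_gt0 uX X_complex X_pure cj au au' _ ei ei' zC); rewrite eq_sym.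
set L := [seq c <- _ | _].
have LE c : (c \in L) = (c \in [:: Some i; b]).
  by rewrite mem_filter mem_enum andbT cellsP !inE.
have uL : uniq L by rewrite filter_uniq ?enum_uniq.
have pL : perm_eq L [:: Some i; b].
  by apply: uniq_perm => //=; rewrite inE eq_sym bi.
have lower k : Some k \in L -> has_dim n (simp k) /\ (j < k)%N.
  rewrite mem_filter mem_enum andbT /= => /andP[hk jk]; split=> //; apply: face_lt => //.
  by apply: contraTneq hk => <-; rewrite /has_dim cj neq_ltn ltnSn.
have sumL z : \sum_(c <- L) cell_coef z c = cell_coef z (Some i) + cell_coef z b.
  by rewrite (perm_big _ pL) /= big_cons big_seq1.
move: L LE uL pL lower sumL => [|s [|t [|? ?]]] LE uL pL lower sumL;
  try by have := perm_size pL.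
exists s, t; split=> //; first by move: uL; rewrite /= inE andbT.
by move=> z zC; rewrite bdP // -sumL big_cons big_seq1.
Qed.

End Cells.

(** * Invariants of the merge-tree algorithm *)

Section MergeTree.
Variables (R : realType) (n : nat) (X : seq {fset 'rV[R]_n}).
Local Notation cellX := (cell X).
Local Notation edgeX := (edge X).
Implicit Types (c d x y : cellX) (k j : idx X) (E : {set edgeX}) (V : {set cellX}).

Definition facet j := has_dim n.-1 (simp j).
Definition cofaces j := [seq c <- enum cellX | cell_face j c].

Hypothesis n_gt0 : (0 < n)%N.
Hypothesis cofacesP : forall j, facet j -> exists s t,
  [/\ cofaces j = [:: s; t], s != t &
    forall i, Some i \in [:: s; t] -> has_dim n (simp i) /\ (j < i)%N].

(** The relation whose reflexive transitive closure defines the descendants. *)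
Definition erel E := [rel x y : cellX | [exists k, (x, k, y) \in E]].
Definition parent E c := if out_edge E c is Some e then e.2 else c.
Definition is_root E c := forall k d, (c, k, d) \notin E.
Definition functional E := forall c k d k' d',
  (c, k, d) \in E -> (c, k', d') \in E -> k = k' /\ d = d'.

Lemma erelP E x y : reflect (exists k, (x, k, y) \in E) (erel E x y).
Proof. exact: existsP. Qed.

Lemma cell_rootE E c : cell_root E c = iter #|E| (parent E) c.
Proof. by []. Qed.

Lemma cell_lt_irr c : cell_lt c c = false.
Proof. by case: c => //= i; rewrite ltnn. Qed.

Lemma cell_lt_trans : transitive (@cell_lt _ _ X).
Proof. by move=> [j|] [i|] [k|] //=; exact: ltn_trans. Qed.

Lemma cell_lt_total c d : c != d -> cell_lt c d || cell_lt d c.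
Proof.
case: c d => [i|] [j|] //=; rewrite (inj_eq Some_inj) => ij.
by rewrite -neq_ltn.
Qed.

Lemma parent_root E c : is_root E c -> parent E c = c.
Proof.
rewrite /parent /out_edge => rc; case: pickP => // -[[c' k] d] /andP[/= e /eqP ec].
by have := rc k d; rewrite -ec e.
Qed.

Lemma parent_edge E c k d : functional E -> (c, k, d) \in E -> parent E c = d.
Proof.
move=> fE cd; rewrite /parent /out_edge; case: pickP => [[[c' k'] d'] /= /andP[e /eqP ec]|none].
  by move: e; rewrite ec => /(fE _ _ _ _ _ cd)[_ ->].
by have := none (c, k, d); rewrite /= cd eqxx.
Qed.

Lemma iter_fixed (T : Type) (f : T -> T) (x : T) i : f x = x -> iter i f x = x.
Proof. by move=> fx; elim: i => //= i ->. Qed.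

Lemma connect_ind (e : rel cellX) (P : cellX -> cellX -> Prop) :
  (forall x, P x x) -> (forall x y z, e x y -> P y z -> P x z) ->
  forall x y, connect e x y -> P x y.
Proof.
move=> P0 PS x y /connectP[p + ->]; elim: p x => [|z p IH] x //= /andP[xz pz].
exact: PS xz (IH z pz).
Qed.

Lemma connect_const E (T : Type) (f : cellX -> T) :
  (forall x k y, (x, k, y) \in E -> f x = f y) ->
  forall x y, connect (erel E) x y -> f x = f y.
Proof.
move=> fE; apply: connect_ind => // x y z /erelP[k /fE ->] //.
Qed.

Lemma connect_is_root E c d : is_root E c -> connect (erel E) c d = (c == d).
Proof.
move=> rc; apply/idP/eqP => [|->]; last exact: connect0.
move=> /connectP[[|z p] //= /andP[/erelP[k ck] _] _].
by have := rc k z; rewrite ck.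
Qed.
(** What the set of descendants of [c] retains from the moment when [c] stopped being a
root, through the edge with label [k]: it is a connected component of the graph restricted to the facets
after [k], which are closed under ([vol_closed]) and connect it ([vol_min]), while the facet [k] leaves it
([vol_cut]). *)
Record volume_inv E c k : Prop := VolumeInv {
  vol_index : forall x, connect (erel E) x c ->
    exists i, [/\ x = Some i, has_dim n (simp i), (k < i)%N & x = c \/ cell_lt x c];
  vol_closed : forall j s t, (k < j)%N -> facet j -> cofaces j = [:: s; t] ->
    connect (erel E) s c = connect (erel E) t c;
  vol_cut : forall s t, cofaces k = [:: s; t] ->
    connect (erel E) s c != connect (erel E) t c;
  vol_min : forall z : cellX -> 'F_2,
    (forall j s t, (k < j)%N -> facet j -> cofaces j = [:: s; t] -> z s = z t) ->
    forall x, connect (erel E) x c -> z x = z c }.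

(** The list [l] holds the indices processed so far.  [inv_merged] and [inv_same] say that two
cells have the same root exactly when processed facets connect them; connectedness is
expressed by means of functions constant across the facets, because chains
are such functions. *)
Record merge_inv (l : seq (idx X)) V E : Prop := MergeInv {
  inv_nodes : forall c, (c \in V) =
    if c is Some i then (i \in l) && has_dim n (simp i) else true;
  inv_edges : forall c k d, (c, k, d) \in E ->
    [/\ c \in V, d \in V, cell_lt c d, k \in l & facet k];
  inv_fun : functional E;
  inv_label : forall c k d c' d', (c, k, d) \in E -> (c', k, d') \in E -> c = c';
  inv_root : forall c, is_root E (cell_root E c);
  inv_connect : forall c r, is_root E r ->
    connect (erel E) c r = (cell_root E c == r);
  inv_root_node : forall c, c \in V -> cell_root E c \in V;
  inv_merged : forall j s t, j \in l -> facet j -> cofaces j = [:: s; t] ->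
    cell_root E s = cell_root E t;
  inv_same : forall z : cellX -> 'F_2,
    (forall j s t, j \in l -> facet j -> cofaces j = [:: s; t] -> z s = z t) ->
    forall c, z (cell_root E c) = z c;
  inv_volume : forall c k d, (c, k, d) \in E -> volume_inv E c k }.

Lemma merge_inv0 : merge_inv [::] [set None] finset.set0.
Proof.
have root0 c : is_root finset.set0 c by move=> k d; rewrite finset.in_set0.
have rootE c : cell_root finset.set0 c = c by rewrite cell_rootE cards0.
split=> //=.
- by move=> c; rewrite finset.in_set1; case: c.
- by move=> c k d; rewrite finset.in_set0.
- by move=> c k d k' d'; rewrite finset.in_set0.
- by move=> c k d c' d'; rewrite finset.in_set0.
- by move=> c r rr; rewrite connect_is_root // rootE.
- by move=> c; rewrite rootE.
- by move=> z _ c; rewrite rootE.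
- by move=> c k d; rewrite finset.in_set0.
Qed.

Section Step.
Variables (l : seq (idx X)) (V : {set cellX}) (E : {set edgeX}) (k : idx X).
Hypotheses (IE : merge_inv l V E) (lk : forall j, (j \in l) = (k < j)%N).

Lemma merge_inv_simplex : has_dim n (simp k) ->
  merge_inv (k :: l) (Some k |: V)%SET E.
Proof.
move=> dk; case: IE => iV iE ifun ilab iroot iconn iVr imer isame ivol.
have kfacet j : j \in k :: l -> facet j -> j \in l.
  rewrite inE => /orP[/eqP ->|//]; rewrite /facet /has_dim.
  by move: dk => /eqP ->; rewrite prednK // eqn_leq ltnn.
split=> //.
- move=> c; rewrite finset.in_setU1 iV; case: c => [i|] //=.
  rewrite (inj_eq Some_inj) inE; case: eqP => [->|] //=.
- by move=> c j d /iE[cV dV cd jl fj]; rewrite !finset.in_setU1 cV dV !orbT inE jl orbT.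
- move=> c; rewrite !finset.in_setU1 => /orP[/eqP ->|/iVr ->]; last by rewrite orbT.
  rewrite (_ : cell_root E (Some k) = Some k) ?eqxx //.
  apply: iter_fixed; apply: parent_root => j d; apply/negP => /iE[].
  by rewrite iV lk ltnn.
- by move=> j s t jl fj; apply: imer => //; exact: kfacet.
- move=> z zP; apply: isame => j s t jl; apply: zP.
  by rewrite inE jl orbT.
Qed.

Lemma merge_inv_skip : ~~ facet k -> ~~ has_dim n (simp k) -> merge_inv (k :: l) V E.
Proof.
move=> nfk ndk; case: IE => iV iE ifun ilab iroot iconn iVr imer isame ivol.
have kfacet j : j \in k :: l -> facet j -> j \in l.
  by rewrite inE => /orP[/eqP -> fk|//]; rewrite fk in nfk.
split=> //.
- move=> [i|]; rewrite iV // inE; case: eqP => [->|] //=.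
  by rewrite (negbTE ndk) andbF.
- by move=> c j d /iE[cV dV cd jl fj]; rewrite inE jl orbT.
- by move=> j s t jl fj; apply: imer => //; exact: kfacet.
- move=> z zP; apply: isame => j s t jl; apply: zP.
  by rewrite inE jl orbT.
Qed.

Lemma facet_ndim : facet k -> has_dim n (simp k) = false.
Proof. by rewrite /facet /has_dim => /eqP ->; rewrite prednK // eqn_leq ltnn andbF. Qed.

Lemma merge_inv_same s t : facet k -> cofaces k = [:: s; t] ->
  cell_root E s = cell_root E t -> merge_inv (k :: l) V E.
Proof.
move=> fk kst st; case: IE => iV iE ifun ilab iroot iconn iVr imer isame ivol.
split=> //.
- move=> [i|]; rewrite iV // inE; case: eqP => [->|] //=.
  by rewrite facet_ndim // andbF.
- by move=> c j d /iE[cV dV cd jl fj]; rewrite inE jl orbT.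
- move=> j s' t'; rewrite inE => /orP[/eqP -> _|jl]; last exact: imer.
  by rewrite kst => -[<- <-].
- move=> z zP; apply: isame => j s' t' jl; apply: zP.
  by rewrite inE jl orbT.
Qed.

(** The new edge redirects to [b] the cells with root [a] and leaves the other roots alone, so the
set of descendants changes only for [b]. *)
Lemma merge_inv_edge s t a b : facet k -> cofaces k = [:: s; t] ->
  (a = cell_root E s /\ b = cell_root E t) \/ (a = cell_root E t /\ b = cell_root E s) ->
  cell_lt a b -> merge_inv (k :: l) V ((a, k, b) |: E)%SET.
Proof.
move=> fk kst ab altb; case: IE => iV iE ifun ilab iroot iconn iVr imer isame ivol.
set E' := (_ |: E)%SET.
have inE' c j d : ((c, j, d) \in E') = ((c, j, d) == (a, k, b)) || ((c, j, d) \in E).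
  by rewrite finset.in_setU1.
have kl : k \notin l by rewrite lk ltnn.
have ra : is_root E a by case: ab => -[-> _]; exact: iroot.
have rb : is_root E b by case: ab => -[_ ->]; exact: iroot.
have a_b : a != b by apply: contraTneq altb => ->; rewrite cell_lt_irr.
have root_id r : is_root E r -> cell_root E r = r.
  by move=> rr; apply: iter_fixed; exact: parent_root.
have stV c : c \in [:: s; t] -> c \in V.
  have [s0 [t0 [e _ low]]] := cofacesP fk; move: e low; rewrite kst => -[<- <-] low.
  by case: c => [i /low[di ki]|_]; rewrite iV // lk ki.
have aV : a \in V.
  by case: ab => -[-> _]; apply: iVr; apply: stV; rewrite !inE eqxx ?orbT.
have bV : b \in V.
  by case: ab => -[_ ->]; apply: iVr; apply: stV; rewrite !inE eqxx ?orbT.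
have ifun' : functional E'.
  move=> c j d j' d'; rewrite !inE' => /orP[/eqP[-> -> ->]|cd] /orP[/eqP e|cd'].
  - by case: e => -> ->.
  - by have := ra j' d'; rewrite cd'.
  - by case: e cd => -> _ _ cd; have := ra j d; rewrite cd.
  - exact: ifun cd cd'.
have rb' : is_root E' b.
  move=> j d; rewrite inE' negb_or rb andbT.
  by apply: contra a_b => /eqP[->].
have root_E' r : is_root E r -> r != a -> is_root E' r.
  move=> rr ra' j d; rewrite inE' negb_or rr andbT.
  by apply: contra ra' => /eqP[->].
have root' c : cell_root E' c = if cell_root E c == a then b else cell_root E c.
  have pa : parent E' a = b by apply: (@parent_edge _ _ k); rewrite // inE' eqxx.
  have p_eq d : d != a -> parent E d = parent E' d.
    move=> da; have [[j [e de]]|none] := pselect (exists j e, (d, j, e) \in E).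
      rewrite (parent_edge ifun de) (@parent_edge E' d j e) // inE' de orbT //.
    have rd : is_root E d.
      by move=> j e; apply/negP => de; apply: none; exists j, e.
    by rewrite !parent_root //; exact: root_E'.
  (* a walk in the old forest halts at a, so it may stop earlier than before; the new edge then adds one step *)
have walk i : exists2 i', (i' <= i)%N & iter i' (parent E') c = iter i (parent E) c.
    elim: i => [|i [i' i'i e]] /=; first by exists 0%N.
    have [ea|ea] := eqVneq (iter i (parent E) c) a.
      by exists i'; [exact: leqW|rewrite e ea parent_root].
    by exists i'.+1; rewrite //= e p_eq.
  have cE' : #|E'| = #|E|.+1.
    by rewrite cardsU1 (_ : (a, k, b) \notin E) // ; exact: ra.
  have [i iE' ei] := walk #|E|; rewrite [LHS]cell_rootE cE'.
  rewrite -cell_rootE in ei.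
  case: eqP => [ra'|/eqP ra'].
    rewrite -(subnK iE') -addnS iterD /= ei ra' pa.
    by apply: iter_fixed; exact: parent_root.
  rewrite -(subnK (leqW iE')) iterD ei.
  by apply: iter_fixed; apply: parent_root; apply: root_E'.
have root_edge x j y : (x, j, y) \in E -> cell_root E x = cell_root E y.
  move=> xy; apply/eqP; rewrite -iconn; last exact: iroot.
  apply: (@connect_trans _ _ y); first by apply: connect1; apply/erelP; exists j.
  by rewrite iconn.
have root_edge' x j y : (x, j, y) \in E' -> cell_root E' x = cell_root E' y.
  rewrite inE' => /orP[/eqP[-> _ ->]|/root_edge e]; rewrite !root'.
    by rewrite (root_id a ra) (root_id b rb) eqxx eq_sym (negbTE a_b).
  by rewrite e.
have subE : subrel (connect (erel E)) (connect (erel E')).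
  apply: connect_sub => x y /erelP[j xy]; apply: connect1; apply/erelP; exists j.
  by rewrite inE' xy orbT.
have iconn' c r : is_root E' r -> connect (erel E') c r = (cell_root E' c == r).
  move=> rr; have ra' : r != a.
    by apply/eqP => e; have := rr k b; rewrite e inE' eqxx.
  have rr' : is_root E r by move=> j d; have := rr j d; rewrite inE' negb_or => /andP[].
  apply/idP/eqP => [/(connect_const root_edge') ->|<-].
    by rewrite root' (root_id r rr') (negbTE ra').
  rewrite root'; case: eqP => [e|_]; last by apply: subE; rewrite iconn.
  apply: (@connect_trans _ _ a); first by apply: subE; rewrite iconn ?e.
  by apply: connect1; apply/erelP; exists k; rewrite inE' eqxx.
have frozen d : d != b -> connect (erel E')^~ d =1 connect (erel E)^~ d.
  move=> db x; apply/idP/idP => [xd|]; last exact: subE.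
  move: xd db; move: x d; apply: connect_ind => [x _|x y z /erelP[j xy] IH zb].
    exact: connect0.
  move: xy; rewrite inE' => /orP[/eqP[ex _ ey]|xy].
    by have := IH zb; rewrite ey connect_is_root // eq_sym (negbTE zb).
  by apply: connect_trans (IH zb); apply: connect1; apply/erelP; exists j.
have vol_frozen c j : c != b -> volume_inv E c j -> volume_inv E' c j.
  move=> cb [v1 v2 v3 v4]; split.
  - by move=> x; rewrite frozen //; exact: v1.
  - by move=> i s1 t1; rewrite !frozen //; exact: v2.
  - by move=> s1 t1; rewrite !frozen //; exact: v3.
  - by move=> z zP x; rewrite frozen //; exact: v4.
split=> //.
- move=> [i|]; rewrite iV // inE; case: eqP => [->|] //=.
  by rewrite facet_ndim // andbF.
- move=> c j d; rewrite inE' => /orP[/eqP[-> -> ->]|/iE[cV dV cd jl fj]].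
    by rewrite inE eqxx.
  by rewrite inE jl orbT.
- move=> c j d c' d'; rewrite !inE' => /orP[/eqP[-> -> _]|cd] /orP[/eqP e|cd'].
  + by case: e.
  + by have [_ _ _] := iE _ _ _ cd'; rewrite (negbTE kl).
  + by case: e cd => _ -> _ cd; have [_ _ _] := iE _ _ _ cd; rewrite (negbTE kl).
  + exact: ilab cd cd'.
- by move=> c; rewrite root'; case: eqP => [//|/eqP ne]; exact: root_E'.
- by move=> c cV; rewrite root'; case: eqP => // _; exact: iVr.
- move=> j s1 t1; rewrite inE => /orP[/eqP -> _|jl fj js].
    rewrite kst => -[<- <-]; rewrite !root'.
    by case: ab => -[-> ->]; rewrite eqxx; case: eqP.
  by rewrite !root' (imer j s1 t1).
- move=> z zP c.
  have zP' j s1 t1 : j \in l -> facet j -> cofaces j = [:: s1; t1] -> z s1 = z t1.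
    by move=> jl; apply: zP; rewrite inE jl orbT.
  have zr := isame z zP'; rewrite root'; case: eqP => [e|_]; last exact: zr.
  rewrite -(zr c) e; have zst : z s = z t by apply: (zP k) => //; rewrite inE eqxx.
  by case: ab => -[-> ->]; rewrite !zr.
- move=> c j d; rewrite inE' => /orP[/eqP[-> -> _]|cd]; last first.
    apply: vol_frozen (ivol _ _ _ cd).
    by apply: contraTneq cd => ->; exact: rb.
  apply: vol_frozen => //; split.
  + have low : forall x y, connect (erel E) x y -> x = y \/ (x \in V /\ cell_lt x y).
      apply: connect_ind => [x|x y z /erelP[i xy] [<-|[yV yz]]]; first by left.
        by right; have [xV _ xlt _ _] := iE _ _ _ xy.
      by right; have [xV _ xlt _ _] := iE _ _ _ xy; split=> //; exact: cell_lt_trans yz.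
    move=> x /low xa; have xV : x \in V by case: xa => [->//|[]].
    have : x = a \/ cell_lt x a by case: xa => [|[]]; [left|right].
    case: x xV {xa} => [i|_ [e|]].
    * by rewrite iV => /andP[il di] h; exists i; split=> //; rewrite -lk.
    * by move: altb; rewrite -e.
    * by [].
  + move=> i s1 t1 ki fi ist; rewrite !iconn //.
    by rewrite (imer i s1 t1) ?lk.
  + move=> s1 t1; rewrite kst => -[<- <-]; rewrite !iconn //.
    by case: ab a_b => -[-> ->] => [|]; rewrite eqxx ?[_ == cell_root E s]eq_sym => /negbTE ->.
  + move=> z zP x; rewrite iconn // => /eqP <-; apply/esym; apply: isame => i s1 t1 il.
    by apply: zP; rewrite -lk.
Qed.

End Step.

Lemma merge_inv_step l G k : (forall j, (j \in l) = (k < j)%N) ->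
  merge_inv l G.1 G.2 -> let G' := merge_step k G in merge_inv (k :: l) G'.1 G'.2.
Proof.
case: G => V E lk /= IE; rewrite /merge_step.
have [dk|ndk] := boolP (has_dim n (simp k)); first exact: merge_inv_simplex.
have [fk|nfk] := boolP (has_dim n.-1 (simp k)); last exact: merge_inv_skip.
have [s [t [kst _ _]]] := cofacesP fk; rewrite -/(cofaces k) kst.
case: ifP => [lt1|nlt1]; first by apply: (merge_inv_edge IE lk fk kst _ lt1); right.
case: ifP => [lt2|nlt2]; first by apply: (merge_inv_edge IE lk fk kst _ lt2); left.
apply: (merge_inv_same IE fk kst); apply/eqP/negPn/negP => /cell_lt_total.
by rewrite nlt1 nlt2.
Qed.

Lemma merge_tree_inv :
  merge_inv [seq k : idx X <- enum (idx X) | (0 < k)%N] (merge_tree X).1 (merge_tree X).2.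
Proof.
rewrite /merge_tree; set l := [seq k <- _ | _].
have : forall i j, i \in l -> (i <= j)%N -> j \in l.
  have memL i : (i \in l) = (0 < i)%N by rewrite /l mem_filter mem_enum andbT.
  by move=> i j; rewrite !memL; exact: leq_trans.
have : sorted ltn (map val l).
  have e : sorted ltn (map val (enum (idx X))) by rewrite val_enum_ord iota_ltn_sorted.
  rewrite sorted_map in e; rewrite /l sorted_map.
  by apply: sorted_filter e => y x z; exact: ltn_trans.
elim: l => [|k l IH] sl up /=; first exact: merge_inv0.
have lt_l j : j \in l -> (k < j)%N.
  move=> jl; have := order_path_min ltn_trans sl.
  by move=> /allP/(_ (val j)); apply; exact: map_f.
apply: merge_inv_step => [j|]; last first.
  apply: IH; first exact: path_sorted sl.
  move=> i j il ij; have : j \in k :: l by apply: up ij; rewrite inE il orbT.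
  rewrite inE => /orP[/eqP ej|//].
  by move: ij; rewrite ej leqNgt lt_l.
apply/idP/idP => [/lt_l//|kj].
have : j \in k :: l by apply: (up k); rewrite ?inE ?eqxx // ltnW.
by rewrite inE => /orP[/eqP e|//]; move: kj; rewrite e ltnn.
Qed.

End MergeTree.

(** * Uniqueness of persistence diagrams *)

Section DiagramUniqueness.
Variables (N : nat) (M : pmodule 'F_2 N).
Implicit Types (D : seq ('I_N * option 'I_N)) (p : 'I_N * option 'I_N).

Lemma row_bool_neq0 (b : bool) (a : 'F_2) : (const_mx a : 'rV['F_2]_b) != 0 = b && (a != 0).
Proof.
case: b => /=; last by rewrite [const_mx a]thinmx0 eqxx.
have [->|a0] := eqVneq a 0.
  by apply/negbTE; rewrite negbK; apply/eqP/matrixP => i j; rewrite !mxE.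
apply/eqP => /matrixP/(_ ord0 ord0); rewrite !mxE => e.
by rewrite e eqxx in a0.
Qed.

Lemma row_boolE (b : bool) (v : 'rV['F_2]_b) : v = const_mx (v != 0)%:R.
Proof.
case: b v => v; last by rewrite [v]thinmx0 [RHS]thinmx0.
apply/rowP => j; rewrite !mxE ord1 [LHS]boolF2; congr (_%:R); congr nat_of_bool.
congr (~~ _); apply/eqP/eqP => [v0|->]; last by rewrite mxE.
by apply/rowP => i; rewrite ord1 v0 mxE.
Qed.

Lemma const_pid_mx (b b' : bool) (a : 'F_2) :
  (const_mx a : 'rV['F_2]_b) *m (pid_mx 1 : 'M['F_2]_(b, b')) = const_mx (b%:R * a).
Proof.
case: b'; last by rewrite [LHS]thinmx0 [RHS]thinmx0.
case: b; last by rewrite [const_mx a]thinmx0 mul0mx mul0r.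
by rewrite pid_mx_1 mulmx1 mul1r.
Qed.

(** Over the field with two elements a vector of a sum of interval modules is the set of its
nonzero components.  The image of the map from [j] to [k] corresponds to the subsets of the set of
intervals that contain both indices. *)
Lemma pdiagram_support D (phi : forall k, {linear M k ->
      pm_dsum (fun i : 'I_(size D) => interval_module 'F_2 (tnth (in_tuple D) i)) k}) :
  (forall k, bijective (phi k)) ->
  (forall (j k : 'I_N) (jk : (j <= k)%N) (x : M j), phi k (pm_map M jk x) =
    pm_map (pm_dsum (fun i : 'I_(size D) => interval_module 'F_2 (tnth (in_tuple D) i))) jk (phi j x)) ->
  forall (j k : 'I_N) (jk : (j <= k)%N),
  exists s : M k -> {set 'I_(size D)},
  let A := [set i | in_interval (tnth (in_tuple D) i) j && in_interval (tnth (in_tuple D) i) k]%SET in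
  [/\ injective s, forall x, s (pm_map M jk x) \subset A &
    forall S : {set 'I_(size D)}, S \subset A -> exists x, s (pm_map M jk x) = S].
Proof.
move=> phib nat j k jk; exists (fun x => [set i | (phi k x : dsum _) i != 0]%SET) => A.
have mapE x i : (phi k (pm_map M jk x) : dsum _) i =
    (phi j x i : 'rV_(in_interval (tnth (in_tuple D) i) j)) *m
    (pid_mx 1 : 'M['F_2]_(_, in_interval (tnth (in_tuple D) i) k)) by rewrite nat.
have aux (b : bool) (a : 'F_2) : b%:R * a != 0 -> b.
  by case: b => //; rewrite mul0r eqxx.
split.
- move=> x y /setP e; apply: (bij_inj (phib k)).
  apply: functional_extensionality_dep => i; have := e i; rewrite !finset.inE => {}e.
  by rewrite [LHS](@row_boolE (in_interval _ k)) e -row_boolE.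
- move=> x; apply/fintype.subsetP => i; rewrite !finset.inE mapE.
  rewrite [phi j x i](@row_boolE (in_interval _ j)) const_pid_mx row_bool_neq0.
  by case/andP => -> /aux ->.
- move=> S SA; have [g gK Kg] := phib j.
  exists (g (fun i => const_mx (i \in S)%:R)); apply/setP => i.
  rewrite finset.inE mapE Kg const_pid_mx row_bool_neq0.
  have := fintype.subsetP SA i; rewrite finset.inE.
  case: (i \in S) => [/(_ isT)/andP[-> ->]//|_].
  by rewrite mulr0 eqxx andbF.
Qed.

(** Both counts are binary logarithms of the cardinality of the image of the map from
[j] to [k], a property of the module alone. *)
Lemma pdiagram_rank_le D D' (j k : 'I_N) : (j <= k)%N ->
  is_pdiagram M D -> is_pdiagram M D' ->
  (count (fun p => in_interval p j && in_interval p k) D <=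
   count (fun p => in_interval p j && in_interval p k) D')%N.
Proof.
have cntE D0 : count (fun p => in_interval p j && in_interval p k) D0 =
  #|[set i | in_interval (tnth (in_tuple D0) i) j && in_interval (tnth (in_tuple D0) i) k]%SET|.
  rewrite -sum1_count big_tnth -sum1_card; apply: eq_bigl => i.
  by rewrite finset.inE.
move=> jk [_ [phi [phib phin]]] [_ [phi' [phib' phin']]]; rewrite !cntE.
have [s [s_inj _ sS]] := pdiagram_support phib phin jk.
have [s' [s'_inj sA' _]] := pdiagram_support phib' phin' jk.
set A := [set i | _]%SET in sS *; set A' := [set i | _]%SET in sA' *.
pose h (S : {set 'I_(size D)}) := if pselect (S \subset A) is left SA
  then s' (pm_map M jk (projT1 (cid (sS S SA)))) else finset.set0.
have h_inj : {in powerset A &, injective h}.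
  move=> S1 S2; rewrite !powersetE /h => S1A S2A.
  case: pselect => // S1A'; case: pselect => // S2A'.
  case: (cid _) => x1 /= <-; case: (cid _) => x2 /= <-.
  by move=> /s'_inj ->.
have : (#|powerset A| <= #|powerset A'|)%N.
  rewrite -(card_in_imset h_inj); apply: fintype.subset_leq_card.
  apply/fintype.subsetP => _ /finset.imsetP[S SA ->]; rewrite powersetE /h.
  by case: pselect => [SA'|_]; [exact: sA'|exact: finset.sub0set].
by rewrite !card_powerset leq_exp2l.
Qed.

(** Infinity is encoded as [N], the first index beyond the module, so that all intervals are
half-open intervals of natural numbers. *)
Definition death p : nat := if p.2 is Some d then d else N.

Lemma in_intervalE p k : in_interval p k = (p.1 <= k < death p)%N.
Proof.
by case: p => b [d|]; rewrite /in_interval /death //= ltn_ord.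
Qed.

(** Inclusion-exclusion over the ranks: the intervals born at [b] and dying at [e] are those
born by [b] and alive just before [e], without those born earlier or still alive at [e]. *)
Lemma pdiagram_uniq D D' : is_pdiagram M D -> is_pdiagram M D' -> perm_eq D D'.
Proof.
move=> pD pD'.
have rank (j k : 'I_N) : (j <= k)%N ->
    count (fun p => in_interval p j && in_interval p k) D =
    count (fun p => in_interval p j && in_interval p k) D'.
  by move=> jk; apply/eqP; rewrite eqn_leq !pdiagram_rank_le.
pose cnt b e D := count (fun p => (p.1 < b)%N && (e <= death p)%N) D.
have death_le p : (death p <= N)%N by case: p => b [d|] //=; rewrite /death /= ltnW.
have cntE b e : (b <= e)%N -> cnt b e D = cnt b e D'.
  move=> be; case: b be => [|b] be.
    by rewrite /cnt !(@eq_count _ _ pred0) ?count_pred0.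
  case: e be => // e be.
  have [eN|eN] := ltnP e N; last first.
    by rewrite /cnt !(@eq_count _ _ pred0) ?count_pred0 // => p;
      apply/negbTE; rewrite negb_and -!leqNgt (leq_trans (death_le p) eN) orbT.
  have be' : (b <= e)%N := be.
  have := rank (Ordinal (leq_ltn_trans be' eN)) (Ordinal eN) be.
  rewrite /cnt; congr (_ = _); apply: eq_count => p; rewrite !in_intervalE /=.
    rewrite !ltnS; case: (leqP p.1 b) => //= pb; rewrite (leq_trans pb be') /=.
    by case: (ltnP e (death p)) => [h|_]; rewrite ?andbF ?(leq_ltn_trans be' h).
  rewrite !ltnS; case: (leqP p.1 b) => //= pb; rewrite (leq_trans pb be') /=.
  by case: (ltnP e (death p)) => [h|_]; rewrite ?andbF ?(leq_ltn_trans be' h).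
rewrite /perm_eq; apply/allP => p0 p0in.
have : in_interval p0 p0.1.
  by move: p0in; rewrite mem_cat => /orP[/pD.1|/pD'.1].
rewrite in_intervalE leqnn /= => lt0; set b := p0.1 in lt0 *; set e := death p0 in lt0 *.
(* inclusion-exclusion, with the subtractions moved to the other side *)
have mult D0 : (count_mem p0 D0 + cnt b e D0 + cnt b.+1 e.+1 D0 =
    cnt b.+1 e D0 + cnt b e.+1 D0)%N.
  have ce (P : pred ('I_N * option 'I_N)) : count P D0 = (\sum_(p <- D0) P p)%N.
    by rewrite -sum1_count big_mkcond; apply: eq_bigr => p _; case: (P p).
  rewrite /cnt !ce -!big_split /=.
  apply: eq_bigr => p _.
  have -> : (p == p0) = (p.1 == b :> nat) && (death p == e).
    apply/eqP/andP => [->|[/eqP/val_inj e1 /eqP e2]]; first by rewrite !eqxx.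
    move: p p0 @b @e e1 e2 {lt0 p0in} => [b1 d1] [b2 d2] /= ->.
    rewrite /death /=; case: d1 d2 => [d1|] [d2|] //= => [/val_inj ->//|e|e].
      by have := ltn_ord d1; rewrite e ltnn.
    by have := ltn_ord d2; rewrite -e ltnn.
  by rewrite !ltnS; case: (ltngtP p.1 b); case: (ltngtP (death p) e).
have E1 : cnt b e D = cnt b e D' by apply: cntE; exact: ltnW.
have E2 : cnt b.+1 e.+1 D = cnt b.+1 e.+1 D' by apply: cntE; exact: leqW.
have E3 : cnt b.+1 e D = cnt b.+1 e D' by exact: cntE.
have E4 : cnt b e.+1 D = cnt b e.+1 D' by apply: cntE; exact: leqW (ltnW lt0).
apply/eqP/(@addIn (cnt b e D'))/(@addIn (cnt b.+1 e.+1 D')).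
by rewrite [RHS]mult -E1 -E2 -E3 -E4 mult.
Qed.

End DiagramUniqueness.

(** * The diagram read off an adapted basis *)

Section DiagramOfBasis.
Variables (P : choiceType) (X : seq {fset P}) (m : nat).
Variable D : seq (idx X * option (idx X)).
Local Notation I := 'I_(size D).
Local Notation p i := (tnth (in_tuple D) i).
Variable v : I -> chain X.
Implicit Types (k : idx X) (c : chain X) (a : I -> 'F_2).

Hypothesis D_nonempty : forall q, q \in D -> in_interval q q.1.
Hypothesis v_free : forall a, \sum_i a i *: v i = 0 -> forall i, a i = 0.
Hypothesis v_cycles : forall k c, c \in cycles m k <->
  exists2 a, (forall i, a i != 0 -> ((p i).1 <= k)%N) & c = \sum_i a i *: v i.
Hypothesis v_boundaries : forall k c, c \in boundaries m k <->
  exists2 a, (forall i, a i != 0 -> (death (p i) <= k)%N) & c = \sum_i a i *: v i.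

Definition basis_coord i c : 'F_2 := coord [tuple v i | i < size D] i c.

Lemma basis_coordE a i : basis_coord i (\sum_j a j *: v j) = a i.
Proof.
have fr : free [tuple v i | i < size D].
  apply/freeP => b b0; apply: v_free; rewrite -[RHS]b0; apply: eq_bigr => j _.
  by rewrite -tnth_nth tnth_mktuple.
rewrite -[RHS](coord_sum_free _ _ fr); congr coord; apply: eq_bigr => j _.
by rewrite -tnth_nth tnth_mktuple.
Qed.

Lemma basis_coordB i c c' : basis_coord i (c - c') = basis_coord i c - basis_coord i c'.
Proof. exact: linearB. Qed.

Lemma basis_coordP i b c c' :
  basis_coord i (b *: c + c') = b * basis_coord i c + basis_coord i c'.
Proof. exact: linearP. Qed.

Lemma cycle_coord k c i : c \in cycles m k -> basis_coord i c != 0 -> ((p i).1 <= k)%N.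
Proof. by move=> /v_cycles[a ak ->]; rewrite basis_coordE; exact: ak. Qed.

Lemma cycle_sum k c : c \in cycles m k -> c = \sum_i basis_coord i c *: v i.
Proof.
move=> /v_cycles[a ak e]; rewrite {1}e; apply: eq_bigr => i _.
by rewrite e basis_coordE.
Qed.

Definition bars k : lmodType 'F_2 :=
  pm_dsum (fun i => interval_module 'F_2 (p i)) k.

(** A homology class is sent to the coordinates of a representative; the coordinates at
the intervals not containing [k] are dropped because their space is zero. *)
Definition to_bars k (x : homology m k) : bars k :=
  fun i => const_mx (basis_coord i (vsval (vquot_repr x))).

(** Independence of the representative: boundaries only involve intervals
that have died by [k]. *)
Lemma to_bars_pi k (u : subvs_of (cycles m k)) :
  to_bars (vquot_pi (cycle_boundaries m k) u) =
  fun i => const_mx (basis_coord i (vsval u)) :> 'rV_(in_interval (p i) k).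
Proof.
apply: functional_extensionality_dep => i; rewrite /to_bars.
set r := vquot_repr _.
have /vquot_eq : vquot_pi (cycle_boundaries m k) r = vquot_pi (cycle_boundaries m k) u.
  exact: vquot_reprK.
rewrite -memv_preim lfunE /= => /v_boundaries[a ak e].
have ru : basis_coord i (vsval r) = basis_coord i (vsval u) + a i.
  by rewrite -[a i](basis_coordE a) -e basis_coordB addrC subrK.
apply/rowP => j; rewrite !mxE ru.
have [->|/ak] := eqVneq (a i) 0; first by rewrite addr0.
have : in_interval (p i) k.
  by move: (leq_ltn_trans (leq0n j) (ltn_ord j)); case: (in_interval _ _).
by rewrite in_intervalE => /andP[_ /ltn_geF ->].
Qed.

Fact to_bars_linear k : linear (@to_bars k).
Proof.
move=> b x y; rewrite -(vquot_reprK x) -(vquot_reprK y).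
rewrite [b *: vquot_pi _ _]vquot_piZ -vquot_piD !to_bars_pi.
apply: functional_extensionality_dep => i; apply/rowP => j.
by rewrite !mxE -basis_coordP.
Qed.

HB.instance Definition _ k :=
  GRing.isLinear.Build 'F_2 (homology m k) (bars k) _ (@to_bars k) (@to_bars_linear k).

Lemma to_bars_bij k : bijective (@to_bars k).
Proof.
(* the only entry of a vector of dimension one, and zero in dimension zero *)
pose entry (b : bool) (r : 'rV['F_2]_b) := \sum_j r 0 j.
have entryE (b : bool) (a : 'F_2) : entry b (const_mx a) = b%:R * a.
  rewrite /entry; under eq_bigr do rewrite mxE.
  by rewrite sumr_const card_ord mulr_natl.
have const_entry (b : bool) (r : 'rV['F_2]_b) : const_mx (entry b r) = r.
  case: b r => r; last by rewrite [LHS]thinmx0 [RHS]thinmx0.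
  by apply/rowP => j; rewrite mxE /entry big_ord1; congr (r 0 _); apply: val_inj; case: j => [[]].
have entry_in (b : bool) (r : 'rV['F_2]_b) : entry b r != 0 -> b.
  by case: b r => // r; rewrite /entry big_ord0 eqxx.
(* the cycle with given coordinates represents the preimage *)
pose lift (y : bars k) := \sum_i entry _ (y i : 'rV_(in_interval (p i) k)) *: v i.
have liftZ y : lift y \in cycles m k.
  apply/v_cycles; exists (fun i => entry _ (y i)) => // i /entry_in.
  by rewrite in_intervalE => /andP[].
exists (fun y => vquot_pi (cycle_boundaries m k) (vsproj (cycles m k) (lift y))).
  move=> x; rewrite -(vquot_reprK x) to_bars_pi; set u := vquot_repr x.
  apply/vquot_eq; rewrite -memv_preim lfunE /= vsprojK //.
  apply/v_boundaries.
  exists (fun i => (in_interval (p i) k)%:R * basis_coord i (vsval u) - basis_coord i (vsval u)).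
    move=> i; rewrite in_intervalE.
    have [->|ui] := eqVneq (basis_coord i (vsval u)) 0; first by rewrite mulr0 subrr eqxx.
    rewrite (cycle_coord (subvsP u) ui) /=; case: (ltnP k) => //= _.
    by rewrite mul1r subrr eqxx.
  rewrite [X in _ - X](cycle_sum (subvsP u)) /lift -sumrB; apply: eq_bigr => i _.
  by rewrite entryE scalerBl.
move=> y; rewrite to_bars_pi vsprojK //; apply: functional_extensionality_dep => i.
by rewrite basis_coordE const_entry.
Qed.

Lemma to_bars_natural (j k : idx X) (jk : (j <= k)%N) (x : homology m j) :
  to_bars (homology_map m jk x) =
  pm_map (pm_dsum (fun i => interval_module 'F_2 (p i))) jk (to_bars x).
Proof.
rewrite -(vquot_reprK x); set u := vquot_repr x.
rewrite [homology_map _ _ _]vquot_mapE !to_bars_pi; apply: functional_extensionality_dep => i.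
rewrite (cycle_inclE jk).
apply: (etrans _ (esym (const_pid_mx (in_interval (p i) j) (in_interval (p i) k) (basis_coord i (vsval u))))).
have [->|ui] := eqVneq (basis_coord i (vsval u)) 0; first by rewrite mulr0.
apply/rowP => q; rewrite !mxE.
have : in_interval (p i) k.
  by move: (leq_ltn_trans (leq0n q) (ltn_ord q)); case: (in_interval _ _).
rewrite !in_intervalE => /andP[_ kd].
by rewrite (cycle_coord (subvsP u) ui) (leq_ltn_trans jk kd) mul1r.
Qed.
(** A basis element born at its first index and dead from its second one on spans an
interval module, and the homology is the direct sum of these. *)
Lemma pdiagram_of_basis : is_pdiagram (persistent_homology X m) D.
Proof.
split; first exact: D_nonempty.
exists (fun k => @to_bars k : {linear _ -> _}); split; first exact: to_bars_bij.
by move=> j k jk x; exact: to_bars_natural.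
Qed.

End DiagramOfBasis.

(** * The volumes of the merge tree *)

Section Volumes.
Variables (R : realType) (n : nat) (X : seq {fset 'rV[R]_n}).
Hypotheses (n_gt0 : (0 < n)%N) (uX : uniq X) (X_complex : simplicial_complex X).
Hypothesis X_pure : forall (k : nat) (s : {fset 'rV[R]_n}), (k < n)%N ->
  s \in X -> has_dim k s -> exists2 t, t \in X & has_dim n t && is_face s t.
Hypothesis X_convex : convex_set (polyhedron X).
Hypothesis X_filtration :
  forall k : nat, (1 <= k <= size X)%N -> face_closed (take k X).
Implicit Types (b d e j k : idx X) (c x y : cell X).

Let X0 := fset0_notin_complex X_complex.
Let fX := complex_closed X_complex.
Let V := (merge_tree X).1.
Let E := (merge_tree X).2.
Let ndim (i : idx X) := has_dim n (simp i).
Local Notation below := (connect (erel E)).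

Lemma cofacesP j : facet j -> exists s t,
  [/\ cofaces j = [:: s; t], s != t &
    forall i, Some i \in [:: s; t] -> ndim i /\ (j < i)%N].
Proof.
by move=> /(facet_cells n_gt0 uX X_complex X_pure X_filtration)[s [t [e st low _]]];
  exists s, t.
Qed.

Lemma boundary_cofaces j s t z : facet j -> cofaces j = [:: s; t] ->
  z \in chains n ord_max -> boundary X z 0 j = cell_coef z s + cell_coef z t.
Proof.
move=> /(facet_cells n_gt0 uX X_complex X_pure X_filtration)[s' [t' [e _ _ bz]]].
by rewrite /cofaces e => -[<- <-]; exact: bz.
Qed.

Let IE := merge_tree_inv n_gt0 cofacesP.

Lemma mem_nodes c : (c \in V) = if c is Some i then (0 < i)%N && ndim i else true.
Proof.
by rewrite (inv_nodes IE); case: c => // i; rewrite mem_filter mem_enum andbT.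
Qed.

Lemma ndim_gt0 (i : idx X) : ndim i -> (0 < i)%N.
Proof. by move=> /eqP ci; apply: simp_gt0; rewrite -cardfs_gt0 ci. Qed.

Lemma facet_gt0 j : facet j -> (0 < j)%N.
Proof. by move=> /eqP; rewrite prednK // => cj; apply: simp_gt0; rewrite -cardfs_gt0 cj. Qed.

Lemma boundary_dim z j : z \in chains n ord_max -> boundary X z 0 j != 0 -> facet j.
Proof.
move=> /chainsP zC; rewrite boundaryE; apply: contraR => nj; apply/eqP.
rewrite big1 // => i _; have [->|/zC/andP[/eqP -> _]] := eqVneq (z 0 i) 0.
  by rewrite mul0r.
rewrite (_ : (n.+1 == _) = false) ?andbF ?mulr0 //.
by apply: contraNF nj => /eqP[e]; rewrite /facet /has_dim -e prednK.
Qed.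

Lemma edge_child c b s : (c, b, s) \in E -> exists2 d, c = Some d & ndim d.
Proof.
move=> /(inv_edges IE)[]; rewrite -/V mem_nodes; case: c => [d|] //.
by move=> /andP[_ dd] _ _ _ _; exists d.
Qed.
(** The cells whose root is a given n-simplex form, at the end of the algorithm, a chain
without boundary, because all facets have been processed and the outer cell is not among
them. *)
Lemma edge_ex d : ndim d -> exists b, exists s, (Some d, b, s) \in E.
Proof.
move=> dd; apply: contrapT => none.
have rd : is_root E (Some d).
  by move=> b s; apply/negP => h; apply: none; exists b, s.
have rfix r : is_root E r -> cell_root E r = r.
  by move=> rr; apply: iter_fixed; exact: parent_root.
pose z : chain X := \row_i (ndim i && (cell_root E (Some i) == Some d))%:R.
have zC : z \in chains n ord_max.
  by apply/chainsP => i; rewrite mxE leq_ord andbT -/(ndim i); case: (ndim i).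
have zE c : cell_coef z c = (cell_root E c == Some d)%:R.
  case: c => [i|] /=.
    rewrite mxE; case: (boolP (ndim i)) => // ndi.
    rewrite rfix => [|k s]; last by apply: contra ndi => /edge_child[_ [<-]].
    by rewrite (_ : (Some i == Some d) = false) //; apply: contraNF ndi => /eqP[->].
  rewrite rfix // => k s; apply/negP => /edge_child[d' //].
have bz : boundary X z = 0.
  apply/rowP => j; rewrite [RHS]mxE; apply/eqP/negPn/negP => bj.
  have fj := boundary_dim zC bj; have [s [t [jst _ _]]] := cofacesP fj.
  move: bj; rewrite (boundary_cofaces fj jst zC) !zE.
  rewrite (inv_merged IE _ fj jst) ?addF2 ?eqxx //.
  by rewrite mem_filter mem_enum facet_gt0.
have := boundary_inj n_gt0 uX X_complex zC bz => /matrixP/(_ 0 d).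
by rewrite !mxE dd rfix // eqxx.
Qed.
Definition volume d : chain X := \row_i (below (Some i) (Some d))%:R.

(** The label of the edge out of [d]; the dummy value concerns the indices that are not those
of n-simplices. *)
Definition birth d : idx X :=
  if pselect (ndim d) is left dd then projT1 (cid (edge_ex dd)) else ord0.

Lemma birthP d : ndim d -> exists s, (Some d, birth d, s) \in E.
Proof. by rewrite /birth => dd; case: pselect => // dd'; case: cid. Qed.

Lemma birth_uniq d b s : (Some d, b, s) \in E -> b = birth d.
Proof.
move=> h; have [_ [<-] dd] := edge_child h; have [s' h'] := birthP dd.
by have [] := inv_fun IE h h'.
Qed.

Section Volume.
Variable d : idx X.
Hypothesis dd : ndim d.

Lemma volumeP : volume_inv E (Some d) (birth d).
Proof. by have [s h] := birthP dd; exact: inv_volume IE _ _ _ h. Qed.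

Lemma volume_index (i : idx X) : below (Some i) (Some d) -> [/\ ndim i, (birth d < i)%N & (i <= d)%N].
Proof.
move=> /(vol_index volumeP)[i' [[<-] di bi h]]; split=> //.
by case: h => [[->]//|/ltnW].
Qed.

Lemma birth_lt : (birth d < d)%N.
Proof. by have [] := volume_index (connect0 _ _). Qed.

Lemma facet_birth : facet (birth d).
Proof. by have [s /(inv_edges IE)[]] := birthP dd. Qed.

Lemma volume_neq0 (i : idx X) : (volume d 0 i != 0) = below (Some i) (Some d).
Proof. by rewrite mxE; case: connect; rewrite ?oner_eq0 ?eqxx. Qed.

Lemma volume_self : volume d 0 d = 1.
Proof. by rewrite mxE connect0. Qed.

Lemma volume_chains k : (d <= k)%N -> volume d \in chains n k.
Proof.
move=> dk; apply/chainsP => i; rewrite volume_neq0 => /volume_index[di _ id].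
by rewrite [has_dim _ _]di (leq_trans id dk).
Qed.

Lemma volume_coef c : cell_coef (volume d) c = (below c (Some d))%:R.
Proof.
case: c => [i|] /=; first by rewrite mxE.
by case: (boolP (below _ _)) => // /(vol_index volumeP)[i []].
Qed.

Lemma boundary_volume j : boundary X (volume d) 0 j != 0 -> facet j /\ (j <= birth d)%N.
Proof.
move=> bj; have zC := volume_chains (k := ord_max) (leq_ord d).
have fj := boundary_dim zC bj; split=> //; rewrite leqNgt; apply/negP => bjlt.
have [s [t [jst _ _]]] := cofacesP fj.
move: bj; rewrite (boundary_cofaces fj jst zC) !volume_coef.
by rewrite (vol_closed volumeP bjlt fj jst) addF2 eqxx.
Qed.

Lemma boundary_volume_birth : boundary X (volume d) 0 (birth d) = 1.
Proof.
have zC := volume_chains (k := ord_max) (leq_ord d).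
have [s [t [jst _ _]]] := cofacesP facet_birth.
rewrite (boundary_cofaces facet_birth jst zC) !volume_coef.
by have := vol_cut volumeP jst; case: (below s _); case: (below t _); rewrite ?addr0 ?add0r.
Qed.

Lemma volume_cycle k : (birth d <= k)%N -> boundary X (volume d) \in cycles n.-1 k.
Proof.
move=> bk; apply/cyclesP; split; last exact: boundary_boundary.
apply/chainsP => j /boundary_volume[fj jb]; rewrite [has_dim _ _]fj.
exact: leq_trans bk.
Qed.

Lemma volume_eq : volume d = elem d +
  \sum_(k | has_dim n (simp k) && (birth d < k < d)%N) volume d 0 k *: elem k.
Proof.
rewrite {1}[volume d]row_sum_delta (bigD1 d) //= volume_self scale1r; congr (_ + _).
rewrite big_mkcond [RHS]big_mkcond /=; apply: eq_bigr => i _.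
have [->|id] := eqVneq i d; first by rewrite ltnn !andbF.
have [e|] := eqVneq (volume d 0 i) 0; first by rewrite e scale0r; case: ifP.
rewrite volume_neq0 => /volume_index[di bi le].
by rewrite [has_dim _ _]di bi ltn_neqAle le andbT id.
Qed.

Lemma volume_persistent : persistent_volume n (birth d, Some d) (volume d).
Proof.
split.
- exact: (volume_chains (k := ord_max) (leq_ord d)).
- exists (fun k => volume d 0 k); exact: volume_eq.
- move=> t _ /andP[bt _]; apply/eqP; apply: contraTT bt => /boundary_volume[_].
  by rewrite -leqNgt.
- by rewrite /coef boundary_volume_birth oner_eq0.
Qed.

Lemma persistent_coef z : persistent_volume n (birth d, Some d) z ->
  z 0 d = 1 /\ forall i, z 0 i != 0 -> (i <= d)%N.
Proof.
move=> [_ [al ->] _ _].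
have coefE i : (elem d + \sum_(k | has_dim n (simp k) && (birth d < k < d)%N) al k *: elem k) 0 i
    = (i == d)%:R + \sum_(k | has_dim n (simp k) && (birth d < k < d)%N) al k * (i == k)%:R.
  by rewrite !mxE summxE; congr (_ + _); apply: eq_bigr => k _; rewrite !mxE.
split.
  rewrite coefE eqxx big1 ?addr0 // => k /and3P[_ _ kd].
  by rewrite (_ : (d == k) = false) ?mulr0 //; apply: contraTF kd => /eqP ->; rewrite ltnn.
move=> i; rewrite coefE; apply: contraR; rewrite -ltnNge => di.
rewrite big1 ?addr0 => [|k /and3P[_ _ kd]].
  by rewrite (_ : (i == d) = false) //; apply: contraTF di => /eqP ->; rewrite ltnn.
rewrite (_ : (i == k) = false) ?mulr0 //; apply: contraTF di => /eqP ->.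
by rewrite -leqNgt ltnW.
Qed.

(** A persistent volume has coefficient one at [d] and is constant across each facet after its
birth: by definition for the facets before [d], and because it vanishes on both cofaces for the facets
after [d]. *)
Lemma volume_min z : persistent_volume n (birth d, Some d) z ->
  supp (volume d) \subset supp z.
Proof.
move=> pz; have [zd zle] := persistent_coef pz; have [zC _ z0 _] := pz.
apply/fintype.subsetP => i; rewrite !finset.inE volume_neq0 => id.
have := vol_min volumeP (z := cell_coef z) _ id; rewrite /= /coef zd => -> //.
move=> j s t bj fj jst.
have [jd|dj] := ltnP j d.
  have := z0 j fj; rewrite bj jd => /(_ isT); rewrite /coef (boundary_cofaces fj jst zC).
  by move=> /eqP; rewrite addr_eq0 oppF2 => /eqP.
have [s' [t' [jst' _ low]]] := cofacesP fj; rewrite jst in jst'; case: jst' => es et.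
have out c : c \in [:: s'; t'] -> cell_coef z c = 0.
  case: c => [k /low[_ jk]|//] /=; apply/eqP; apply: contraTT jk => /zle kd.
  by rewrite -leqNgt (leq_trans kd).
by rewrite es et !out // !inE eqxx ?orbT.
Qed.

Lemma volume_optimal : unique (optimal_volume n (birth d, Some d)) (volume d).
Proof.
split; first by split=> [|z pz]; [exact: volume_persistent|exact/fintype.subset_leq_card/volume_min].
move=> z [pz zmin]; have e : supp (volume d) = supp z.
  by apply/eqP; rewrite eqEcard volume_min //= zmin //; exact: volume_persistent.
apply/rowP => i; rewrite [LHS]boolF2 [RHS]boolF2; congr (_%:R); congr nat_of_bool.
by move/setP/(_ i): e; rewrite !finset.inE.
Qed.

Lemma volume_descendants : [set Some k | k in supp (volume d)]%SET = descendants V E (Some d).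
Proof.
apply/setP => c; rewrite finset.inE; apply/finset.imsetP/andP.
  move=> [i]; rewrite finset.inE volume_neq0 => id ->; split=> //.
  by have [di _ _] := volume_index id; rewrite mem_nodes ndim_gt0.
move=> [_ cd]; have [i [e _ _ _]] := vol_index volumeP cd; exists i => //.
by rewrite finset.inE volume_neq0 -e.
Qed.

End Volume.

Lemma birth_inj d d' : ndim d -> ndim d' -> birth d = birth d' -> d = d'.
Proof.
move=> /birthP[s h] /birthP[s' h'] e; rewrite e in h.
by have [] := inv_label IE h h'.
Qed.

(** The leading term of the volume of [d] is [d], so volumes can be subtracted one
at a time. *)
Lemma volume_span (m : nat) z : z \in chains n ord_max ->
  (forall i, z 0 i != 0 -> (i < m)%N) ->
  exists2 a : idx X -> 'F_2, forall d, a d != 0 -> ndim d /\ (d < m)%N &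
    z = \sum_d a d *: volume d.
Proof.
elim: m z => [|m IH] z zC zm.
  exists (fun=> 0) => [d|]; first by rewrite eqxx.
  under eq_bigr do rewrite scale0r.
  rewrite big1 //; apply/rowP => i; rewrite [RHS]mxE; apply/eqP/negPn/negP => /zm.
  by rewrite ltn0.
have [[i [ei zi]]|none] := pselect (exists i, nat_of_ord i = m /\ z 0 i != 0); last first.
  have [|a am ->] := IH z zC.
    move=> i zi; have := zm i zi; rewrite ltnS leq_eqVlt => /orP[/eqP ei|//].
    by case: none; exists i.
  by exists a => // d /am[dd dm]; split=> //; exact: leqW.
have /andP[di _] := chainsP _ _ _ zC i zi.
have [||a am e] := IH (z - volume i).
- by rewrite memvB // volume_chains // leq_ord.
- move=> j; rewrite mxE [X in _ + X]mxE => zj.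
  have jm : (j <= m)%N.
    have [zj0|/zm//] := eqVneq (z 0 j) 0; move: zj; rewrite zj0 add0r oppr_eq0 volume_neq0.
    by move=> /(volume_index di)[_ _]; rewrite ei.
  rewrite ltn_neqAle jm andbT; apply: contra zj => /eqP ej.
  have -> : j = i by apply: val_inj; rewrite /= ej ei.
  by rewrite volume_self // subr_eq0 -neq0F2.
exists (fun d => a d + (d == i)%:R) => [d|].
  have [->|ne] := eqVneq d i; first by rewrite ei ltnSn.
  by rewrite addr0 => /am[dd dm]; split=> //; exact: leqW.
rewrite -[z](subrK (volume i)) e; under [RHS]eq_bigr do rewrite scalerDl.
rewrite big_split /=; congr (_ + _); rewrite (bigD1 i) //= eqxx scale1r big1 ?addr0 //.
by move=> j /negbTE ->; rewrite scale0r.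
Qed.

Lemma volume_free (a : idx X -> 'F_2) : (forall d, a d != 0 -> ndim d) ->
  \sum_d a d *: volume d = 0 -> forall d, a d = 0.
Proof.
move=> an s0 d; apply/eqP/negPn/negP => ad.
(* the leading term of the combination *)
have [i ai imax] := @arg_maxnP _ d (fun i => a i != 0) val ad.
have /matrixP/(_ 0 i) := s0; rewrite summxE (bigD1 i) //= big1 => [|j ji].
  by rewrite addr0 !mxE connect0 mulr1 => /eqP; rewrite (negbTE ai).
have [e|aj] := eqVneq (a j) 0; first by rewrite e scale0r mxE.
rewrite mxE; apply/eqP; rewrite mulf_eq0 (negbTE aj) /=.
rewrite -[_ == _]negbK volume_neq0; apply/negP => /(volume_index (an j aj))[_ _ le].
move/negP: ji; apply; apply/eqP/val_inj/eqP.
by rewrite eqn_leq [(val j <= val i)%N]imax.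
Qed.

(** The leading terms of the boundaries of volumes are their births, which are distinct, so
no cancellation lowers the largest of them. *)
Lemma volume_birth (a : idx X -> 'F_2) k : (forall d, a d != 0 -> ndim d) ->
  \sum_d a d *: boundary X (volume d) \in chains n.-1 k ->
  forall d, a d != 0 -> (birth d <= k)%N.
Proof.
move=> an cC d ad.
have [i ai imax] := @arg_maxnP _ d (fun i => a i != 0) (fun i => birth i) ad.
apply: leq_trans (imax d ad) _.
suff e : (\sum_d a d *: boundary X (volume d)) 0 (birth i) = a i.
  have : (\sum_d a d *: boundary X (volume d)) 0 (birth i) != 0 by rewrite e.
  by move=> /(chainsP _ _ _ cC)/andP[].
rewrite summxE (bigD1 i) //= big1 => [|j ji].
  by rewrite addr0 mxE boundary_volume_birth ?mulr1 ?an.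
have [e|aj] := eqVneq (a j) 0; first by rewrite e scale0r mxE.
rewrite mxE; apply/eqP; rewrite mulf_eq0 (negbTE aj) /=.
rewrite -[_ == _]negbK; apply/negP => /(boundary_volume (an j aj))[_ le].
move/negP: ji; apply; apply/eqP; apply: birth_inj; rewrite ?an //.
by apply: val_inj; apply/eqP; rewrite eqn_leq [(val (birth j) <= _)%N]imax.
Qed.

Definition tree_diagram : seq (idx X * option (idx X)) :=
  [seq (birth d, Some d) | d <- enum (idx X) & ndim d].

Lemma tree_diagramP p : p \in tree_diagram <-> exists2 d, ndim d & p = (birth d, Some d).
Proof.
split=> [/mapP[d]|[d dd ->]]; first by rewrite mem_filter => /andP[dd _] ->; exists d.
by apply/mapP; exists d => //; rewrite mem_filter mem_enum andbT.
Qed.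

Lemma tree_diagram_uniq : uniq tree_diagram.
Proof.
rewrite map_inj_uniq; first by rewrite filter_uniq ?enum_uniq.
by move=> d d' [].
Qed.

Section Bars.
Let D := tree_diagram.
Local Notation I := 'I_(size D).
Let bar (i : I) : idx X := odflt ord0 (tnth (in_tuple D) i).2.

Lemma tnth_bar i : tnth (in_tuple D) i = (birth (bar i), Some (bar i)) /\ ndim (bar i).
Proof.
have /tree_diagramP[d dd e] : tnth (in_tuple D) i \in D by exact: mem_tnth.
by rewrite /bar e.
Qed.

Lemma bar_inj : injective bar.
Proof.
move=> i j e; have [ei _] := tnth_bar i; have [ej _] := tnth_bar j.
apply/val_inj/eqP; rewrite -(nth_uniq (ord0, None) (ltn_ord i) (ltn_ord j) tree_diagram_uniq).
have nthE (q : I) : nth (ord0, None) tree_diagram q = tnth (in_tuple D) q.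
  by rewrite (tnth_nth (ord0, None)).
by rewrite !nthE ei ej e.
Qed.

Lemma sum_bars (F : idx X -> chain X) : \sum_i F (bar i) = \sum_(d | ndim d) F d.
Proof.
rewrite /bar -(big_tnth _ _ D xpredT (fun p => F (odflt ord0 p.2))).
by rewrite /D /tree_diagram big_map big_filter big_enum_cond.
Qed.

Lemma pull_bars (a : idx X -> 'F_2) (F : idx X -> chain X) :
  (forall d, a d != 0 -> ndim d) ->
  \sum_d a d *: F d = \sum_i a (bar i) *: F (bar i).
Proof.
move=> an; rewrite (sum_bars (fun d => a d *: F d)) [RHS]big_mkcond; apply: eq_bigr => d _.
case: ifPn => // nd; have [->|/an] := eqVneq (a d) 0; first by rewrite scale0r.
by rewrite (negbTE nd).
Qed.

(** The diagram indexes bars by positions in a list, and the triangularity arguments index them by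
n-simplices; this and [pull_bars] translate families of coefficients. *)
Lemma push_bars (a : I -> 'F_2) : exists a' : idx X -> 'F_2,
  [/\ forall i, a' (bar i) = a i, forall d, a' d != 0 -> exists i, bar i = d /\ a i != 0,
    forall d, a' d != 0 -> ndim d &
    forall F : idx X -> chain X, \sum_i a i *: F (bar i) = \sum_d a' d *: F d].
Proof.
pose a' d := \sum_(i | bar i == d) a i.
have aE i : a' (bar i) = a i.
  rewrite /a' (bigD1 i) //= big1 ?addr0 // => j /andP[/eqP/bar_inj ->].
  by rewrite eqxx.
have a'P d : a' d != 0 -> exists i, bar i = d /\ a i != 0.
  move=> ad; apply: contrapT => none; move/eqP: ad; apply.
  rewrite /a' big1 // => i /eqP e; apply/eqP/negPn/negP => ai.
  by apply: none; exists i.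
have a'n d : a' d != 0 -> ndim d by move=> /a'P[i [<- _]]; case: (tnth_bar i).
exists a'; split=> // F; rewrite (pull_bars F a'n).
by apply: eq_bigr => i _; rewrite aE.
Qed.

Lemma boundary_sum (J : finType) (a : J -> 'F_2) (F : J -> chain X) :
  boundary X (\sum_d a d *: F d) = \sum_d a d *: boundary X (F d).
Proof. by rewrite linear_sum; apply: eq_bigr => d _; rewrite linearZ. Qed.
(** A cycle of X_k is a boundary in X, hence a combination of boundaries of volumes, with
births at most [k] by [volume_birth]; a boundary in X_k bounds a chain of X_k, hence a combination of
volumes of simplices of X_k. *)
Lemma tree_is_pdiagram : is_pdiagram (persistent_homology X n.-1) tree_diagram.
Proof.
have n1 : n.-1.+1 = n by rewrite prednK.
apply: (pdiagram_of_basis (v := fun i => boundary X (volume (bar i)))).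
- move=> p /tree_diagramP[d dd ->]; rewrite in_intervalE leqnn /=.
  exact: birth_lt.
- move=> a; have [a' [aE _ an aF]] := push_bars a.
  rewrite (aF (fun d => boundary X (volume d))) -boundary_sum => b0 i.
  rewrite -aE; apply: volume_free (bar i) => //.
  apply: (boundary_inj n_gt0 uX X_complex) b0.
  apply: memv_suml => d _; have [->|/an dd] := eqVneq (a' d) 0.
    by rewrite scale0r mem0v.
  by rewrite memvZ // volume_chains // leq_ord.
- move=> k c; split=> [cZ|[a ak ->]].
    have [z zC bz] : exists2 z, z \in chains n ord_max & boundary X z = c.
      apply: (cycle_bounds n_gt0 uX X_complex X_pure X_convex).
      by apply: (subvP (cycles_mono _ (k := ord_max) (leq_ord k))) cZ.
    have [a am ez] := volume_span zC (fun i _ => ltn_ord i).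
    have an d : a d != 0 -> ndim d by move=> /am[].
    have ec : c = \sum_d a d *: boundary X (volume d) by rewrite -bz ez boundary_sum.
    exists (fun i => a (bar i)); last by rewrite ec (pull_bars _ an).
    move=> i ai; have [-> _] := tnth_bar i; apply: (volume_birth an _ ai).
    by rewrite -ec; case/cyclesP: cZ.
  apply: memv_suml => i _; have [->|/ak] := eqVneq (a i) 0; first by rewrite scale0r mem0v.
  have [-> di] := tnth_bar i => bi; rewrite memvZ //.
  exact: volume_cycle.
- move=> k c; split=> [/boundariesP[z]|[a ak ->]].
    rewrite n1 => zC ->.
    have [||a am ez] := @volume_span k.+1 z.
    + by apply: (subvP (chains_mono _ (k := ord_max) (leq_ord k))) zC.
    + by move=> i /(chainsP _ _ _ zC)/andP[].
    have an d : a d != 0 -> ndim d by move=> /am[].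
    exists (fun i => a (bar i)); last by rewrite ez boundary_sum (pull_bars _ an).
    by move=> i /am[_]; have [-> _] := tnth_bar i.
  apply/boundariesP; exists (\sum_i a i *: volume (bar i)); last by rewrite boundary_sum.
  rewrite n1; apply: memv_suml => i _.
  have [->|/ak] := eqVneq (a i) 0; first by rewrite scale0r mem0v.
  have [-> di] := tnth_bar i => bi; rewrite memvZ //.
  exact: volume_chains.
Qed.

End Bars.

Lemma tree_diagram_edges b c : (b, c) \in tree_diagram <->
  exists2 s, s \in V & (c, b, s) \in E.
Proof.
split=> [/tree_diagramP[d dd [-> ->]]|[s sV h]].
  by have [s h] := birthP dd; have [_ sV _ _ _] := inv_edges IE h; exists s.
have [d ec dd] := edge_child h; apply/tree_diagramP; exists d => //.
by rewrite ec in h *; rewrite (birth_uniq h).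
Qed.

Lemma optimal_volumeE d z : ndim d ->
  optimal_volume n (birth d, Some d) z <-> z = volume d.
Proof.
move=> dd; have [vo vu] := volume_optimal dd.
by split=> [/vu//|->].
Qed.

Lemma supp_volume d (i : idx X) : (i \in supp (volume d)) = below (Some i) (Some d).
Proof. by rewrite finset.inE /coef mxE; case: connect; rewrite ?eqxx ?oner_eq0. Qed.

Lemma volume_proper d d' : ndim d -> ndim d' -> below (Some d) (Some d') -> d != d' ->
  supp (volume d) \proper supp (volume d').
Proof.
move=> dd dd' lt ne; apply/properP; split.
  by apply/fintype.subsetP => i; rewrite !supp_volume => id; exact: connect_trans lt.
exists d'; first by rewrite supp_volume connect0.
rewrite supp_volume; apply/negP => gt; move/eqP: ne; apply; apply: val_inj; apply/eqP.
have [_ _ le] := volume_index dd' lt; have [_ _ ge] := volume_index dd gt.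
by rewrite eqn_leq [(val d <= _)%N]le [(val d' <= _)%N]ge.
Qed.

Lemma below_step c c' k w : below c c' -> c != c' -> (c, k, w) \in E -> below w c'.
Proof.
move=> /connectP[[|y p] /= + ->]; first by rewrite eqxx.
move=> /andP[/erelP[k' cy] yp] _ cw.
have [_ ->] := inv_fun IE cw cy; apply/connectP; by exists p.
Qed.

(** Nesting of volumes is the descendant relation, and in a forest nothing lies strictly between
a node and its parent. *)
Lemma child_edges d d' : ndim d -> ndim d' ->
  is_child n tree_diagram (birth d, Some d) (birth d', Some d') <->
  exists2 s, s \in V & ((Some d, birth d, Some d') \in E) && ((Some d', birth d', s) \in E).
Proof.
move=> dd dd'; have vE e z : ndim e -> optimal_volume n (birth e, Some e) z -> z = volume e.
  by move=> de /optimal_volumeE ->.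
have vo e : ndim e -> optimal_volume n (birth e, Some e) (volume e).
  by move=> de; exact/optimal_volumeE.
split=> [[zp [zq [/(vE _ _ dd) -> /(vE _ _ dd') -> sub nobtw]]]|[s sV /andP[h h']]].
  have [s' h'] := birthP dd'; have [_ sV' _ _ _] := inv_edges IE h'.
  exists s'; rewrite ?h' ?andbT //.
  have ne : d != d' by apply: contraTneq sub => ->; rewrite fintype.properxx.
  have lt : below (Some d) (Some d').
    rewrite -supp_volume; apply: (fintype.subsetP (fintype.proper_sub sub)).
    by rewrite supp_volume connect0.
  have [w hw] := birthP dd.
  have wd' : below w (Some d') by apply: below_step lt _ hw; rewrite (inj_eq Some_inj).
  have [e [ew de _ _]] := vol_index (volumeP dd') wd'; rewrite ew in hw wd'.
  have [<-|ed'] := eqVneq e d'; first by [].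
  case: nobtw; exists (birth e, Some e), (volume e); split.
  - by apply/tree_diagramP; exists e.
  - exact: vo.
  - apply: volume_proper => //.
      by apply: connect1; apply/erelP; exists (birth d).
    have [_ _ lt' _ _] := inv_edges IE hw.
    by apply: contraTneq lt' => ->; rewrite /= ltnn.
  - exact: volume_proper.
have lt : below (Some d) (Some d') by apply: connect1; apply/erelP; exists (birth d).
have ne : d != d'.
  by have [_ _ lt' _ _] := inv_edges IE h; apply: contraTneq lt' => ->; rewrite /= ltnn.
exists (volume d), (volume d'); split; [exact: vo|exact: vo|exact: volume_proper|].
move=> [r [zr [/tree_diagramP[e de ->] /(vE _ _ de) -> sub1 sub2]]].
have de' : below (Some d) (Some e).
  rewrite -supp_volume; apply: (fintype.subsetP (fintype.proper_sub sub1)).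
  by rewrite supp_volume connect0.
have d_e : d != e by apply: contraTneq sub1 => ->; rewrite fintype.properxx.
have d'e : below (Some d') (Some e).
  by apply: below_step de' _ h; rewrite (inj_eq Some_inj).
move: sub2; rewrite fintype.properE => /andP[_ /negP]; apply.
by apply/fintype.subsetP => i; rewrite !supp_volume => id'; exact: connect_trans d'e.
Qed.

End Volumes.

(** * The persistence trees of a convex polyhedron *)

Theorem theorem9 (R : realType) (n : nat) (X : seq {fset 'rV[R]_n})
  (n_gt0 : (0 < n)%N)
  (X_distinct : uniq X)
  (X_complex : simplicial_complex X)
  (X_pure : forall (k : nat) (s : {fset 'rV[R]_n}), (k < n)%N ->
     s \in X -> has_dim k s ->
     exists2 t, t \in X & has_dim n t && is_face s t)
  (X_convex : convex_set (polyhedron X))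
  (X_filtration : forall k : nat, (1 <= k <= size X)%N -> face_closed (take k X)) :
  let V := (merge_tree X).1 in
  let E := (merge_tree X).2 in
  let H := persistent_homology X n.-1 in
  (exists D, is_pdiagram H D) /\
  forall D, is_pdiagram H D ->
  [/\ uniq D /\
      (forall (b : idx X) (d : cell X),
         (b, d) \in D <-> exists2 s : cell X, s \in V & (d, b, s) \in E),
      forall p, p \in D ->
        exists z : chain X, unique (optimal_volume n p) z /\
          [set Some k | k in supp z] = descendants V E p.2
    & forall p q, p \in D -> q \in D ->
        (is_child n D p q <->
         exists2 s : cell X, s \in V & ((p.2, p.1, q.2) \in E) && ((q.2, q.1, s) \in E))].
Proof.
move=> V E H.
have pd := tree_is_pdiagram n_gt0 X_distinct X_complex X_pure X_convex X_filtration.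
set D0 := tree_diagram _ _ _ _ _ in pd.
have D0P p := tree_diagramP n_gt0 X_distinct X_complex X_pure X_filtration p.
split=> [|D pD]; first by exists D0.
have pe : perm_eq D D0 := pdiagram_uniq pD pd.
have memE p : (p \in D) = (p \in D0) by exact: perm_mem.
split.
- split; first by rewrite (perm_uniq pe) tree_diagram_uniq.
  by move=> b d; rewrite memE; exact: tree_diagram_edges.
- move=> p; rewrite memE => /D0P[d dd ->]; eexists; split.
    exact: volume_optimal dd.
  exact: volume_descendants.
- move=> p q; rewrite !memE => /D0P[d dd ->] /D0P[d' dd' ->].
  rewrite -(child_edges n_gt0 X_distinct X_complex X_pure X_filtration dd dd').
  by split=> -[zp [zq [op oq sub nobtw]]]; exists zp, zq; split=> // -[r [zr [rD rest1 rest2 rest3]]];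
    apply: nobtw; exists r, zr; split=> //; move: rD; rewrite memE.
Qed.
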